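(* Suppose that $$\int_1^\infty g^{-1/m}(\zeta)\,\zeta^{1/m-1}\,d\zeta<\infty \qquad\text{and}\qquad \int_{\Omega\setminus S}\gamma\left(\frac{1}{f(x)}\right)dx<\infty .$$ Let $$k=n-\liminf_{r\to+0}\frac{\log\operatorname{mes}(S_r\setminus S)}{\log r},$$ and suppose that there exists a real number $\delta>0$ such that $$\lim_{r\to+0} r^{\,n-k-m-\delta}\,G^{-1}\left(C\,r\,\operatorname{ess\,inf}_{S_r\setminus S} f^{1/m}\right)=0$$ for all real numbers $C>0$, where $G^{-1}$ is the inverse function to $$G(t)=\int_t^\infty g^{-1/m}(\zeta)\,\zeta^{1/m-1}\,d\zeta .$$ Then the singular set $S$ is removable for any weak solution $u$ of the inequality $$\sum_{|\alpha|=m}\partial^\alpha a_\alpha(x,u)\ge f(x)\,g(|u|)\quad\text{in }\Omega\setminus S .$$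
   Context: Setting. $m,n\ge1$ are integers, $\Omega\subset\mathbb R^n$ is a bounded domain, $S$ is a compact subset of $\Omega$. For each multi-index $\alpha$ with $|\alpha|=m$, $a_\alpha:\Omega\times\mathbb R\to\mathbb R$ is a Caratheodory function, and there is a constant $A>0$ with $|a_\alpha(x,\zeta)|\le A|\zeta|$ for almost all $x\in\Omega$ and all $\zeta\in\mathbb R$. $f:\Omega\to[0,\infty)$ is measurable. $g:[0,\infty)\to[0,\infty)$ is twice continuously differentiable, $g(0)=0$, and $g(\zeta)>0$, $g'(\zeta)>0$, $g''(\zeta)>0$ for all $\zeta\in(0,\infty)$. Notation. For $\omega\subset\mathbb R^n$ and $r>0$, $\omega_r$ is the set of points of $\mathbb R^n$ whose distance to $\omega$ is less than $r$. $\operatorname{mes}$ is Lebesgue measure on $\mathbb R^n$. Weak solution. $u$ is a weak solution of $\sum_{|\alpha|=m}\partial^\alpha a_\alpha(x,u)\ge f(x)g(|u|)$ in $\Omega\setminus S$ if $u\in L_1(\Omega\setminus S_r)$ and $f(x)g(|u|)\in L_1(\Omega\setminus S_r)$ for any $r>0$, and $$\int_\Omega\sum_{|\alpha|=m}(-1)^m a_\alpha(x,u)\,\partial^\alpha\varphi\,dx\ge\int_\Omega f(x)g(|u|)\varphi\,dx\qquad( * )$$ for any non-negative $\varphi\in C_0^\infty(\Omega\setminus S)$. Removability. The singular set $S$ is removable (for $u$) if $u\in L_1(\Omega)$, $f(x)g(|u|)\in L_1(\Omega)$, and $( * )$ holds for all non-negative $\varphi\in C_0^\infty(\Omega)$;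 here $u$ is extended by zero to $S$. The function $\gamma$. The Legendre transformation of $g$ is $g^*(\xi)=\int_{g'(0)}^{\xi}(g')^{-1}(\zeta)\,d\zeta$ for $\xi>g'(0)$ and $g^*(\xi)=0$ for $\xi\le g'(0)$, where $(g')^{-1}$ is the inverse function to $g'$; and $\gamma(\xi)=g^*(\xi)/\xi$ for $\xi>0$. Conventions: $\gamma(1/f(x))=+\infty$ where $f(x)=0$, and $G^{-1}(0)=+\infty$. *)

(* Defs.v *)
From HB Require Import structures.
From mathcomp Require Import all_boot all_order all_algebra.
From mathcomp Require Import all_classical all_reals all_analysis.
From mathcomp Require Import ess_sup_inf.

Set Implicit Arguments.
Unset Strict Implicit.
Unset Printing Implicit Defensive.

Import Order.TTheory GRing.Theory Num.Theory.
Import numFieldNormedType.Exports.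

Local Open Scope classical_set_scope.
Local Open Scope ring_scope.

(* Lebesgue outer measure is the infimum of the total volumes of countable
   covers by half-open boxes; the measurable sets are those satisfying
   Caratheodory's criterion, so the sigma-algebra is the complete Lebesgue one,
   and not only the Borel one. *)

Section lebesgue_outer.
Variables (R : realType) (n : nat).
Implicit Types (ab : 'rV[R]_n * 'rV[R]_n) (A : set 'rV[R]_n).

Definition box ab : set 'rV[R]_n :=
  [set x | forall i, ab.1 0 i < x 0 i <= ab.2 0 i].

(* [box ab] is empty as soon as [ab.2 0 i <= ab.1 0 i] for some [i]. *)
Definition box_volume ab : R := \prod_(i < n) Num.max 0 (ab.2 0 i - ab.1 0 i).

Definition lebesgue_outer A : \bar R :=
  ereal_inf [set \esum_(ab in C) (box_volume ab)%:E | C in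
    [set C | countable C /\ A `<=` \bigcup_(ab in C) box ab]].

Let box_volume_ge0 ab : (0 <= (box_volume ab)%:E)%E.
Proof. by rewrite lee_fin; apply: prodr_ge0 => i _; rewrite le_max lexx. Qed.

Let lebesgue_outer_ge0 A : (0 <= lebesgue_outer A)%E.
Proof. by apply: le_ereal_inf_tmp => _ [C _ <-]; exact: esum_ge0. Qed.

Let lebesgue_outer0 : lebesgue_outer set0 = 0%E.
Proof.
apply/eqP; rewrite eq_le lebesgue_outer_ge0 andbT.
apply: ereal_inf_lbound; exists set0; last by rewrite esum_set0.
by split; [exact: countable0|exact: sub0set].
Qed.

Let le_lebesgue_outer : {homo lebesgue_outer : A B / A `<=` B >-> (A <= B)%E}.
Proof.
move=> A B AB; apply: ereal_inf_le_tmp => x [C [cC BC] <-].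
by exists C => //; split=> //; exact: subset_trans BC.
Qed.

Let lebesgue_outer_sigma_subadditive : sigma_subadditive lebesgue_outer.
Proof.
move=> A; have [[i ioo]|] := pselect (exists i, lebesgue_outer (A i) = +oo%E).
  rewrite (eseries_pinfty _ _ ioo) ?leey// => k _.
  by rewrite -ltNye (lt_le_trans _ (lebesgue_outer_ge0 _)).
rewrite -forallNE => Aoo; apply/lee_addgt0Pr => e e0.
rewrite (le_trans _ (epsilon_trick _ _ (ltW e0)))//.
have en0 k : 0 < e / (2 ^ k.+1)%:R by rewrite divr_gt0// ltr0n expn_gt0.
have [C PC] : {C : nat -> set ('rV[R]_n * 'rV[R]_n) & forall k,
    [/\ countable (C k), A k `<=` \bigcup_(ab in C k) box ab &
    (\esum_(ab in C k) (box_volume ab)%:E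
       <= lebesgue_outer (A k) + (e / (2 ^ k.+1)%:R)%:E)%E]}.
  apply: (@choice _ _ (fun k D => [/\ countable D,
    A k `<=` \bigcup_(ab in D) box ab &
    (\esum_(ab in D) (box_volume ab)%:E
       <= lebesgue_outer (A k) + (e / (2 ^ k.+1)%:R)%:E)%E])) => k.
  have Afin : lebesgue_outer (A k) \is a fin_num.
    by rewrite ge0_fin_numE// ltey; apply/eqP; exact: Aoo.
  have [_ [D [cD AD] <-] Dlt] := lb_ereal_inf_adherent (en0 k) Afin.
  by exists D; split => //; exact: ltW.
apply: (@le_trans _ _ (\esum_(ab in \bigcup_k C k) (box_volume ab)%:E)%E).
  apply: ereal_inf_lbound; exists (\bigcup_k C k) => //; split.
    by apply: bigcup_countable => // k _; have [] := PC k.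
  move=> x [k _ Akx]; have [_ /(_ _ Akx)[ab Cab abx] _] := PC k.
  by exists ab => //; exists k.
rewrite seqDU_bigcup_eq.
rewrite (nneseries_sum_bigcup (@trivIset_seqDU _ C) box_volume_ge0).
apply: lee_nneseries => [k _ _|k _]; first exact: esum_ge0.
have [_ _] := PC k; apply: le_trans.
rewrite [leLHS]esum_mkcond [leRHS]esum_mkcond; apply: le_esum => ab _.
case: ifPn => [|_]; last by case: ifPn.
by move=> /set_mem /(@subset_seqDU _ C k) Cab; rewrite mem_set.
Qed.

HB.instance Definition _ := isOuterMeasure.Build R 'rV[R]_n lebesgue_outer
  lebesgue_outer0 lebesgue_outer_ge0 le_lebesgue_outer
  lebesgue_outer_sigma_subadditive.

End lebesgue_outer.

HB.instance Definition _ (R : realType) (n : nat) :=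
  Measurable.copy 'rV[R]_n (caratheodory_type (@lebesgue_outer R n)).

Definition mes {R : realType} {n : nat} : set 'rV[R]_n -> \bar R :=
  @lebesgue_outer R n.

HB.instance Definition _ (R : realType) (n : nat) :=
  isMeasure.Build _ 'rV[R]_n R (@mes R n)
    (@caratheodory_measure0 _ _ (@lebesgue_outer R n))
    (@caratheodory_measure_ge0 _ _ (@lebesgue_outer R n))
    (@caratheodory_measure_sigma_additive _ _ (@lebesgue_outer R n)).

Section geometry.
Variables (R : realType) (n : nat).

(* The library's norm on ['rV[R]_n] is the sup norm: it gives the right
   topology, but not the Euclidean distance. *)
Definition enorm (x : 'rV[R]_n) : R := Num.sqrt (\sum_(i < n) x 0 i ^+ 2).

Definition nbhd_of (w : set 'rV[R]_n) (r : R) : set 'rV[R]_n :=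
  [set x | exists2 y, w y & enorm (x - y) < r].

Definition bounded_domain (Omega : set 'rV[R]_n) :=
  [/\ open Omega, connected Omega, Omega !=set0 & bounded_set Omega].

End geometry.

(* Multi-indices of order exactly [m]; each component is then at most [m]. *)
Definition multi_index (n m : nat) : finType :=
  {al : {ffun 'I_n -> 'I_m.+1} | (\sum_(i < n) al i == m)%N}.

Section test_functions.
Variables (R : realType) (n : nat).
Implicit Types (phi : 'rV[R]_n -> R).

Definition partial (i : 'I_n) phi : 'rV[R]_n -> R :=
  fun x => derive phi x (delta_mx 0 i).

Definition partials (s : seq 'I_n) phi : 'rV[R]_n -> R := foldr partial phi s.

Definition partial_multi (m : nat) (al : multi_index n m) phi : 'rV[R]_n -> R :=
  partials (flatten [seq nseq (val al i) i | i <- enum 'I_n]) phi.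

Definition smooth phi := forall s : seq 'I_n,
  continuous (partials s phi) /\
  forall i x, derivable (partials s phi) x (delta_mx 0 i).

Definition support_of phi : set 'rV[R]_n := closure [set x | phi x != 0].

Definition test_function (U : set 'rV[R]_n) phi :=
  [/\ smooth phi, compact (support_of phi) & support_of phi `<=` U].

End test_functions.

Section nonlinearity.
Variable R : realType.
Implicit Types (g : R -> R).

(* [g] is a function on [0, +oo[ given by an arbitrary extension to [R], whose
   values at negative numbers must play no role: derivatives are taken along
   [0, +oo[, hence are right derivatives at 0 and the usual ones elsewhere. *)
Definition halfline_quotient g (x : R) : set_system R :=
  h^-1 * (g (x + h) - g x) @[h --> within [set h | 0 <= x + h] 0^'].

Definition halfline_derivable g (x : R) := cvg (halfline_quotient g x).

Definition halfline_derive g (x : R) : R := lim (halfline_quotient g x).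

Definition halfline_C2 g :=
  [/\ forall x, 0 <= x -> halfline_derivable g x,
      forall x, 0 <= x -> halfline_derivable (halfline_derive g) x &
      {within `[0, +oo[, continuous (halfline_derive (halfline_derive g))}].

Definition admissible_g g :=
  [/\ halfline_C2 g, g 0 = 0, forall z, 0 <= z -> 0 <= g z &
      forall z, 0 < z -> [/\ 0 < g z, 0 < halfline_derive g z &
                             0 < halfline_derive (halfline_derive g) z]].

Definition derive_inv g : R -> R :=
  'pinv_(fun=> 0) `[0, +oo[ (halfline_derive g).

Definition legendre g (xi : R) : R :=
  if xi <= halfline_derive g 0 then 0
  else \int[lebesgue_measure]_(z in `[halfline_derive g 0, xi]) derive_inv g z.

Definition gamma_fun g (xi : R) : R := legendre g xi / xi.

(* gamma (1 / y), with the convention that it is +oo at y = 0 *)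
Definition gamma_of_inv g (y : R) : \bar R :=
  if y == 0 then +oo%E else (gamma_fun g (1 / y))%:E.

Definition G_integrand (m : nat) g (z : R) : R :=
  g z `^ (- m%:R^-1) * z `^ (m%:R^-1 - 1).

Definition G_fun (m : nat) g (t : R) : R :=
  \int[lebesgue_measure]_(z in `[t, +oo[) G_integrand m g z.

(* [G_fun m g] decreases from +oo to 0 on ]0, +oo[; its inverse is extended by
   +oo at 0 and by 0 at +oo. The value at negative numbers is irrelevant. *)
Definition G_inv (m : nat) g (s : \bar R) : \bar R :=
  match s with
  | EFin s => if s == 0 then +oo%E
              else ('pinv_(fun=> 0) `]0, +oo[ (G_fun m g) s)%:E
  | +oo%E => 0%E
  | -oo%E => +oo%E
  end.

End nonlinearity.

Section inequality.
Variables (R : realType) (n m : nat) (Omega : set 'rV[R]_n).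
Implicit Types (S U D : set 'rV[R]_n) (a : multi_index n m -> 'rV[R]_n -> R -> R).
Implicit Types (f u : 'rV[R]_n -> R) (g : R -> R).

Definition caratheodory_function (a : 'rV[R]_n -> R -> R) :=
  (forall z, measurable_fun Omega (a ^~ z)) /\
  {ae mes, forall x, Omega x -> continuous (a x)}.

(* The essential infimum over [D] of [h]: the library's [ess_inf] is over the
   whole space. *)
Definition ess_inf_on D (h : 'rV[R]_n -> R) : \bar R :=
  ess_inf mes (patch (fun=> +oo%E) D (EFin \o h)).

Definition in_L1 D u := mes.-integrable D (EFin \o u).

Definition weak_inequality a f g u U :=
  forall phi, test_function U phi -> (forall x, 0 <= phi x) ->
  \int[mes]_(x in Omega) (f x * g `|u x| * phi x) <=
  \int[mes]_(x in Omega)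
    (\sum_(al : multi_index n m)
       (-1) ^+ m * a al x (u x) * partial_multi al phi x).

(* The values of [u] on [S] play no role here. *)
Definition weak_solution a f g S u :=
  (forall r, 0 < r -> in_L1 (Omega `\` nbhd_of S r) u /\
     in_L1 (Omega `\` nbhd_of S r) (fun x => f x * g `|u x|)) /\
  weak_inequality a f g u (Omega `\` S).

Definition extend_by_zero S u : 'rV[R]_n -> R := patch (fun=> 0) (~` S) u.

Definition removable a f g S u :=
  let u0 := extend_by_zero S u in
  [/\ in_L1 Omega u0, in_L1 Omega (fun x => f x * g `|u0 x|) &
      weak_inequality a f g u0 Omega].

End inequality.

(* Main.v *)
(* Let J(r) be the integral of f g(|u|) outside S_r and A(r, s) that of |u| over the
   layer S_s \ S_r. Testing the inequality with a function equal to 1 near S but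
   vanishing on S_r, with m-th derivatives of size (s - r)^-m, gives
     J(s) <= K (s - r)^-m A(r, s) + C.
   Conversely, convexity of g and f >= q := ess inf f on S_s \ S give
     mes(S_s \ S) q g(A(r, s) / (2 mes(S_s \ S))) <= J(r) - J(s).
   Were J unbounded near 0, combining the two would double J along radii whose
   total decrease is controlled by G, and the assumption on G^-1, together with
   mes(S_r \ S) <= r^(n - k - delta/2), makes this decrease too small to exhaust
   the radius: J would blow up at a positive radius. So f g(|u|) is integrable,
   and u is integrable by Young's inequality with the integrability of
   gamma(1/f). The same two inequalities then yield A(r/2, r) = o(r^m), so the
   error of cutting a test function off near S tends to 0. *)
Require Import Defs.
From HB Require Import structures.
From mathcomp Require Import all_boot all_order all_algebra.
From mathcomp Require Import all_classical all_reals all_analysis.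
From mathcomp Require Import ess_sup_inf measurable_realfun ring lra zify.

Set Implicit Arguments.
Unset Strict Implicit.
Unset Printing Implicit Defensive.

Import Order.TTheory GRing.Theory Num.Theory.
Import numFieldNormedType.Exports.

Local Open Scope classical_set_scope.
Local Open Scope ring_scope.

(** * Lebesgue measure on row vectors *)

(** Eliminating [A] turns the two inequalities into [J(r) - J(s) >= V e^m g(c^m (s - r)^m J(s) /
    V)], where [V = mes(S_rho \ S)] and [e] is the essential infimum of [f^(1/m)]. If [y] is the
    argument of [g], doubling [J] costs a decrease of the radius of order [(y / g(y))^(1/m) / e].
    Along [y = (3/2)^i y0] these costs form a Riemann sum for the integral of
    [(y / g(y))^(1/m) dy / y], which is [G]: this is how the tail condition enters. The initial [y0]
    is of order [rho^m / V], hence at least of order [rho^(m - (n - k) + delta/2)]; the other half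
    of [delta] absorbs the constants, and the hypothesis on [G^-1] bounds the total cost by a small
    multiple of [rho]. Since [S] is an arbitrary compact set, the distance to it is not smooth:
    cutoffs with derivatives of the right size are built from bumps centred at lattice points. The
    growth bound on the coefficients holds only almost everywhere, so they are truncated before the
    estimates; and [S] may have positive measure, which matters when the inequality is extended
    across it. *)

Lemma esum_image_le (R : realType) (T T' : choiceType) (P : set T)
    (e : T -> T') (a : T' -> \bar R) : (forall y, 0 <= a y)%E ->
  (\esum_(y in e @` P) a y <= \esum_(x in P) a (e x))%E.
Proof.
move=> a0.
have /choice[s sP] : forall y, exists x : option T,
    (e @` P) y -> exists2 z, x = Some z & P z /\ e z = y.
  move=> y; have [[x Px <-]|nPy] := pselect ((e @` P) y).
    by exists (Some x) => _; exists x.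
  by exists None.
(* One preimage is kept for each point of the image, so that [e] is injective on [D]; different
   boxes of a cover may have the same trace after a cut, which is why only an inequality holds. *)
pose D := [set x | P x /\ s (e x) = Some x].
have -> : e @` P = e @` D.
  apply/seteqP; split=> [y Py|y [x [Px _] <-]]; last by exists x.
  have [z sz [Pz ezy]] := sP y Py.
  by exists z => //; split => //; rewrite ezy.
rewrite esum_image; last first.
  move=> x y /set_mem[_ sx] /set_mem[_ sy] exy.
  by apply: Some_inj; rewrite -sx -sy exy.
rewrite [leRHS](esumID D) => [|//].
rewrite [X in \esum_(i in X) _](_ : D = P `&` D)//; last first.
  by apply/seteqP; split=> [x [Px]|x []//]; split.
by rewrite leeDl// esum_ge0.
Qed.

(* Cutting each box of a cover along the hyperplane splits its volume additively. *)
Lemma halfspace_measurable (R : realType) (n : nat) (i : 'I_n) (c : R) :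
  measurable [set x : 'rV[R]_n | x 0 i <= c].
Proof.
apply: le_caratheodory_measurable => X.
apply: le_ereal_inf_tmp => _ [C [cC XC] <-].
pose lo (ab : 'rV[R]_n * 'rV[R]_n) : 'rV[R]_n * 'rV[R]_n :=
  (ab.1, \row_j if j == i then Num.min (ab.2 0 j) c else ab.2 0 j).
pose up (ab : 'rV[R]_n * 'rV[R]_n) : 'rV[R]_n * 'rV[R]_n :=
  (\row_j if j == i then Num.max (ab.1 0 j) c else ab.1 0 j, ab.2).
have vol0 (ab : 'rV[R]_n * 'rV[R]_n) : (0 <= (box_volume ab)%:E)%E.
  by rewrite lee_fin; apply: prodr_ge0 => j _; rewrite le_max lexx.
have volE ab : box_volume ab = box_volume (lo ab) + box_volume (up ab).
  have split_max (p q : R) : Num.max 0 (q - p) =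
      Num.max 0 (Num.min q c - p) + Num.max 0 (q - Num.max p c).
    case: (leP q c) => ?; case: (leP p c) => ?;
      by rewrite !maxEle; repeat (case: ifPn; rewrite -?ltNge => ?); lra.
  rewrite /box_volume (bigD1 i)//= [X in _ = X + _](bigD1 i)//=.
  rewrite [X in _ = _ + X](bigD1 i)//= !mxE eqxx split_max mulrDl.
  by congr (_ * _ + _ * _); apply: eq_bigr => j /negbTE ji; rewrite !mxE ji.
have sub (F : 'rV[R]_n * 'rV[R]_n -> 'rV[R]_n * 'rV[R]_n) (Y : set 'rV[R]_n) :
    (forall ab, C ab -> box ab `&` Y `<=` box (F ab)) ->
    (lebesgue_outer (X `&` Y) <= \esum_(ab in C) (box_volume (F ab))%:E)%E.
  move=> FY; apply: (@le_trans _ _ (\esum_(ab in F @` C) (box_volume ab)%:E)%E).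
    apply: ereal_inf_lbound; exists (F @` C) => //; split.
      exact: sub_countable (card_image_le _ _) cC.
    move=> x [/XC[ab Cab abx] Yx]; exists (F ab); first by exists ab.
    by apply: FY => //; split.
  by apply: (@esum_image_le _ _ _ _ F (fun ab => (box_volume ab)%:E)).
rewrite (eq_esum (fun ab _ => congr1 EFin (volE ab))).
under eq_esum do rewrite EFinD.
rewrite esumD//; apply: leeD; apply: sub => ab _ x [abx /= xc] j.
- rewrite /lo/= mxE; case: eqP => [->|_]; last exact: abx.
  by have /andP[-> xb] := abx i; rewrite le_min xb.
- rewrite /up/= mxE; case: eqP => [->|_]; last exact: abx.
  by have /andP[xa ->] := abx i; rewrite gt_max xa/= andbT ltNge; apply/negP.
Qed.

Lemma box_measurable (R : realType) (n : nat) (ab : 'rV[R]_n * 'rV[R]_n) :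
  measurable (box ab).
Proof.
rewrite (_ : box ab = \bigcap_(i in [set: 'I_n])
  ([set x : 'rV[R]_n | x 0 i <= ab.2 0 i] `&`
   ~` [set x : 'rV[R]_n | x 0 i <= ab.1 0 i])).
  apply: fin_bigcap_measurable => // i _; apply: measurableI.
    exact: halfspace_measurable.
  exact/measurableC/halfspace_measurable.
apply/seteqP; split=> [x abx i _|x abx i].
  by have /andP[xa xb] := abx i; split => //=; apply/negP; rewrite -ltNge.
by have [/= -> /negP] := abx i Logic.I; rewrite -ltNge andbT.
Qed.

(** An open set is the union of the boxes with rational corners that it contains, and there are
    countably many of these. *)
Lemma open_rV_measurable (R : realType) (n : nat) (U : set 'rV[R]_n) :
  open U -> measurable U.
Proof.
move=> oU.
pose rbox (pq : 'rV[rat]_n * 'rV[rat]_n) : set 'rV[R]_n :=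
  box (map_mx ratr pq.1, map_mx ratr pq.2).
rewrite (_ : U = \bigcup_pq (if `[< rbox pq `<=` U >] then rbox pq else set0)).
  apply: countable_bigcupT_measurable; first exact: countableP.
  by move=> pq; case: ifPn => _; [exact: box_measurable|exact: measurable0].
apply/seteqP; split=> [x Ux|x [pq _]]; last by case: asboolP => // + ?; exact.
have /nbhs_ballP[e /= e0 xeU] : nbhs x U by exact: open_nbhs_nbhs.
have /choice[p pP] : forall i : 'I_n, exists q : rat, ratr q \in `](x 0 i - e), (x 0 i)[.
  by move=> i; apply: rat_in_itvoo; lra.
have /choice[q qP] : forall i : 'I_n, exists q : rat, ratr q \in `](x 0 i), (x 0 i + e)[.
  by move=> i; apply: rat_in_itvoo; lra.
exists (\row_i p i, \row_i q i) => //.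
have rx : rbox (\row_i p i, \row_i q i) x.
  move=> i; rewrite !mxE.
  by have := pP i; have := qP i; rewrite !in_itv/=; lra.
rewrite asboolT// => y ry; apply: xeU; split=> [//|i j]; rewrite (ord1 i).
have := ry j; rewrite !mxE; have := pP j; have := qP j; rewrite !in_itv/=.
move=> H1 H2 H3; rewrite /ball/= ltr_norml; apply/andP; split; lra.
Qed.

Lemma closed_rV_measurable (R : realType) (n : nat) (U : set 'rV[R]_n) :
  closed U -> measurable U.
Proof.
by move=> cU; rewrite -[U]setCK; apply/measurableC/open_rV_measurable/closed_openC.
Qed.

Lemma continuous_rV_measurable (R : realType) (n : nat) (D : set 'rV[R]_n)
    (phi : 'rV[R]_n -> R) :
  continuous phi -> measurable D -> measurable_fun D phi.
Proof.
move=> cphi mD; apply: (measurability _ (measurable_realfun.RGenOInfty.measurableE R)).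
move=> _ [_ [x ->] <-]; apply: measurableI => //.
apply: open_rV_measurable; apply: open_comp => //.
Qed.

Lemma mes_bounded_lty (R : realType) (n : nat) (D : set 'rV[R]_n) :
  bounded_set D -> (mes D < +oo)%E.
Proof.
move=> [M [Mr MD]]; pose ab : 'rV[R]_n * 'rV[R]_n := (const_mx (- (M + 2)), const_mx (M + 2)).
apply: (@le_lt_trans _ _ (box_volume ab)%:E); last exact: ltry.
apply: ereal_inf_lbound; exists [set ab]; last first.
  by rewrite esum_set1// lee_fin prodr_ge0// => i _; rewrite le_max lexx.
split; first exact: countable1.
move=> x Dx; exists ab => // i; rewrite !mxE.
have /= : `|x| <= M + 1 by apply: MD => //; lra.
have : `|x 0 i| <= `|x|.
  by rewrite [leRHS]/Num.norm/= mx_normrE; apply: (le_bigmax _ (fun ij => `|x ij.1 ij.2|) (0, i)).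
move=> H1 H2; have := le_trans H1 H2; rewrite ler_norml; lra.
Qed.

Lemma mes_complete (R : realType) (n : nat) :
  measure_is_complete (@mes R n).
Proof. exact: measure_is_complete_caratheodory. Qed.

(** * Smooth cutoff functions *)

Section flat.
Variable R : realType.
Implicit Types (k : nat) (x y : R).

(* [x^-k e^(-1/x)]: the derivative of each is a combination of two others. *)
Definition flat k x : R := if 0 < x then x^-1 ^+ k * expR (- x^-1) else 0.

(** This is [1 + t <= e^t] at [t = y / k], raised to the power [k]; the case [k = 0] uses
    [0 ^ 0 = 1]. *)
Lemma expR_pow_bound k y : 0 <= y -> y ^+ k * expR (- y) <= k%:R ^+ k.
Proof.
move=> y0; case: k => [|k]; first by rewrite !expr0 mul1r expR_le1// oppr_le0.
rewrite expRN ler_pdivrMr ?expR_gt0//.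
have -> : y = (y / k.+1%:R) * k.+1%:R by rewrite divfK.
rewrite -[X in expR X]mulrC expRM_natl -exprMn_comm; last exact: mulrC.
rewrite lerXn2r ?nnegrE ?mulr_ge0 ?expR_ge0 ?divr_ge0//.
rewrite mulrC ler_wpM2l//.
by apply: le_trans (expR_ge1Dx _); rewrite lerDr.
Qed.

Lemma flat_ge0 k x : 0 <= flat k x.
Proof.
rewrite /flat; case: ifPn => // x0.
by rewrite mulr_ge0 ?expR_ge0// exprn_ge0// invr_ge0 ltW.
Qed.

Lemma flat_le k x : flat k x <= k%:R ^+ k.
Proof.
rewrite /flat; case: ifPn => [x0|_]; last by rewrite exprn_ge0.
by apply: expR_pow_bound; rewrite invr_ge0 ltW.
Qed.

Lemma flat0_gt0 x : 0 < x -> 0 < flat 0 x.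
Proof. by move=> x0; rewrite /flat x0 mul1r expR_gt0. Qed.

Lemma flat_npos k x : x <= 0 -> flat k x = 0.
Proof. by move=> x0; rewrite /flat ltNge x0. Qed.

Lemma flat0_mono x y : x <= y -> flat 0 x <= flat 0 y.
Proof.
move=> xy; rewrite {1}/flat; case: ifPn => [x0|_]; last exact: flat_ge0.
rewrite /flat (lt_le_trans x0 xy) !mul1r ler_expR lerN2 lef_pV2// ?posrE//.
exact: lt_le_trans xy.
Qed.

Lemma flatS k x : flat k x = x * flat k.+1 x.
Proof.
rewrite /flat; case: ifPn => [x0|_]; last by rewrite mulr0.
by rewrite exprS !mulrA divff ?mul1r// gt_eqF.
Qed.

(** Away from 0 this is the chain rule. At 0 the difference quotient of [flat k] is [flat k.+1] by
    [flatS], and it tends to 0 because it is in turn [x] times the bounded function [flat k.+2]. *)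
Lemma is_derive_flat k x :
  is_derive x 1 (flat k) (flat k.+2 x - k%:R * flat k.+1 x).
Proof.
have [x0|x0|->] := ltgtP x 0.
- rewrite !flat_npos ?(ltW x0)// mulr0 subr0.
  apply: (@near_eq_is_derive _ _ _ (cst 0)).
    by near=> y; rewrite /cst flat_npos// ltW//; near: y; exact: lt_nbhsl.
- apply: (@near_eq_is_derive _ _ _ (fun y => y^-1 ^+ k * expR (- y^-1))).
    near=> y; rewrite /flat ifT//; near: y; exact: lt_nbhsr.
  have dV : is_derive x 1 (fun y : R => y^-1) (- x ^- 2).
    by have := @is_deriveV R id x 1 1; rewrite /= scaler1; apply; rewrite ?gt_eqF.
  have dN : is_derive x 1 (fun y : R => - y^-1) (x ^- 2).
    by rewrite -[x ^- 2]opprK; apply: is_deriveN.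
  have dE : is_derive x 1 (fun y : R => expR (- y^-1)) (expR (- x^-1) * x ^- 2).
    exact: (is_derive1_comp (f := expR) (g := fun y : R => - y^-1)).
  have dX : is_derive x 1 (fun y : R => y^-1 ^+ k)
      (k%:R * x^-1 ^+ k.-1 * - x ^- 2).
    have -> : (fun y : R => y^-1 ^+ k) = (fun y : R => y^-1) ^+ k.
      by apply/funext => y; rewrite exprfctE.
    exact: is_deriveX.
  have := @is_deriveM _ _ (fun y : R => y^-1 ^+ k) (fun y : R => expR (- y^-1))
    x 1 _ _ dX dE.
  move=> dM; apply: (is_derive_eq dM); rewrite /flat x0 /GRing.scale/=.
  case: k {dX dM} => [|k]; rewrite ?mul0r ?exprS /=; field; exact: lt0r_neq0.
- have c0 j : flat j h @[h --> 0^'] --> (0 : R).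
    apply/cvgr0Pnorm_le => e e0; near=> h.
    rewrite ger0_norm ?flat_ge0// flatS.
    have [h0|h0] := leP h 0.
      by rewrite (le_trans _ (ltW e0))// mulr_le0_ge0 ?flat_ge0.
    rewrite (le_trans (ler_wpM2l (ltW h0) (flat_le j.+1 h)))//.
    rewrite -ler_pdivlMr ?exprn_gt0// -[leLHS]gtr0_norm//.
    near: h; apply: dnbhs0_le; exact/divr_gt0/exprn_gt0.
  have d0 : h^-1 *: ((flat k \o shift 0) (h *: 1) - flat k 0) @[h --> 0^'] --> (0 : R).
    apply: cvg_trans (c0 k.+1); apply: near_eq_cvg; near=> h.
    rewrite /= addr0 /GRing.scale/= mulr1 (flat_npos k (lexx 0)) subr0 (flatS k h).
    by rewrite mulKf//; near: h; exact: nbhs_dnbhs_neq.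
  rewrite !(flat_npos _ (lexx 0)) mulr0 subr0.
  apply: DeriveDef; first by apply/cvg_ex; exists 0.
  exact/cvg_lim.
Unshelve. all: by end_near. Qed.

Lemma flat_continuous k : continuous (flat k).
Proof.
move=> x; apply/differentiable_continuous/derivable1_diffP.
exact: (ex_derive (is_derive := is_derive_flat k x)).
Qed.
End flat.

(** * Smoothness of finite order: sums, products, affine changes of variable and composition with
    [flat] *)

Section partials_calculus.
Variables (R : realType) (n : nat).
Implicit Types (phi psi v : 'rV[R]_n -> R) (x : 'rV[R]_n) (N : nat).

Lemma is_derive_line phi x e d :
  is_derive x e phi d <-> is_derive (0 : R) 1 (fun h : R => phi (h *: e + x)) d.
Proof.
have E : (fun h : R => h^-1 *: ((phi \o shift x) (h *: e) - phi x)) =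
    (fun h : R => h^-1 *: (((fun h : R => phi (h *: e + x)) \o shift (0 : R)) (h *: (1 : R))
      - phi ((0 : R) *: e + x))).
  by apply/funext => h /=; rewrite addr0 scale0r add0r /GRing.scale/= mulr1.
by split => -[dd de]; apply: DeriveDef;
  rewrite /derivable /derive ?E// -?E in dd de *.
Qed.

Lemma is_derive_comp1 (F : R -> R) v x e a b :
  is_derive (v x) 1 F a -> is_derive x e v b -> is_derive x e (F \o v) (a * b).
Proof.
move=> dF /is_derive_line dv; apply/is_derive_line.
apply: (is_derive1_comp (f := F) (g := fun h : R => v (h *: e + x))).
by rewrite scale0r add0r.
Qed.

Lemma is_derive_affine phi c a x e d : is_derive (c *: x + a) e phi d ->
  is_derive x e (fun y => phi (c *: y + a)) (c * d).
Proof.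
move=> /is_derive_line dphi; apply/is_derive_line.
have -> : (fun h : R => phi (c *: (h *: e + x) + a)) =
    (fun h : R => phi (h *: e + (c *: x + a))) \o (fun h : R => c * h).
  apply/funext => h /=; congr (phi _).
  by rewrite scalerDr scalerA addrA.
rewrite mulrC.
apply: (is_derive1_comp (f := fun h : R => phi (h *: e + (c *: x + a)))
  (g := fun h : R => c * h)).
  by rewrite mulr0.
have := @is_deriveZ _ _ _ id c 0 (1 : R) 1 (is_derive_id _ _).
by rewrite /GRing.scale/= mulr1.
Qed.

Lemma partials_rcons s i phi : partials (rcons s i) phi = partials s (partial i phi).
Proof. by rewrite /partials foldr_rcons. Qed.

(** An order-by-order form of [smooth]. It removes the innermost derivative, the last one in the
    list, so that the Leibniz and chain rules, which rewrite a first derivative as a combination of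
    products, give inductions on [N]. *)
Fixpoint smooth_upto N phi : Prop := match N with
  | 0 => continuous phi
  | N'.+1 => continuous phi /\ forall i,
      (forall x, derivable phi x (delta_mx 0 i)) /\ smooth_upto N' (partial i phi)
  end.

Lemma smooth_upto_continuous N phi : smooth_upto N phi -> continuous phi.
Proof. by case: N => [|N] //= []. Qed.

Lemma smooth_upto_derivable N phi i x :
  smooth_upto N.+1 phi -> derivable phi x (delta_mx 0 i).
Proof. by move=> [_ /(_ i)[]]. Qed.

Lemma smooth_upto_partial N phi i : smooth_upto N.+1 phi -> smooth_upto N (partial i phi).
Proof. by move=> [_ /(_ i)[]]. Qed.

Lemma smooth_uptoW N phi : smooth_upto N.+1 phi -> smooth_upto N phi.
Proof.
elim: N phi => [|N IH] phi; first by case.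
by move=> [cphi dphi]; split=> // i; split; [exact: (dphi i).1|apply/IH/(dphi i).2].
Qed.

Lemma smoothP phi : smooth phi <-> forall N, smooth_upto N phi.
Proof.
split=> [sphi N|sphi s].
  elim: N phi sphi => [|N IH] phi sphi; first exact: (sphi [::]).1.
  split=> [|i]; first exact: (sphi [::]).1.
  split; first exact: (sphi [::]).2.
  by apply: IH => s; rewrite -partials_rcons.
elim/last_ind: s phi sphi => [|s i IH] phi sphi /=.
  split=> [|i x]; first exact: (sphi 0%N).
  exact: smooth_upto_derivable (sphi 1%N).
rewrite !partials_rcons; apply: IH => N.
exact: smooth_upto_partial (sphi N.+1).
Qed.

Lemma is_derive_partial N phi i x : smooth_upto N.+1 phi ->
  is_derive x (delta_mx 0 i) phi (partial i phi x).
Proof. by move=> /smooth_upto_derivable dphi; apply: DeriveDef. Qed.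

Lemma partialD N phi psi i : smooth_upto N.+1 phi -> smooth_upto N.+1 psi ->
  partial i (fun x => phi x + psi x) = (fun x => partial i phi x + partial i psi x).
Proof.
by move=> sphi spsi; apply/funext => x; apply: deriveD;
  [exact: smooth_upto_derivable sphi|exact: smooth_upto_derivable spsi].
Qed.

Lemma partialM N phi psi i : smooth_upto N.+1 phi -> smooth_upto N.+1 psi ->
  partial i (fun x => phi x * psi x) =
  (fun x => phi x * partial i psi x + psi x * partial i phi x).
Proof.
by move=> sphi spsi; apply/funext => x; apply: deriveM;
  [exact: smooth_upto_derivable sphi|exact: smooth_upto_derivable spsi].
Qed.

Lemma smooth_uptoD N phi psi : smooth_upto N phi -> smooth_upto N psi ->
  smooth_upto N (fun x => phi x + psi x).
Proof.
elim: N phi psi => [|N IH] phi psi sphi spsi.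
  by move=> x; apply: continuousD;
    [exact: (smooth_upto_continuous sphi)|exact: (smooth_upto_continuous spsi)].
split=> [|i].
  by move=> x; apply: continuousD;
    [exact: (smooth_upto_continuous sphi)|exact: (smooth_upto_continuous spsi)].
split=> [x|].
  by apply: derivableD;
    [exact: smooth_upto_derivable sphi|exact: smooth_upto_derivable spsi].
by rewrite (partialD i sphi spsi); apply: IH; exact: smooth_upto_partial.
Qed.

Lemma smooth_uptoM N phi psi : smooth_upto N phi -> smooth_upto N psi ->
  smooth_upto N (fun x => phi x * psi x).
Proof.
elim: N phi psi => [|N IH] phi psi sphi spsi.
  by move=> x; apply: continuousM;
    [exact: (smooth_upto_continuous sphi)|exact: (smooth_upto_continuous spsi)].
split=> [|i].
  by move=> x; apply: continuousM;
    [exact: (smooth_upto_continuous sphi)|exact: (smooth_upto_continuous spsi)].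
split=> [x|].
  by apply: derivableM;
    [exact: smooth_upto_derivable sphi|exact: smooth_upto_derivable spsi].
rewrite (partialM i sphi spsi); apply: smooth_uptoD; apply: IH;
  by [exact: smooth_uptoW|exact: smooth_upto_partial].
Qed.

Lemma smooth_upto_cst N (c : R) : smooth_upto N (fun=> c).
Proof.
elim: N c => [|N IH] c; first exact: cst_continuous.
split=> [|i]; first exact: cst_continuous.
split=> [x|]; first exact: derivable_cst.
rewrite (_ : partial i _ = fun=> 0); first exact: IH.
by apply/funext => x; exact: derive_cst.
Qed.

Lemma smooth_upto_coord N (i : 'I_n) : smooth_upto N (fun x => x 0 i).
Proof.
have dc (j : 'I_n) x : is_derive x (delta_mx 0 j)
    (fun x : 'rV[R]_n => x 0 i) ((delta_mx 0 j : 'rV[R]_n) 0 i).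
  apply/is_derive_line.
  rewrite [X in is_derive _ _ X _](_ : _ =
      (fun h : R => h * ((delta_mx 0 j : 'rV[R]_n) 0 i) + x 0 i)).
    rewrite -[X in is_derive _ _ _ X]addr0.
    apply: (@is_deriveD _ _ _ (fun h : R => h * ((delta_mx 0 j : 'rV[R]_n) 0 i)) (fun=> x 0 i)).
    have := @is_deriveZ _ _ _ id ((delta_mx 0 j : 'rV[R]_n) 0 i) (0 : R) 1 1 (is_derive_id _ _).
    rewrite /GRing.scale/= mulr1; congr (is_derive _ _ _ _).
    by apply/funext => h; rewrite mulrC.
  by apply/funext => h; rewrite mxE [X in X + _]mxE.
case: N => [|N]; first exact: coord_continuous.
split; first exact: coord_continuous.
move=> j; split=> [x|]; first exact: (ex_derive (is_derive := dc j x)).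
rewrite (_ : partial j _ = fun=> ((delta_mx 0 j : 'rV[R]_n) 0 i)); first exact: smooth_upto_cst.
by apply/funext => x; exact: (derive_val (is_derive := dc j x)).
Qed.

Lemma smooth_upto_prod N (I : Type) (r : seq I) (F : I -> 'rV[R]_n -> R) :
  (forall i, smooth_upto N (F i)) -> smooth_upto N (fun x => \prod_(i <- r) F i x).
Proof.
move=> sF; elim: r => [|i r IH].
  by under eq_fun do rewrite big_nil; exact: smooth_upto_cst.
by under eq_fun do rewrite big_cons; exact: smooth_uptoM.
Qed.

Lemma smooth_upto_sum N (I : Type) (r : seq I) (F : I -> 'rV[R]_n -> R) :
  (forall i, smooth_upto N (F i)) -> smooth_upto N (fun x => \sum_(i <- r) F i x).
Proof.
move=> sF; elim: r => [|i r IH].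
  by under eq_fun do rewrite big_nil; exact: smooth_upto_cst.
by under eq_fun do rewrite big_cons; exact: smooth_uptoD.
Qed.

Lemma partial_affine N phi c a i : smooth_upto N.+1 phi ->
  partial i (fun y => phi (c *: y + a)) = (fun y => c * partial i phi (c *: y + a)).
Proof.
move=> sphi; apply/funext => x.
exact: (derive_val (is_derive := is_derive_affine (is_derive_partial i _ sphi))).
Qed.

Lemma smooth_upto_affine N phi c a : smooth_upto N phi ->
  smooth_upto N (fun y => phi (c *: y + a)).
Proof.
have caff : continuous (fun y : 'rV[R]_n => c *: y + a).
  move=> y; apply: continuousD; last exact: cst_continuous.
  exact: scaler_continuous.
elim: N phi => [|N IH] phi sphi.
  by move=> x; apply: (continuous_comp (caff x)); exact: (smooth_upto_continuous sphi).
split=> [|i].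
  by move=> x; apply: (continuous_comp (caff x)); exact: sphi.1.
split=> [x|].
  exact: (ex_derive (is_derive := is_derive_affine (is_derive_partial i _ sphi))).
rewrite (partial_affine _ _ i sphi); apply: smooth_uptoM.
  exact: smooth_upto_cst.
exact/IH/smooth_upto_partial.
Qed.

Lemma partials_affine phi c a s : smooth phi ->
  partials s (fun y => phi (c *: y + a)) =
  (fun y => c ^+ size s * partials s phi (c *: y + a)).
Proof.
move=> sphi; elim: s => [|i s IH].
  by apply/funext => y; rewrite expr0 mul1r.
apply/funext => x; rewrite [LHS]/= -/(partials s _) IH.
have dphi : is_derive (c *: x + a) (delta_mx 0 i) (partials s phi)
  (partials (i :: s) phi (c *: x + a)).
  by apply: DeriveDef => //; exact: (sphi s).2.
have := is_deriveZ (c ^+ size s) (is_derive_affine dphi).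
by case=> _ dE; apply: etrans dE _; rewrite /GRing.scale/= mulrA exprSr.
Qed.

Lemma partial_flat N k v i : smooth_upto N.+1 v ->
  partial i (fun x => flat k (v x)) =
  (fun x => (flat k.+2 (v x) + - k%:R * flat k.+1 (v x)) * partial i v x).
Proof.
move=> sv; apply/funext => x; rewrite mulNr.
exact: (derive_val (is_derive :=
  is_derive_comp1 (is_derive_flat k (v x)) (is_derive_partial i x sv))).
Qed.

Lemma smooth_upto_flat N k v : smooth_upto N v -> smooth_upto N (fun x => flat k (v x)).
Proof.
elim: N k v => [|N IH] k v sv.
  by move=> x; apply: (continuous_comp (smooth_upto_continuous sv (x := x))); exact: flat_continuous.
split=> [|i].
  by move=> x; apply: (continuous_comp (sv.1 x)); exact: flat_continuous.
split=> [x|].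
  exact: (ex_derive (is_derive :=
    is_derive_comp1 (is_derive_flat k (v x)) (is_derive_partial i x sv))).
rewrite (partial_flat k i sv); apply: smooth_uptoM; last exact: smooth_upto_partial.
have sv' := smooth_uptoW sv.
apply: smooth_uptoD; first exact: IH.
apply: smooth_uptoM; [exact: smooth_upto_cst|exact: IH].
Qed.

End partials_calculus.

(** * Derivative bounds that are uniform over a family of functions *)

Section bounded_families.
Variables (R : realType) (n : nat) (L : Type).
Implicit Types (Phi Psi : L -> 'rV[R]_n -> R) (N : nat).

Definition unif_bounded Phi := exists C : R, forall l x, `|Phi l x| <= C.

(** The index type [L] will consist of finite sets of lattice points and of scales: uniformity in
    [L] is what makes the constant of a cutoff independent of the set that is cut off and of the
    width of the transition. *)
Fixpoint bounded_upto N Phi : Prop := match N with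
  | 0 => unif_bounded Phi
  | N'.+1 => unif_bounded Phi /\
      forall i, bounded_upto N' (fun l => partial i (Phi l))
  end.

Lemma bounded_uptoP N Phi : bounded_upto N Phi <->
  forall s, (size s <= N)%N -> unif_bounded (fun l => partials s (Phi l)).
Proof.
elim: N Phi => [|N IH] Phi /=; split.
- by move=> bPhi [|].
- by move=> /(_ [::]); exact.
- move=> [bPhi bdPhi]; case/lastP => [//|s i]; rewrite size_rcons ltnS => sN.
  have := (IH _).1 (bdPhi i) s sN.
  by under [X in unif_bounded X -> _]eq_fun do rewrite -partials_rcons.
- move=> bs; split=> [|i]; first exact: (bs [::]).
  apply/IH => s sN; have := bs (rcons s i); rewrite size_rcons => /(_ sN).
  by under [X in unif_bounded X -> _]eq_fun do rewrite partials_rcons.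
Qed.

Lemma bounded_uptoW N Phi : bounded_upto N.+1 Phi -> bounded_upto N Phi.
Proof.
by move=> /bounded_uptoP bPhi; apply/bounded_uptoP => s sN; apply/bPhi/leqW.
Qed.

Lemma unif_boundedD Phi Psi : unif_bounded Phi -> unif_bounded Psi ->
  unif_bounded (fun l x => Phi l x + Psi l x).
Proof.
move=> [C PhiC] [D PsiD]; exists (C + D) => l x.
by rewrite (le_trans (ler_normD _ _))// lerD.
Qed.

Lemma unif_boundedM Phi Psi : unif_bounded Phi -> unif_bounded Psi ->
  unif_bounded (fun l x => Phi l x * Psi l x).
Proof.
move=> [C PhiC] [D PsiD]; exists (C * D) => l x.
by rewrite normrM ler_pM.
Qed.

Lemma bounded_upto_cst N (c : R) : bounded_upto N (fun _ _ => c).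
Proof.
elim: N c => [|N IH] c; first by exists `|c|.
split=> [|i]; first by exists `|c|.
rewrite (_ : (fun l => _) = fun _ _ => 0)//.
by apply/funext => l; apply/funext => x; exact: derive_cst.
Qed.

Lemma bounded_uptoD N Phi Psi :
  (forall l, smooth_upto N (Phi l)) -> (forall l, smooth_upto N (Psi l)) ->
  bounded_upto N Phi -> bounded_upto N Psi ->
  bounded_upto N (fun l x => Phi l x + Psi l x).
Proof.
elim: N Phi Psi => [|N IH] Phi Psi sPhi sPsi bPhi bPsi.
  exact: unif_boundedD.
split=> [|i]; first exact: unif_boundedD bPhi.1 bPsi.1.
rewrite (_ : (fun l => _) = fun l x => partial i (Phi l) x + partial i (Psi l) x).
  apply: IH; [move=> l; exact: smooth_upto_partial|
    move=> l; exact: smooth_upto_partial|exact: bPhi.2|exact: bPsi.2].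
by apply/funext => l; exact: partialD (sPhi l) (sPsi l).
Qed.

Lemma bounded_uptoM N Phi Psi :
  (forall l, smooth_upto N (Phi l)) -> (forall l, smooth_upto N (Psi l)) ->
  bounded_upto N Phi -> bounded_upto N Psi ->
  bounded_upto N (fun l x => Phi l x * Psi l x).
Proof.
elim: N Phi Psi => [|N IH] Phi Psi sPhi sPsi bPhi bPsi.
  exact: unif_boundedM.
split=> [|i]; first exact: unif_boundedM bPhi.1 bPsi.1.
have sW Xi : (forall l, smooth_upto N.+1 (Xi l)) -> forall l, smooth_upto N (Xi l).
  by move=> sXi l; exact: smooth_uptoW.
have sP Xi : (forall l : L, smooth_upto N.+1 (Xi l)) ->
    forall l, smooth_upto N (partial i (Xi l)).
  by move=> sXi l; exact: smooth_upto_partial.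
rewrite (_ : (fun l => _) = fun l x =>
  Phi l x * partial i (Psi l) x + Psi l x * partial i (Phi l) x).
  apply: bounded_uptoD.
  - by move=> l; apply: smooth_uptoM; [exact: sW|exact: sP].
  - by move=> l; apply: smooth_uptoM; [exact: sW|exact: sP].
  - apply: IH; [exact: sW|exact: sP|exact: bounded_uptoW|exact: bPsi.2].
  - apply: IH; [exact: sW|exact: sP|exact: bounded_uptoW|exact: bPhi.2].
by apply/funext => l; exact: partialM (sPhi l) (sPsi l).
Qed.

Lemma bounded_upto_flat N k Phi : (forall l, smooth_upto N (Phi l)) ->
  bounded_upto N Phi -> bounded_upto N (fun l x => flat k (Phi l x)).
Proof.
have b0 j Xi : unif_bounded (fun l x => flat j (Xi l x)).
  by exists (j%:R ^+ j) => l x; rewrite ger0_norm ?flat_ge0// flat_le.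
elim: N k Phi => [|N IH] k Phi sPhi bPhi; first exact: b0.
split=> [|i]; first exact: b0.
have sPhi' l : smooth_upto N (Phi l) by exact: smooth_uptoW.
have sE l : smooth_upto N (fun x => flat k.+1 (Phi l x)) by exact: smooth_upto_flat.
have bPhi' := bounded_uptoW bPhi.
rewrite (_ : (fun l => _) = fun l x =>
  (flat k.+2 (Phi l x) + - k%:R * flat k.+1 (Phi l x)) * partial i (Phi l) x); last first.
  by apply/funext => l; exact: partial_flat (sPhi l).
apply: bounded_uptoM.
- move=> l; apply: smooth_uptoD; first exact: smooth_upto_flat.
  by apply: smooth_uptoM; [exact: smooth_upto_cst|exact: sE].
- by move=> l; exact: smooth_upto_partial.
- apply: bounded_uptoD; [by move=> l; exact: smooth_upto_flat| |exact: IH|].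
    by move=> l; apply: smooth_uptoM; [exact: smooth_upto_cst|exact: sE].
  apply: bounded_uptoM; [by move=> l; exact: smooth_upto_cst|exact: sE| |exact: IH].
  exact: bounded_upto_cst.
- exact: bPhi.2.
Qed.

End bounded_families.

(** * A compactly supported bump function *)

Section bump.
Variables (R : realType) (n : nat).
Implicit Types (phi psi : 'rV[R]_n -> R) (x : 'rV[R]_n).

Lemma smooth_cst (c : R) : smooth (fun _ : 'rV[R]_n => c).
Proof. by apply/smoothP => N; exact: smooth_upto_cst. Qed.

Lemma smoothM phi psi : smooth phi -> smooth psi -> smooth (fun x => phi x * psi x).
Proof.
by move=> /smoothP sphi /smoothP spsi; apply/smoothP => N; exact: smooth_uptoM.
Qed.

Lemma partials_near phi psi s x :
  (\near x, phi x = psi x) -> \near x, partials s phi x = partials s psi x.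
Proof.
elim: s => [//|i s IH] H.
by have := near_join (IH H); apply: filterS => y; exact: near_eq_derive.
Qed.

Lemma partials_near_cst phi s x (c : R) : (0 < size s)%N ->
  (\near x, phi x = c) -> partials s phi x = 0.
Proof.
move=> s0 /(@partials_near _ (cst c) s) /nbhs_singleton ->.
elim: s s0 => // i s _ _.
suff -> : partials (i :: s) (cst c) = fun=> (0 : R) by [].
elim: s i => [|j s IH] i.
  by apply/funext => y; exact: derive_cst.
rewrite [LHS](_ : _ = partial i (partials (j :: s) (cst c)))// IH.
by apply/funext => y; exact: derive_cst.
Qed.

Lemma partials_out_closed phi s (K : set 'rV[R]_n) : closed K ->
  (forall x, ~ K x -> phi x = 0) -> forall x, ~ K x -> partials s phi x = 0.
Proof.
move=> cK phi0 x nKx.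
have nphi0 : \near x, phi x = 0.
  by apply: filterS (open_nbhs_nbhs _); [exact: phi0|split => //; exact: closed_openC].
by case: s => [|i s]; [exact: phi0|exact: partials_near_cst nphi0].
Qed.

Lemma partials_compact_bounded phi s (K : set 'rV[R]_n) : compact K -> smooth phi ->
  (forall x, ~ K x -> phi x = 0) -> exists C : R, forall x, `|partials s phi x| <= C.
Proof.
move=> kK sphi phi0.
have cK : closed K by apply: compact_closed => //; exact: norm_hausdorff.
have [M [Mr MK]] : bounded_set (partials s phi @` K).
  apply: compact_bounded; apply: continuous_compact => //.
  by apply: continuous_subspaceT; exact: (sphi s).1.
exists (`|M| + 1) => x.
have [Kx|nKx] := pselect (K x).
  by apply: MK; [rewrite (le_lt_trans (ler_norm _))// ltrDl|exists x].
by rewrite (partials_out_closed s cK phi0 nKx) normr0 addr_ge0.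
Qed.

(** Positive exactly on the open cube of half-side 2. On the closed cube of half-side 1 every factor
    is at least [flat 0 3], which is the origin of [bump_level]. *)
Definition bump x : R := \prod_(i < n) flat 0 (4 - x 0 i ^+ 2).

Lemma smooth_bump : smooth bump.
Proof.
apply/smoothP => N; apply: smooth_upto_prod => i.
apply: smooth_upto_flat; apply: smooth_uptoD; first exact: smooth_upto_cst.
under eq_fun do rewrite expr2 -mulNr -mulN1r -mulrA.
apply: smooth_uptoM; first exact: smooth_upto_cst.
by apply: smooth_uptoM; exact: smooth_upto_coord.
Qed.

Lemma bump_ge0 x : 0 <= bump x.
Proof. by apply: prodr_ge0 => i _; exact: flat_ge0. Qed.

Definition bump_level : R := flat 0 3 ^+ n.

Lemma bump_level_gt0 : 0 < bump_level.
Proof. by rewrite exprn_gt0// flat0_gt0. Qed.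

Lemma bump_level_le x : (forall i, `|x 0 i| <= 1) -> bump_level <= bump x.
Proof.
move=> x1; rewrite /bump_level -[n in X in X <= _]card_ord -prodr_const.
apply: ler_prod => i _; rewrite flat_ge0 flat0_mono//.
have : x 0 i ^+ 2 <= 1 by rewrite -real_normK ?num_real// expr_le1.
lra.
Qed.

Lemma bump_eq0 x i : 2 <= `|x 0 i| -> bump x = 0.
Proof.
move=> x2; rewrite /bump (bigD1 i)//= flat_npos ?mul0r//.
have : 2 ^+ 2 <= x 0 i ^+ 2.
  by rewrite -(real_normK (num_real (x 0 i))) lerXn2r ?nnegrE.
lra.
Qed.

End bump.

Lemma coord_le_norm (R : realType) (n : nat) (x : 'rV[R]_n) i : `|x 0 i| <= `|x|.
Proof.
rewrite [leRHS]/Num.norm/= mx_normrE.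
exact: (le_bigmax _ (fun ij => `|x ij.1 ij.2|) (0, i)).
Qed.

Lemma rV_norm_le (R : realType) (n : nat) (x : 'rV[R]_n) (c : R) : 0 <= c ->
  (forall i, `|x 0 i| <= c) -> `|x| <= c.
Proof.
move=> c0 xc; rewrite /Num.norm/= mx_normrE.
by apply/bigmax_leP; split => // -[i j] _ /=; rewrite (ord1 i).
Qed.

(** * Cutoffs near an arbitrary bounded set, by sums of lattice bumps *)

Section cutoff.
Variables (R : realType) (n : nat).
Implicit Types (phi psi : 'rV[R]_n -> R) (x y : 'rV[R]_n) (Z : seq 'rV[int]_n).

Lemma partialsD phi psi s : smooth phi -> smooth psi ->
  partials s (fun x => phi x + psi x) = (fun x => partials s phi x + partials s psi x).
Proof.
move=> sphi spsi; elim: s => [//|i s IH].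
rewrite [LHS](_ : _ = partial i (partials s (fun x => phi x + psi x)))// IH.
apply/funext => x; apply: deriveD; [exact: (sphi s).2|exact: (spsi s).2].
Qed.

Lemma smooth_sum (I : Type) (r : seq I) (F : I -> 'rV[R]_n -> R) :
  (forall i, smooth (F i)) -> smooth (fun x => \sum_(i <- r) F i x).
Proof.
by move=> sF; apply/smoothP => N; apply: smooth_upto_sum => i; exact: (smoothP _).1 (sF i) N.
Qed.

Lemma partials_sum (I : Type) (r : seq I) (F : I -> 'rV[R]_n -> R) s :
  (forall i, smooth (F i)) ->
  partials s (fun x => \sum_(i <- r) F i x) = (fun x => \sum_(i <- r) partials s (F i) x).
Proof.
move=> sF; elim: r => [|i r IH].
  under eq_fun do rewrite big_nil.
  apply/funext => x; rewrite big_nil.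
  case: s => [//|i s].
  apply: (@partials_near_cst R n _ _ _ (0 : R)) => //.
  by apply: (@filterE _ (nbhs x)).
under eq_fun do rewrite big_cons.
rewrite partialsD//; last exact: smooth_sum.
by rewrite IH; apply/funext => x; rewrite big_cons.
Qed.

Definition near_int x (z : 'rV[int]_n) := [forall i, `|x 0 i - (z 0 i)%:~R| <= 2].

(** Each coordinate of such a lattice point is one of the five integers from [floor(x_i) - 2] to
    [floor(x_i) + 2]. *)
Lemma count_near_int Z x : uniq Z -> (count (near_int x) Z <= 5 ^ n)%N.
Proof.
move=> uZ; rewrite -size_filter.
pose f (z : 'rV[int]_n) : {ffun 'I_n -> 'I_5} :=
  [ffun i => inord `|(z 0 i - Num.floor (x 0 i) + 2)%R|%N].
have close (z : 'rV[int]_n) i : `|x 0 i - (z 0 i)%:~R| <= 2 ->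
    (0 <= z 0 i - Num.floor (x 0 i) + 2 < 5)%R.
  rewrite ler_norml => /andP[H1 H2].
  have := floor_le (x 0 i); have := floorD1_gt (x 0 i).
  rewrite intrD => H3 H4.
  rewrite -(@ler_int R) -(@ltr_int R) !intrD rmorphN /=; apply/andP; split; lra.
have uf : uniq (map f [seq z <- Z | near_int x z]).
  rewrite map_inj_in_uniq ?filter_uniq// => z w.
  rewrite !mem_filter => /andP[/forallP zx _] /andP[/forallP wx _] fzw.
  apply/rowP => i; have /(congr1 val) := congr1 (fun h : {ffun 'I_n -> 'I_5} => h i) fzw.
  rewrite !ffunE.
  have := close _ _ (zx i); have := close _ _ (wx i).
  move: (z 0 i) (w 0 i) (Num.floor (x 0 i)) => a b c /andP[b0 b5] /andP[a0 a5].
  rewrite /= !inordK; lia.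
have := max_card (mem (map f [seq z <- Z | near_int x z])).
by rewrite (card_uniqP uf) size_map card_ffun !card_ord.
Qed.

Definition bump_sum Z x : R := \sum_(z <- Z) bump (x - map_mx intr z).

Let smooth_bump_shift (z : 'rV[int]_n) : smooth (fun x => bump (x - map_mx intr z)).
Proof.
under eq_fun do rewrite -[X in X - _]scale1r.
apply/smoothP => N; apply: smooth_upto_affine.
exact: (smoothP _).1 (@smooth_bump R n) N.
Qed.

Lemma smooth_bump_sum Z : smooth (bump_sum Z).
Proof. exact: smooth_sum. Qed.

Lemma bump_sum_bounded N :
  bounded_upto N (fun Z : {Z : seq 'rV[int]_n | uniq Z} => bump_sum (val Z)).
Proof.
apply/bounded_uptoP => s _.
pose K : set 'rV[R]_n := [set x | forall i, (x 0 i) \in `[-2, 2]].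
have kK : compact K.
  apply: (@rV_compact _ _ (fun=> `[(-2 : R), 2]%classic)) => _.
  exact: segment_compact.
have cK : closed K by apply: compact_closed kK; exact: norm_hausdorff.
have out x : ~ K x -> exists i, 2 < `|x 0 i|.
  move=> /existsNP[i /negP]; rewrite in_itv/= -ler_norml -ltNge; by exists i.
have bump0 x : ~ K x -> bump x = 0.
  by move=> /out[i xi]; exact: bump_eq0 (ltW xi).
have [C CP] := partials_compact_bounded s kK (@smooth_bump R n) bump0.
have C0 : 0 <= C by rewrite (le_trans _ (CP 0)).
exists (C * (5 ^ n)%:R) => -[Z uZ] x /=.
rewrite /bump_sum partials_sum// (le_trans (ler_norm_sum _ _ _))//.
apply: (@le_trans _ _ (\sum_(z <- Z) C *+ near_int x z)).
  apply: ler_sum => z _.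
  have -> : partials s (fun x0 : 'rV_n => bump (x0 - map_mx intr z)) x =
      partials s (@bump R n) (x - map_mx intr z).
    under [X in partials s X]eq_fun do rewrite -[X in X - _]scale1r.
    by rewrite partials_affine ?expr1n ?mul1r ?scale1r//; exact: smooth_bump.
  have [_|] := boolP (near_int x z); first by rewrite mulr1n.
  move=> /forallPn[i]; rewrite -ltNge => xi.
  rewrite (partials_out_closed s cK bump0) ?normr0//.
  move=> /(_ i); rewrite in_itv/= -ler_norml leNgt !mxE.
  by move/negP; apply.
rewrite sumrMnr mulr_natr ler_wpMn2l//.
have -> : (\sum_(z <- Z) near_int x z = count (near_int x) Z)%N.
  by rewrite -sum1_count [RHS]big_mkcond; apply: eq_bigr => z _; case: near_int.
exact: count_near_int.
Qed.

(* It vanishes where some translated bump reaches [bump_level] and is 1 off the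
   supports of the bumps. Since at most [5 ^ n] bumps overlap at a point, its
   derivatives are bounded independently of [Z]. *)
Definition cutoff Z x : R := flat 0 (bump_level R n - bump_sum Z x) / flat 0 (bump_level R n).

Lemma cutoff_ge0 Z x : 0 <= cutoff Z x.
Proof. by rewrite divr_ge0// flat_ge0. Qed.

Lemma bump_sum_ge0 Z x : 0 <= bump_sum Z x.
Proof. by apply: sumr_ge0 => z _; exact: bump_ge0. Qed.

Lemma cutoff_le1 Z x : cutoff Z x <= 1.
Proof.
rewrite ler_pdivrMr ?flat0_gt0 ?bump_level_gt0// mul1r flat0_mono//.
by rewrite gerBl bump_sum_ge0.
Qed.

Lemma cutoff_eq0 Z x (z : 'rV[int]_n) : z \in Z ->
  (forall i, `|x 0 i - (z 0 i)%:~R| <= 1) -> cutoff Z x = 0.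
Proof.
move=> zZ xz; rewrite /cutoff flat_npos ?mul0r// subr_le0.
rewrite /bump_sum (big_rem z)//= ler_wpDr ?sumr_ge0//.
  by move=> w _; exact: bump_ge0.
by apply: bump_level_le => i; rewrite !mxE.
Qed.

Lemma cutoff_eq1 Z x : (forall z : 'rV[int]_n, z \in Z ->
  exists i, 2 <= `|x 0 i - (z 0 i)%:~R|) -> cutoff Z x = 1.
Proof.
move=> xZ; rewrite /cutoff [bump_sum _ _]big_seq big1 ?subr0.
  by rewrite divff// gt_eqF// flat0_gt0// bump_level_gt0.
by move=> z /xZ[i xi]; apply: (@bump_eq0 _ _ _ i); rewrite !mxE.
Qed.

Lemma cutoff_smooth Z : smooth (cutoff Z).
Proof.
apply/smoothP => N; apply: smooth_uptoM; last exact: smooth_upto_cst.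
apply: smooth_upto_flat; under eq_fun do rewrite -mulN1r.
apply: smooth_uptoD; first exact: smooth_upto_cst.
apply: smooth_uptoM; first exact: smooth_upto_cst.
exact: (smoothP _).1 (smooth_bump_sum _) N.
Qed.

Lemma cutoff_bounded N :
  bounded_upto N (fun Z : {Z : seq 'rV[int]_n | uniq Z} => cutoff (val Z)).
Proof.
have sS (Z : {Z : seq 'rV[int]_n | uniq Z}) : smooth_upto N (fun x => -1 * bump_sum (val Z) x).
  apply: smooth_uptoM; first exact: smooth_upto_cst.
  exact: (smoothP _).1 (smooth_bump_sum _) N.
have sD (Z : {Z : seq 'rV[int]_n | uniq Z}) :
    smooth_upto N (fun x => bump_level R n + -1 * bump_sum (val Z) x).
  by apply: smooth_uptoD => //; exact: smooth_upto_cst.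
rewrite (_ : (fun Z : {Z : seq 'rV[int]_n | uniq Z} => cutoff (val Z)) =
  fun (Z : {Z : seq 'rV[int]_n | uniq Z}) x =>
    flat 0 (bump_level R n + -1 * bump_sum (val Z) x) * (flat 0 (bump_level R n))^-1).
  apply: bounded_uptoM.
  - by move=> Z; exact: smooth_upto_flat.
  - by move=> Z; exact: smooth_upto_cst.
  - apply: bounded_upto_flat => //; apply: bounded_uptoD => //.
    + by move=> Z; exact: smooth_upto_cst.
    + exact: bounded_upto_cst.
    + apply: bounded_uptoM.
      * by move=> Z; exact: smooth_upto_cst.
      * move=> Z; exact: (smoothP _).1 (smooth_bump_sum _) N.
      * exact: bounded_upto_cst.
      * exact: bump_sum_bounded.
  - exact: bounded_upto_cst.
by apply/funext => Z; apply/funext => x; rewrite mulN1r.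
Qed.

Lemma smooth_affine phi c a : smooth phi -> smooth (fun y => phi (c *: y + a)).
Proof. by move=> /smoothP sphi; apply/smoothP => N; exact: smooth_upto_affine. Qed.

(** [Z] consists of the points of [E / eps] rounded to nearest integers. That every [z] comes from a
    point of [E] will make the cutoff equal to 1 far from [E]; that every point of [E] has its [z]
    will make it vanish near [E]. *)
Lemma int_cover (E : set 'rV[R]_n) (eps : R) : bounded_set E -> 0 < eps ->
  exists2 Z, uniq Z &
    (forall z : 'rV[int]_n, z \in Z -> exists2 e, E e &
      forall i, `|e 0 i / eps - (z 0 i)%:~R| <= 2^-1) /\
    (forall e, E e -> exists2 z : 'rV[int]_n, z \in Z &
      forall i, `|e 0 i / eps - (z 0 i)%:~R| <= 2^-1).
Proof.
move=> [M [Mr ME]] eps0.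
pose B : R := `|M| + 1.
have EB e i : E e -> `|e 0 i| <= B.
  move=> Ee; apply: (le_trans (coord_le_norm _ _)); apply: ME => //.
  by rewrite (le_lt_trans (ler_norm _))// ltrDl.
(* The coordinates of [e / eps] are at most [K - 1] in absolute value, so rounding keeps them within
   [K]; the grid is shifted by [K] to be indexed by ordinals. *)
pose K := (Num.truncn (B / eps)).+2.
have EK e i : E e -> `|e 0 i / eps| <= K%:R - 1.
  move=> Ee; rewrite normrM [`|eps^-1|]gtr0_norm ?invr_gt0//.
  rewrite -[K%:R]natr1 addrK.
  apply: (@le_trans _ _ (B / eps)); first by apply: ler_wpM2r; [rewrite invr_ge0 ltW|exact: EB].
  by rewrite ltW// truncnS_gt.
pose grid := undup [seq (\row_i ((f i : nat)%:Z - K%:Z) : 'rV[int]_n)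
  | f : {ffun 'I_n -> 'I_(K.*2).+1}].
exists [seq z : 'rV[int]_n <- grid | `[< exists2 e, E e &
      forall i, `|e 0 i / eps - (z 0 i)%:~R| <= 2^-1 >]].
  by rewrite filter_uniq// undup_uniq.
split=> [z|e Ee]; first by rewrite mem_filter => /andP[/asboolP].
pose z : 'rV[int]_n := \row_i Num.floor (e 0 i / eps + 2^-1).
have ze i : `|e 0 i / eps - (z 0 i)%:~R| <= 2^-1.
  rewrite mxE; have := floor_le (e 0 i / eps + 2^-1).
  have := floorD1_gt (e 0 i / eps + 2^-1); rewrite intrD ler_norml.
  move=> H1 H2; apply/andP; split; lra.
exists z => //; rewrite mem_filter; apply/andP; split; first by apply/asboolP; exists e.
rewrite mem_undup; apply/mapP.
exists [ffun i : 'I_n => inord `|(z 0 i + K%:Z)%R|%N]; first by rewrite mem_enum.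
apply/rowP => i; rewrite [RHS]mxE ffunE.
have zK : (- K%:Z <= z 0 i <= K%:Z)%R.
  have := ze i; have := EK e i Ee; rewrite -!(@ler_int R) !ler_norml rmorphN /=.
  have -> : (Posz K)%:~R = K%:R :> R by [].
  move=> /andP[H1 H2] /andP[H3 H4]; apply/andP; split; lra.
move: (z 0 i) zK => b /andP[b1 b2].
rewrite inordK; lia.
Qed.

(** A scaling argument. In the variable [y = x / eps] the cutoff has unit scale, and
    [phi (eps *: y)] has derivatives no larger than those of [phi] because [eps <= 1]; the products
    thus form one uniformly bounded family. Returning to [x] costs the factor [eps ^- m]. *)
Lemma cutoff_exists phi m : smooth phi ->
  (forall s, exists C : R, forall x, `|partials s phi x| <= C) ->
  exists2 C : R, 0 <= C & forall (E : set 'rV[R]_n) (eps : R), bounded_set E ->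
    0 < eps <= 1 -> exists psi : 'rV[R]_n -> R,
    [/\ smooth psi, forall x, 0 <= psi x <= 1,
      forall x e, E e -> `|x - e| <= eps / 2 -> psi x = 0,
      forall x, (forall e, E e -> 3 * eps <= `|x - e|) -> psi x = 1 &
      forall s x, size s = m ->
        `|partials s (fun x => phi x * psi x) x| <= C / eps ^+ m].
Proof.
move=> sphi bphi.
pose L := ({Z : seq 'rV[int]_n | uniq Z} * {eps : R | 0 < eps <= 1})%type.
pose Phi (l : L) y := phi (val l.2 *: y + 0) * cutoff (val l.1) y.
have sPhi l : smooth (Phi l).
  by apply: smoothM; [exact: smooth_affine|exact: cutoff_smooth].
have bPhi : bounded_upto m Phi.
  apply: bounded_uptoM.
  - by move=> l; apply: (smoothP _).1; exact: smooth_affine.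
  - by move=> l; exact: (smoothP _).1 (cutoff_smooth _) m.
  - apply/bounded_uptoP => s _; have [C CP] := bphi s; exists C => -[Z [e /= e01]] x.
    rewrite partials_affine// normrM; apply: le_trans (CP (e *: x + 0)).
    have /andP[e0 e1] := e01.
    by rewrite ler_piMl// normrX gtr0_norm// exprn_ile1// ltW.
  - apply/bounded_uptoP => s sm.
    have [C CP] := (bounded_uptoP _ _).1 (cutoff_bounded m) s sm.
    by exists C => l x; exact: CP.
have : exists C : R, forall s, size s = m -> forall l x, `|partials s (Phi l) x| <= C.
  have /choice[C CP] : forall s : m.-tuple 'I_n, exists C : R,
      forall l x, `|partials s (Phi l) x| <= C.
    by move=> s; apply: ((bounded_uptoP _ _).1 bPhi); rewrite size_tuple.
  exists (\sum_s `|C s|) => s sm l x.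
  have sm' : size s == m by rewrite sm.
  rewrite (bigD1 (Tuple sm'))//= (le_trans (CP (Tuple sm') l x))//.
  by rewrite (le_trans (ler_norm _))// lerDl sumr_ge0.
move=> [C CP]; exists `|C| => // E eps bE eps01.
have /andP[eps0 eps1] := eps01.
have [Z uZ [ZE EZ]] := int_cover bE eps0.
exists (fun x => cutoff Z (eps^-1 *: x + 0)); split.
- by apply: smooth_affine; exact: cutoff_smooth.
- by move=> x; rewrite cutoff_ge0 cutoff_le1.
- move=> x e /EZ[z zZ ez] xe; apply: (cutoff_eq0 zZ) => i.
  rewrite !mxE addr0.
  have -> : eps^-1 * x 0 i - (z 0 i)%:~R =
    (x - e) 0 i / eps + (e 0 i / eps - (z 0 i)%:~R) by rewrite !mxE; ring.
  rewrite (le_trans (ler_normD _ _))//.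
  have : `|(x - e) 0 i / eps| <= 2^-1.
    rewrite normrM [`|eps^-1|]gtr0_norm ?invr_gt0// ler_pdivrMr//.
    by rewrite (le_trans (coord_le_norm _ _))// mulrC.
  by have := ez i; lra.
- move=> x xE; apply: cutoff_eq1 => z /ZE[e Ee ez].
  apply: contrapT => /forallNP xz.
  (* The half-side 2 of the support of a bump plus the rounding error 1/2 stays below 3. Similarly,
     above, 1/2 plus the rounding error stays in the unit cube where [cutoff] vanishes. *)
  suff : `|x - e| <= 5 / 2 * eps by have := xE e Ee; lra.
  apply: rV_norm_le => [|i]; first by rewrite mulr_ge0// ltW.
  rewrite -ler_pdivrMr//.
  have -> : `|(x - e) 0 i| / eps = `|(x - e) 0 i / eps|.
    by rewrite normrM [`|eps^-1|]gtr0_norm ?invr_gt0.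
  have /negP := xz i; rewrite -ltNge !mxE addr0 => xzi.
  have -> : (x 0 i - e 0 i) / eps =
    (eps^-1 * x 0 i - (z 0 i)%:~R) - (e 0 i / eps - (z 0 i)%:~R) by ring.
  by rewrite (le_trans (ler_normB _ _))//; have := ez i; lra.
- move=> s x sm.
  have -> : (fun x0 => phi x0 * cutoff Z (eps^-1 *: x0 + 0)) =
      (fun x => Phi (exist _ Z uZ, exist _ eps eps01) (eps^-1 *: x + 0)).
    apply/funext => y; rewrite /Phi /=; congr (phi _ * _).
    by rewrite !addr0 scalerA divff ?scale1r// gt_eqF.
  rewrite partials_affine// normrM sm -exprVn mulrC normrX.
  rewrite [`|eps^-1|]gtr0_norm ?invr_gt0//.
  rewrite ler_wpM2r ?exprn_ge0 ?invr_ge0 ?(ltW eps0)//.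
  by rewrite (le_trans (CP s sm _ _))// ler_norm.
Qed.

End cutoff.

(** * The nonlinearity *)

Section halfline.
Variable R : realType.
Implicit Types (g : R -> R) (x y : R).

Lemma halfline_is_derive g x : 0 < x -> halfline_derivable g x ->
  is_derive x 1 g (halfline_derive g x).
Proof.
move=> x0 dg.
have c : h^-1 * (g (x + h) - g x) @[h --> 0^'] --> halfline_derive g x.
  move=> P Pl.
  have nP : \forall h \near 0^', 0 <= x + h -> P (h^-1 * (g (x + h) - g x)).
    exact: (dg P Pl).
  have nx : \forall h \near 0^', 0 <= x + h.
    near=> h; have : `|h| < x by near: h; exact: dnbhs0_lt.
    by rewrite ltr_norml; lra.
  change (\forall h \near 0^', P (h^-1 * (g (x + h) - g x))).
  by apply: filterS2 nx nP => h ?; apply.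
have c' : h^-1 *: ((g \o shift x) (h *: 1) - g x) @[h --> 0^'] --> halfline_derive g x.
  apply: cvg_trans c; apply: near_eq_cvg; near=> h.
  by rewrite /= /GRing.scale/= mulr1 (addrC x h).
by apply: DeriveDef; [apply/cvg_ex; exists (halfline_derive g x)|exact/cvg_lim].
Unshelve. all: by end_near. Qed.

Lemma halfline_right_continuous g : halfline_derivable g 0 ->
  g x @[x --> 0^'+] --> g 0.
Proof.
move=> dg.
have c : h^-1 * (g (0 + h) - g 0) @[h --> 0^'+] --> halfline_derive g 0.
  move=> P Pl.
  have nP : \forall h \near (0 : R), h != 0 -> 0 <= 0 + h ->
      P (h^-1 * (g (0 + h) - g 0)).
    exact: (dg P Pl).
  change (\forall h \near (0 : R), 0 < h -> P (h^-1 * (g (0 + h) - g 0))).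
  apply: filterS nP => h + h0; apply; first by rewrite gt_eqF.
  by rewrite add0r ltW.
have c2 : h * (h^-1 * (g (0 + h) - g 0)) + g 0 @[h --> 0^'+] --> 0 * halfline_derive g 0 + g 0.
  apply: cvgD; last exact: cvg_cst.
  apply: cvgM => //; exact: cvg_at_right_filter cvg_id.
rewrite mul0r add0r in c2; apply: cvg_trans c2; apply: near_eq_cvg; near=> h.
have h0 : 0 < h by [].
by rewrite add0r mulVKf ?subrK// gt_eqF.
Unshelve. all: by end_near. Qed.

Lemma halfline_within_continuous g a b : (forall x, 0 <= x -> halfline_derivable g x) ->
  0 <= a -> a < b -> {within `[a, b], continuous g}.
Proof.
move=> dg a0 ab.
have cg x : 0 < x -> {for x, continuous g}.
  move=> x0; apply/differentiable_continuous/derivable1_diffP.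
  exact: (ex_derive (is_derive := halfline_is_derive x0 (dg x (ltW x0)))).
apply/continuous_within_itvP => //; split.
- by move=> x; rewrite in_itv/= => /andP[ax _]; apply: cg; exact: le_lt_trans ax.
- move: a0; rewrite le_eqVlt => /predU1P[<-|a0].
    exact/halfline_right_continuous/dg.
  exact/cvg_at_right_filter/cg.
- apply/cvg_at_left_filter/cg; exact: le_lt_trans ab.
Qed.

Lemma halfline_MVT g x y : (forall x, 0 <= x -> halfline_derivable g x) ->
  0 <= x -> x < y -> exists2 c, x < c < y &
  g y - g x = halfline_derive g c * (y - x).
Proof.
move=> dg x0 xy.
have [c|c] := @MVT R g (halfline_derive g) x y xy _
  (halfline_within_continuous dg x0 xy).
  rewrite in_itv/= => /andP[xc _]; apply: halfline_is_derive.
    exact: le_lt_trans xc.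
  by apply/dg/ltW; exact: le_lt_trans xc.
by rewrite in_itv/= => cxy E; exists c.
Qed.

End halfline.

(** * Convexity of [g] and the inverse of its derivative *)

Section admissible.
Variables (R : realType) (g : R -> R).
Hypothesis ag : admissible_g g.
Let h := halfline_derive g.

Let dg x : 0 <= x -> halfline_derivable g x.
Proof. by case: ag => -[+ _ _] _ _ _; apply. Qed.

Let dh x : 0 <= x -> halfline_derivable h x.
Proof. by case: ag => -[_ + _] _ _ _; apply. Qed.

Let g_0 : g 0 = 0. Proof. by case: ag. Qed.

Lemma admissible_gt0 z : 0 < z -> 0 < g z.
Proof. by move=> z0; case: ag => _ _ _ /(_ z z0)[]. Qed.

Lemma admissible_ge0 z : 0 <= z -> 0 <= g z.
Proof. by case: ag => _ _ + _; apply. Qed.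

Lemma derive_mono x y : 0 <= x -> x <= y -> h x <= h y.
Proof.
move=> x0; rewrite le_eqVlt => /predU1P[->//|xy].
have [c /andP[xc _] E] := halfline_MVT dh x0 xy.
have c0 : 0 < c by exact: le_lt_trans xc.
rewrite -subr_ge0 E mulr_ge0 ?subr_ge0 ?(ltW xy)// ltW//.
by case: ag => _ _ _ /(_ c c0)[].
Qed.

(** Convexity together with [g 0 = 0] makes [g z / z] nondecreasing. The iteration and the averaging
    over a layer use convexity only in this form. *)
Lemma admissible_slope x y : 0 < x -> x <= y -> y * g x <= x * g y.
Proof.
move=> x0; rewrite le_eqVlt => /predU1P[->//|xy].
have [c /andP[c0 cx]] := halfline_MVT dg (lexx 0) x0.
rewrite g_0 !subr0 => E1.
have [d /andP[xd dy] E2] := halfline_MVT dg (ltW x0) xy.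
have cd : h c <= h d by apply: derive_mono; [exact: ltW|lra].
have -> : y * g x = x * (h c * (y - x)) + x * g x by rewrite E1 -/h; ring.
have -> : g y = h d * (y - x) + g x by rewrite -E2; ring.
by rewrite [leRHS]mulrDr lerD2r ler_wpM2l ?(ltW x0)// ler_wpM2r ?subr_ge0// ltW.
Qed.

Lemma admissible_le_derive x : 0 < x -> g x <= x * h x.
Proof.
move=> x0; have [c /andP[c0 cx]] := halfline_MVT dg (lexx 0) x0.
rewrite g_0 !subr0 => ->; rewrite mulrC ler_wpM2l ?(ltW x0)//.
by apply: derive_mono; exact: ltW.
Qed.

(** Over [[x, 2x]] the function [g] rises by at least [x] times its slope at [x]. This converts a
    bound on [g] into one on its derivative at half the argument, which is how the Legendre
    transform is reached in [young_weak]. *)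
Lemma derive_le_admissible x : 0 < x -> x * h x <= g (2 * x).
Proof.
move=> x0; have [|c /andP[c0 cx]] := halfline_MVT dg (ltW x0) (y := 2 * x); first lra.
move=> E; have : h x <= h c by apply: derive_mono; exact: ltW.
have := admissible_gt0 x0; rewrite -/h in E.
have -> : g (2 * x) = h c * (2 * x - x) + g x by rewrite -E; ring.
move=> gx hc; have : h x * x <= h c * x by rewrite ler_wpM2r// ltW.
lra.
Qed.

Lemma admissible_continuous x : 0 < x -> {for x, continuous g}.
Proof.
move=> x0; apply/differentiable_continuous/derivable1_diffP.
exact: (ex_derive (is_derive := halfline_is_derive x0 (dg (ltW x0)))).
Qed.

(** The pseudo-inverse picks some preimage as soon as one exists, and the intermediate value theorem
    on [[0, b]] gives one. The argument uses monotonicity of [h] but not its strictness, hence the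
    separate case [z = h b], in which the chosen preimage might lie beyond [b]. *)
Lemma derive_inv_spec z b : 0 < b -> h 0 <= z -> z <= h b ->
  [/\ 0 <= derive_inv g z, derive_inv g z <= b \/ z = h b & h (derive_inv g z) = z].
Proof.
move=> b0 hz zb.
have zim : (h @` `[0, +oo[) z.
  have [||c] := @IVT R h 0 b z (ltW b0).
  - exact: halfline_within_continuous.
  - by rewrite ge_min hz le_max zb orbT.
  by rewrite in_itv/= => /andP[c0 _] hc; exists c => //=; rewrite in_itv/= c0.
have inv0 : 0 <= derive_inv g z.
  have : `[0, +oo[%classic (derive_inv g z).
    have := @surjpinv_image_sub _ _ (fun=> 0) `[(0 : R), +oo[ (h @` `[0, +oo[) h _.
    by apply => //; exists z.
  by rewrite /= in_itv/= andbT.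
have hE : h (derive_inv g z) = z by rewrite /derive_inv pinvK// inE.
split => //; have [|bz] := leP (derive_inv g z) b; [by left|right].
by apply/eqP; rewrite eq_le zb -hE derive_mono// ltW.
Qed.

(** * The tail integral [G], its values and its discrete counterpart *)

Section tail_integral.
Variable m : nat.
Hypothesis m_ge1 : (1 <= m)%N.
Hypothesis gint :
  (\int[lebesgue_measure]_(z in `[1%R, +oo[) (G_integrand m g z)%:E < +oo)%E.
Let k := G_integrand m g.
Let G := G_fun m g.

(** The integrand of [G] is [root_ratio z / z], so [G] integrates a nonincreasing function against
    [dz / z]. Up to a constant factor, [root_ratio y] is also the decrease of the radius paid for
    one doubling of [J]. *)
Definition root_ratio y : R := (y / g y) `^ m%:R^-1.

Let root_pos : 0 < m%:R^-1 :> R. Proof. by rewrite invr_gt0 ltr0n. Qed.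

Lemma root_ratio_gt0 y : 0 < y -> 0 < root_ratio y.
Proof. by move=> y0; rewrite powR_gt0// divr_gt0// admissible_gt0. Qed.

Lemma root_ratio_pow y : 0 < y -> root_ratio y ^+ m = y / g y.
Proof.
move=> y0; rewrite /root_ratio -powR_mulrn ?powR_ge0// -powRrM mulVf ?pnatr_eq0 -?lt0n//.
by rewrite powRr1// divr_ge0 ?admissible_ge0// ltW.
Qed.

Lemma root_ratio_noninc x y : 0 < x -> x <= y -> root_ratio y <= root_ratio x.
Proof.
move=> x0 xy; have y0 : 0 < y by exact: lt_le_trans xy.
apply: ge0_ler_powR; rewrite ?nnegrE ?divr_ge0 ?admissible_ge0 ?(ltW x0) ?(ltW y0)//.
rewrite ler_pdivrMr ?admissible_gt0// mulrAC ler_pdivlMr ?admissible_gt0//.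
exact: admissible_slope.
Qed.

Lemma G_integrandE z : 0 < z -> k z = root_ratio z / z.
Proof.
move=> z0; rewrite /k /G_integrand /root_ratio powRB; last by rewrite (gt_eqF z0) implybT.
rewrite powRr1 ?(ltW z0)// powRN.
rewrite powRM ?invr_ge0 ?admissible_ge0 ?(ltW z0)//.
rewrite -[(g z)^-1]powR_inv1 ?admissible_ge0 ?(ltW z0)// -powRrM mulN1r powRN.
by rewrite mulrA [_^-1 * _]mulrC.
Qed.

Lemma G_integrand_ge0 z : 0 < z -> 0 <= k z.
Proof. by move=> z0; rewrite G_integrandE// divr_ge0 ?(ltW z0)// ltW// root_ratio_gt0. Qed.

Lemma G_integrand_ge b z : 0 < z -> z <= b -> root_ratio b / b <= k z.
Proof.
move=> z0 zb; have b0 : 0 < b by exact: lt_le_trans zb.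
rewrite G_integrandE// ler_pM ?invr_ge0 ?(ltW b0) ?(ltW (root_ratio_gt0 b0))//.
  exact: root_ratio_noninc.
by rewrite lef_pV2 ?posrE.
Qed.

Lemma G_integrand_le a z : 0 < a -> a <= z -> k z <= root_ratio a / a.
Proof.
move=> a0 az; have z0 : 0 < z by exact: lt_le_trans az.
rewrite G_integrandE// ler_pM ?invr_ge0 ?(ltW z0) ?(ltW (root_ratio_gt0 z0))//.
  exact: root_ratio_noninc.
by rewrite lef_pV2 ?posrE.
Qed.

Let mk : measurable_fun (`]0, +oo[%classic : set R) k.
Proof.
apply: measurable_funM.
  apply: (measurableT_comp (measurable_powR (- m%:R^-1))).
  apply: open_continuous_measurable_fun; first exact: interval_open.
  by move=> x; rewrite inE/= in_itv/= andbT => x0; exact: admissible_continuous.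
exact: measurable_funTS (measurable_powR _).
Qed.

Let mk' (D : set R) : measurable D -> D `<=` `]0, +oo[%classic -> measurable_fun D (EFin \o k).
Proof.
move=> mD D0; apply/measurable_EFinP; apply: measurable_funS mk => //.
Qed.

Let bnd_itv a b : 0 < a -> [bounded k x | x in `[a, b[%classic].
Proof.
move=> a0; exists (root_ratio a / a); split; first exact: num_real.
move=> x ax z /=; rewrite in_itv/= => /andP[az _].
rewrite ger0_norm ?G_integrand_ge0 ?(lt_le_trans a0)//.
exact: le_trans (G_integrand_le a0 az) (ltW ax).
Qed.

Let int_itv a b : 0 < a -> lebesgue_measure.-integrable `[a, b[ (EFin \o k).
Proof.
move=> a0; apply: measurable_bounded_integrable => //.
- by rewrite /= lebesgue_measure_itv /=; case: ifP => _; rewrite ?ltry// -EFinB ltry.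
- apply: measurable_funS mk => // x /=; rewrite !in_itv/= andbT => /andP[ax _].
  exact: lt_le_trans ax.
- exact: bnd_itv.
Qed.

Lemma G_integrable a : 0 < a -> lebesgue_measure.-integrable `[a, +oo[ (EFin \o k).
Proof.
move=> a0.
have i1 : lebesgue_measure.-integrable `[1, +oo[ (EFin \o k).
  apply/integrableP; split.
    by apply: mk' => // x /=; rewrite !in_itv/= !andbT; exact: lt_le_trans.
  apply: le_lt_trans gint; rewrite le_eqVlt; apply/predU1P; left.
  apply: eq_integral => x; rewrite inE/= in_itv/= andbT => x1.
  by rewrite ger0_norm// G_integrand_ge0// (lt_le_trans _ x1).
have [a1|a1] := leP 1 a.
  by apply: integrableS i1 => // x /=; rewrite !in_itv/= !andbT; exact: le_trans.
have U : `[a, +oo[%classic = `[a, 1[ `|` `[1, +oo[ :> set R.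
  by rewrite (@itv_bndbnd_setU _ _ (BLeft a) (BLeft 1) +oo%O)// bnd_simp ltW.
apply/integrableP; split.
  by apply: mk' => // x /=; rewrite !in_itv/= !andbT; exact: lt_le_trans.
rewrite U ge0_integral_setU//=.
- by apply: lte_add_pinfty; [have /integrableP[] := int_itv 1 a0|have /integrableP[] := i1].
- rewrite -U; apply: measurableT_comp => //; apply: measurableT_comp => //.
  by apply: measurable_funS mk => // x /=; rewrite !in_itv/= !andbT; exact: lt_le_trans.
- apply/disj_setPS => x [] /=; rewrite !in_itv/= => /andP[_ x1] /andP[x1' _].
  by move: x1; rewrite ltNge x1'.
Qed.

Lemma G_splitE a b : 0 < a -> a <= b ->
  G a - G b = \int[lebesgue_measure]_(z in `[a, b[) k z.
Proof.
move=> a0 ab; rewrite /G /G_fun.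
have U : `[a, +oo[%classic = `[a, b[ `|` `[b, +oo[ :> set R.
  by rewrite (@itv_bndbnd_setU _ _ (BLeft a) (BLeft b) +oo%O).
rewrite U Rintegral_setU//.
- by rewrite addrK.
- by rewrite -U; exact: G_integrable.
- apply/disj_setPS => x [] /=; rewrite !in_itv/= => /andP[_ x1] /andP[x1' _].
  by move: x1; rewrite ltNge x1'.
Qed.

Let mu_itv a b : a <= b -> fine (lebesgue_measure (`[a, b[%classic : set R)) = b - a.
Proof.
rewrite le_eqVlt => /predU1P[->|ab]; rewrite lebesgue_measure_itv/= lte_fin.
  by rewrite ltxx subrr.
by rewrite ab -EFinB.
Qed.

Let int_cst (a b c : R) : lebesgue_measure.-integrable `[a, b[ (EFin \o (fun=> c)).
Proof.
apply: measurable_bounded_integrable => //.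
  by rewrite /= lebesgue_measure_itv /=; case: ifP => _; rewrite ?ltry// -EFinB ltry.
by exists `|c|; split; [exact: num_real|move=> x cx z _; exact: ltW].
Qed.

Lemma G_sub_ge a b : 0 < a -> a <= b -> (b - a) * (root_ratio b / b) <= G a - G b.
Proof.
move=> a0 ab; rewrite G_splitE// mulrC -mu_itv// -Rintegral_cst//.
apply: le_Rintegral => //; [exact: int_itv|].
move=> z /=; rewrite in_itv/= => /andP[az zb].
by apply: G_integrand_ge; [exact: lt_le_trans az|exact: ltW].
Qed.

Lemma G_sub_le a b : 0 < a -> a <= b -> G a - G b <= (b - a) * (root_ratio a / a).
Proof.
move=> a0 ab; rewrite G_splitE// mulrC -mu_itv// -Rintegral_cst//.
apply: le_Rintegral => //; [exact: int_itv|].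
by move=> z /=; rewrite in_itv/= => /andP[az zb]; exact: G_integrand_le.
Qed.

Lemma G_ge0 a : 0 < a -> 0 <= G a.
Proof.
move=> a0; apply: Rintegral_ge0 => z /=; rewrite in_itv/= andbT => az.
by rewrite G_integrand_ge0// (lt_le_trans a0).
Qed.

Lemma G_noninc a b : 0 < a -> a <= b -> G b <= G a.
Proof.
move=> a0 ab; rewrite -subr_ge0 G_splitE//; apply: Rintegral_ge0 => z /=.
by rewrite in_itv/= => /andP[az _]; rewrite G_integrand_ge0// (lt_le_trans a0).
Qed.

(** On [[2w/3, w]], of length [w / 3], the integrand is at least [root_ratio w / w], so
    [root_ratio w <= 3 (G (2w/3) - G w)]. For [w] in geometric progression of ratio 3/2 these
    intervals are adjacent and the bounds telescope. *)
Lemma sum_root_ratio_le N y : 0 < y ->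
  \sum_(i < N) root_ratio ((3 / 2) ^+ i * y) <= 3 * G (2 / 3 * y).
Proof.
have step (a b c d : R) : d / 3 <= b - c -> 3 * (a - b) + d <= 3 * (a - c) by lra.
move=> y0; have p0 i : 0 < (3 / 2) ^+ i * y :> R by rewrite mulr_gt0// exprn_gt0.
suff H : \sum_(i < N) root_ratio ((3 / 2) ^+ i * y) <=
    3 * (G (2 / 3 * y) - G (2 / 3 * ((3 / 2) ^+ N * y))).
  apply: le_trans H _; rewrite ler_wpM2l// gerBl G_ge0// mulr_gt0//.
elim: N => [|N IH]; first by rewrite big_ord0 expr0 mul1r subrr mulr0.
rewrite big_ord_recr/=.
have := @G_sub_ge (2 / 3 * ((3 / 2) ^+ N * y)) ((3 / 2) ^+ N * y).
have -> : 2 / 3 * ((3 / 2) ^+ N.+1 * y) = (3 / 2) ^+ N * y.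
  by rewrite exprS mulrA mulrA [2 / 3 * _]mulf_div mulrC mulrA; field.
have := p0 N; move: ((3 / 2) ^+ N * y) IH => w IH w0.
have -> : (w - 2 / 3 * w) * (root_ratio w / w) = root_ratio w / 3.
  by field; rewrite gt_eqF.
have w1 : 0 < 2 / 3 * w by rewrite mulr_gt0.
have w2 : 2 / 3 * w <= w by rewrite ger_pMl// ler_pdivrMr// mul1r ler_nat.
by move=> /(_ w1 w2) H; apply: le_trans (lerD IH (lexx _)) _; exact: step.
Qed.

Lemma root_ratio_le_G y : 0 < y -> root_ratio y <= 3 * G (2 / 3 * y).
Proof. by move=> y0; have := sum_root_ratio_le 1 y0; rewrite big_ord1 expr0 mul1r. Qed.

(** If [g z <= M z] for all positive [z], then [root_ratio] is bounded below by a positive constant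
    and the sums in [sum_root_ratio_le] exceed the fixed bound [3 G (2/3)]. *)
Lemma admissible_superlinear (M : R) : exists2 z, 0 < z & M * z < g z.
Proof.
apply: contrapT => H.
have gM z : 0 < z -> g z <= M * z.
  by move=> z0; rewrite leNgt; apply/negP => gz; apply: H; exists z.
have M0 : 0 < M by have := gM 1 ltr01; have := admissible_gt0 ltr01; lra.
pose c := M^-1 `^ m%:R^-1.
have c0 : 0 < c by rewrite powR_gt0 ?invr_gt0.
have rc z : 0 < z -> c <= root_ratio z.
  move=> z0; apply: ge0_ler_powR.
  - exact: ltW.
  - by rewrite nnegrE invr_ge0 ltW.
  - by rewrite nnegrE divr_ge0 ?admissible_ge0// ltW.
  - rewrite ler_pdivlMr ?admissible_gt0// mulrC ler_pdivrMr//.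
    by rewrite mulrC gM.
pose N := (Num.truncn (3 * G (2 / 3 * 1) / c)).+1.
have : c * N%:R <= 3 * G (2 / 3 * 1).
  apply: le_trans (sum_root_ratio_le N ltr01).
  rewrite mulr_natr -[N in X in X <= _]card_ord -sumr_const; apply: ler_sum => i _.
  by apply: rc; rewrite mulr_gt0// exprn_gt0.
by rewrite -ler_pdivlMl// mulrC leNgt truncnS_gt.
Qed.

Lemma G_tail (e : R) : 0 < e -> exists2 T, 0 < T & G T < e.
Proof.
move=> e0; pose F (i : nat) : set R := `[1, 1 + i%:R[%classic.
have ndF : {homo F : i j / (i <= j)%N >-> (i <= j)%O}.
  move=> i j ij; apply/subsetPset => x; rewrite /F/= !in_itv/= => /andP[-> /lt_le_trans].
  by apply; rewrite lerD2l ler_nat.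
have FU : \bigcup_i F i = `[1, +oo[%classic.
  apply/seteqP; split=> [x [i _]|x]; rewrite /F/= !in_itv/= ?andbT.
    by move=> /andP[].
  move=> x1; exists (Num.truncn x).+1 => //=; rewrite in_itv/= x1/=.
  by rewrite (lt_trans (truncnS_gt x))// ltrDr.
have F0 x i : F i x -> 0 < x.
  by rewrite /F/= in_itv/= => /andP[x1 _]; exact: lt_le_trans x1.
have cF : (\int[lebesgue_measure]_(x in F i) (k x)%:E @[i --> \oo] -->
    \int[lebesgue_measure]_(x in `[1%R, +oo[) (k x)%:E)%E.
  rewrite -FU; apply: ge0_nondecreasing_set_cvg_integral => //.
  - by move=> i; exact: measurable_itv.
  - move=> i; apply: mk'; first exact: measurable_itv.
    by move=> x /F0; rewrite /= in_itv/= andbT.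
  - by move=> i x /F0 x0; rewrite lee_fin G_integrand_ge0.
have lim_gt : ((G 1 - e)%:E < \int[lebesgue_measure]_(x in `[1%R, +oo[) (k x)%:E)%E.
  rewrite -(@fineK _ (integral _ _ _)).
    by rewrite lte_fin ltrBlDr ltrDl.
  exact/integrable_fin_num/G_integrable.
have := cF _ (open_ereal_gt' lim_gt).
move=> [i _ /(_ i (leqnn i))] Hi; exists (1 + i%:R); first by rewrite ltr_pwDl.
have := @G_splitE 1 (1 + i%:R) ltr01.
rewrite lerDl ler0n => /(_ isT) E.
have : G 1 - e < \int[lebesgue_measure]_(z in `[1, 1 + i%:R[) k z.
  rewrite -lte_fin /Rintegral fineK//.
  exact/integrable_fin_num/int_itv.
rewrite -E; lra.
Qed.

Lemma G_continuous t : 0 < t -> {for t, continuous G}.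
Proof.
move=> t0; have t20 : 0 < t / 2 by rewrite divr_gt0.
pose K := root_ratio (t / 2) / (t / 2).
have K0 : 0 < K by rewrite divr_gt0// root_ratio_gt0.
have lip a b : t / 2 <= a -> a <= b -> `|G a - G b| <= (b - a) * K.
  move=> ta ab; have a0 : 0 < a by exact: lt_le_trans ta.
  rewrite ger0_norm ?subr_ge0 ?G_noninc//; apply: le_trans (G_sub_le a0 ab) _.
  rewrite ler_wpM2l ?subr_ge0// ler_pM ?invr_ge0 ?(ltW a0) ?(ltW (root_ratio_gt0 a0))//.
    exact: root_ratio_noninc.
  by rewrite lef_pV2 ?posrE.
apply/cvgrPdist_le => e e0; near=> s.
have ts : `|t - s| <= t / 2 by near: s; exact: (@cvgr_dist_le _ _ _ _ _ id).
have es : `|t - s| * K <= e.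
  rewrite -ler_pdivlMr//; near: s.
  by apply: (@cvgr_dist_le _ _ _ _ _ id) => //; rewrite divr_gt0.
have [st|st] := leP s t.
  rewrite distrC; move: ts es; rewrite ger0_norm ?subr_ge0// => ts es.
  by apply: le_trans es; apply: lip => //; lra.
move: ts es; rewrite ltr0_norm ?subr_lt0// opprB => ts es.
by apply: le_trans es; apply: lip => //; [lra|exact: ltW].
Unshelve. all: by end_near. Qed.

Lemma G_attained y s : 0 < y -> 0 < s -> s < G y -> exists2 t, y < t & G t = s.
Proof.
move=> y0 s0 sG; have [T T0 GT] := G_tail s0.
have yT : y < T by rewrite ltNge; apply/negP => /(G_noninc T0); lra.
have cG : {within `[y, T], continuous G}.
  apply: continuous_in_subspaceT => t; rewrite inE/= in_itv/= => /andP[yt _].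
  exact/G_continuous/(lt_le_trans y0).
have [|t] := IVT (ltW yT) cG (v := s).
  by rewrite ge_min (ltW GT) orbT le_max (ltW sG).
rewrite in_itv/= => /andP[yt tT] Gt; exists t => //.
by rewrite lt_neqAle yt andbT; apply/eqP => E; move: sG; rewrite E Gt ltxx.
Qed.

(* [G_inv] is only a pseudo-inverse here: what matters is that [G] takes every
   value between 0 and [G y] beyond [y]. *)
Lemma G_inv_le s y : 0 < s -> 0 < y -> (G_inv m g s%:E <= y%:E)%E -> G y <= s.
Proof.
move=> s0 y0; rewrite /G_inv gt_eqF// lee_fin => py.
rewrite leNgt; apply/negP => sG; have [t yt Gt] := G_attained y0 s0 sG.
have sim : (G @` `]0, +oo[) s.
  by exists t => //=; rewrite in_itv/= andbT (lt_trans y0).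
move: py sG; set p := 'pinv_(_) _ _ s => py.
have Gp : G p = s by rewrite /p -/G pinvK// inE.
have p0 : 0 < p.
  have : (`]0, +oo[%classic : set R) p.
    have := @surjpinv_image_sub _ _ (fun=> 0) `]0, +oo[ (G @` `]0, +oo[) G _.
    by apply => //; exists s.
  by rewrite /= in_itv/= andbT.
by rewrite ltNge -Gp G_noninc.
Qed.

Lemma derive_unbounded (M : R) : exists2 b, 0 < b & M < h b.
Proof.
have [b b0 Mb] := admissible_superlinear M; exists b => //.
rewrite -(ltr_pM2l b0); apply: lt_le_trans (admissible_le_derive b0).
by rewrite mulrC.
Qed.

Lemma derive0_le z : 0 <= z -> h 0 <= h z.
Proof. exact: derive_mono. Qed.

(** Extended by 0 to the left of [h 0], the inverse is monotone on the whole line, and its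
    measurability follows. *)
Let inv_ext (z : R) : R := if z < h 0 then 0 else derive_inv g z.

Let inv_ext_mono : nondecreasing_fun inv_ext.
Proof.
move=> z w zw; rewrite /inv_ext; have [b b0 hb] := derive_unbounded w.
case: ltP => hz.
  case: ltP => // hw; have [+ _ _] := derive_inv_spec b0 hw (ltW hb); exact.
rewrite ifF; last by apply/negbTE; rewrite -leNgt (le_trans hz).
have [pw _ hw] := derive_inv_spec b0 (le_trans hz zw) (ltW hb).
have [pz _ hz'] := derive_inv_spec b0 hz (le_trans zw (ltW hb)).
rewrite leNgt; apply/negP => wlt.
have hwz : h (derive_inv g w) <= h (derive_inv g z) by apply: derive_mono => //; exact: ltW.
have E : z = w by apply/eqP; rewrite eq_le zw/= -hw -hz'.
by move: wlt; rewrite E ltxx.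
Qed.

(* Weaker than Young's inequality [z <= y g(z) + gamma(1/y)], but it needs no
   change of variables in the integral defining [g^*]. *)
Lemma young_weak (y z : R) : 0 < y -> 0 <= z -> z <= 4 * (y * g z) + 4 * gamma_fun g (1 / y).
Proof.
move=> y0; have step (a b c : R) : 0 <= b -> 0 <= c -> a <= 4 * b \/ a <= 4 * c ->
  a <= 4 * b + 4 * c by move=> ? ? []; lra.
have xi0 : 0 < 1 / y by rewrite divr_gt0.
move: {-2}(1 / y) (erefl (1 / y)) xi0 => xi xiE xi0.
have lint0 : 0 <= legendre g xi.
  rewrite /legendre; case: ifPn => //; rewrite -ltNge => hxi.
  have [b b0 hb] := derive_unbounded xi.
  apply: Rintegral_ge0 => w /=; rewrite in_itv/= => /andP[hw wxi].
  by have [] := derive_inv_spec b0 hw (le_trans wxi (ltW hb)).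
rewrite le_eqVlt => /predU1P[<-|z0].
  apply: step; [by rewrite g_0 mulr0| |right]; rewrite /gamma_fun.
    by rewrite divr_ge0// ltW.
  by rewrite mulr_ge0// divr_ge0// ltW.
apply: step.
- by rewrite mulr_ge0 ?(ltW y0)// admissible_ge0 ?(ltW z0).
- by rewrite /gamma_fun divr_ge0// ltW.
have [zg|gz] := leP z (4 * (y * g z)); [by left|right].
have z20 : 0 < z / 2 by rewrite divr_gt0.
(* In the remaining case [z > 4 y g(z)], the derivative at [z / 2] is below [xi / 2]. Hence the
   inverse is at least [z / 2] on [[xi / 2, xi]], and this interval alone contributes [xi z / 4] to
   the Legendre transform. *)
have hz2 : h (z / 2) < xi / 2.
  have := derive_le_admissible z20; rewrite mulrCA divff ?mulr1//.
  rewrite -(ltr_pM2l z20) => H; apply: le_lt_trans H _.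
  have -> : z / 2 * (xi / 2) = z * xi / 4 by field.
  rewrite ltr_pdivlMr// -(ltr_pM2l y0).
  have -> : y * (z * xi) = z by rewrite xiE; field; rewrite gt_eqF.
  by have -> : y * (g z * 4) = 4 * (y * g z) by ring.
have h0xi : h 0 <= xi / 2 by rewrite (le_trans (derive0_le (ltW z20)))// ltW.
have xi2 : xi / 2 <= xi by rewrite ler_pdivrMr// ler_peMr ?ler1n// ltW.
have h0x : h 0 < xi.
  by rewrite (le_lt_trans (derive0_le (ltW z20)))// (lt_le_trans hz2).
have [b b0 hb] := derive_unbounded xi.
suff H : xi / 2 * (z / 2) <= legendre g xi.
  rewrite /gamma_fun mulrA ler_pdivlMr// mulrC.
  have -> : xi * z = 4 * (xi / 2 * (z / 2)) by field.
  by rewrite ler_pM2l.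
rewrite /legendre -/h ifF; last by apply/negbTE; rewrite -ltNge.
have int_all : lebesgue_measure.-integrable `[h 0, xi] (EFin \o derive_inv g).
  apply: measurable_bounded_integrable => //.
  - by rewrite /= lebesgue_measure_itv /=; case: ifP => _; rewrite ?ltry// -EFinB ltry.
  - apply: (@eq_measurable_fun _ _ _ _ _ inv_ext).
      move=> w; rewrite inE/= in_itv/= => /andP[hw _].
      by rewrite /inv_ext ltNge hw.
    exact: nondecreasing_measurable.
  - exists b; split; first exact: num_real.
    move=> w bw v /=; rewrite in_itv/= => /andP[hv vxi].
    have [v0 vb _] := derive_inv_spec b0 hv (le_trans vxi (ltW hb)).
    rewrite ger0_norm//; apply: le_trans (ltW bw).
    case: vb => // E; move: vxi; rewrite E leNgt hb//.
have U : `[h 0, xi]%classic = `[h 0, xi / 2[ `|` `[xi / 2, xi] :> set R.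
  by rewrite (@itv_bndbnd_setU _ _ (BLeft (h 0)) (BLeft (xi / 2)) (BRight xi))// bnd_simp.
have int_hi : lebesgue_measure.-integrable `[xi / 2, xi] (EFin \o derive_inv g).
  by apply: integrableS int_all => //; rewrite U; exact: subsetUr.
rewrite U Rintegral_setU//; first last.
- apply/disj_setPS => x [] /=; rewrite !in_itv/= => /andP[_ x1] /andP[x1' _].
  by move: x1; rewrite ltNge x1'.
- by rewrite -U.
rewrite ler_wpDl//.
  apply: Rintegral_ge0 => w /=; rewrite in_itv/= => /andP[hw wxi].
  have wxi' : w <= xi by rewrite (le_trans (ltW wxi)).
  by have [] := derive_inv_spec b0 hw (le_trans wxi' (ltW hb)).
have mu_xi : fine (lebesgue_measure (`[xi / 2, xi]%classic : set R)) = xi / 2.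
  rewrite lebesgue_measure_itv/= lte_fin ltr_pdivrMr// ltr_pMr// ltr1n -EFinB /=.
  by field.
rewrite -[X in X * (z / 2) <= _]mu_xi mulrC -Rintegral_cst//.
apply: le_Rintegral => //.
  apply: measurable_bounded_integrable => //.
    by rewrite /= lebesgue_measure_itv /=; case: ifP => _; rewrite ?ltry// -EFinB ltry.
  by exists `|z / 2|; split; [exact: num_real|move=> x cx w _; exact: ltW].
move=> w /=; rewrite in_itv/= => /andP[hw wxi].
have [w0 _ hE] := derive_inv_spec b0 (le_trans h0xi hw) (le_trans wxi (ltW hb)).
rewrite leNgt; apply/negP => wz.
have : h (derive_inv g w) <= h (z / 2) by apply: derive_mono => //; exact: ltW.
by rewrite hE leNgt (lt_le_trans hz2).
Qed.

End tail_integral.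

End admissible.

(** * Iteration over shrinking layers *)

Section iteration.
Variables (R : realType) (g : R -> R) (m : nat).
Hypotheses (ag : admissible_g g) (m_ge1 : (1 <= m)%N).
Hypothesis gint :
  (\int[lebesgue_measure]_(z in `[1%R, +oo[) (G_integrand m g z)%:E < +oo)%E.

(* With [step_ratio ^ m = 3/4], doubling [J] while shrinking the geometric part of
   the step multiplies the argument of [g] by 3/2. *)
Definition step_ratio : R := (3 / 4) `^ m%:R^-1.

Let b0 : 0 < step_ratio. Proof. by rewrite powR_gt0 ?divr_gt0. Qed.

Let bm : step_ratio ^+ m = 3 / 4.
Proof.
rewrite /step_ratio -powR_mulrn ?powR_ge0// -powRrM mulVf ?pnatr_eq0 -?lt0n//.
by rewrite powRr1// divr_ge0.
Qed.

Let b1 : step_ratio < 1.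
Proof.
rewrite ltNge; apply/negP => b1.
have : 1 <= step_ratio ^+ m by rewrite exprn_ege1.
rewrite bm; lra.
Qed.

Definition step_size : R := (1 - step_ratio) / 4.

Lemma step_size_gt0 : 0 < step_size.
Proof. by rewrite divr_gt0// subr_gt0. Qed.

(* If the conclusion failed, radii [s_0 = rho > s_1 > s_2 > ...] along which [J]
   doubles could be chosen with total decrease at most [rho / 2]. *)
Lemma blow_up (J : R -> R) (V q c rho J0 : R) :
  0 < V -> 0 < q -> 0 < c -> 0 < rho -> 0 < J0 -> J0 <= J rho ->
  (forall r s, rho / 2 <= r -> r <= s -> s <= rho -> J s <= J r) ->
  (forall r s, rho / 2 <= r -> r < s -> s <= rho ->
    V * q ^+ m * g ((c * (s - r)) ^+ m * J s / V) <= J r - J s) ->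
  rho * (c * q) / 12 < G_fun m g (2 / 3 * ((c * (step_size * rho)) ^+ m * J0 / V)).
Proof.
move=> V0 q0 c0 rho0 J00 J0rho Jmono Jdiff.
have k0 := step_size_gt0.
have expr_le (a b : R) : 0 <= a -> a <= b -> a ^+ m <= b ^+ m.
  by move=> a0 ab; rewrite lerXn2r ?nnegrE// (le_trans a0).
rewrite ltNge; apply/negP => Gle.
pose y0 := (c * (step_size * rho)) ^+ m * J0 / V.
have y00 : 0 < y0 by rewrite divr_gt0// mulr_gt0// exprn_gt0// mulr_gt0// mulr_gt0.
pose y i := (3 / 2) ^+ i * y0.
have yi0 i : 0 < y i by rewrite mulr_gt0// exprn_gt0.
have rr0 i := root_ratio_gt0 ag m (yi0 i).
(* The first term keeps the argument of [g] in [Jdiff] above [y i]; the second makes [V q^m g] of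
   that argument at least [2 ^ i * J0], the amount to be gained. *)
pose d i := step_size * rho * step_ratio ^+ i + root_ratio g m (y i) / (c * q).
have d1 i : 0 < step_size * rho * step_ratio ^+ i by rewrite mulr_gt0 ?exprn_gt0// mulr_gt0.
have d2 i : 0 < root_ratio g m (y i) / (c * q) by rewrite divr_gt0// mulr_gt0.
have d0 i : 0 < d i by rewrite addr_gt0.
(* Each of the two parts sums to at most [rho / 4]: hence the 4 in [step_size] and the 12, which is
   3 times 4, in the bound on [G]. *)
have sum_d N : \sum_(i < N) d i <= rho / 2.
  have geo : \sum_(i < N) step_ratio ^+ i <= (1 - step_ratio)^-1.
    rewrite -[leRHS]div1r ler_pdivlMr ?subr_gt0//.
    rewrite -opprB mulrN mulrC -subrX1 opprB gerBl exprn_ge0//.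
    exact: ltW.
  have := sum_root_ratio_le ag gint N y00; rewrite -/y0 in Gle *.
  rewrite big_split/= -mulr_sumr -mulr_suml.
  move: (G_fun m g _) Gle => G Gle; move: (\sum_(i < N) step_ratio ^+ i) geo => S1 geo.
  move: (\sum_(i < N) root_ratio g m _) => S2 HS2.
  have H1 : step_size * rho * S1 <= rho / 4.
    have -> : rho / 4 = step_size * rho * (1 - step_ratio)^-1.
      by rewrite /step_size; field; rewrite subr_eq0 gt_eqF.
    by rewrite ler_wpM2l// mulr_ge0 ?ltW.
  have H2 : S2 / (c * q) <= rho / 4.
    rewrite ler_pdivrMr ?mulr_gt0//; apply: le_trans HS2 _.
    move: Gle; rewrite !mulrA; lra.
  lra.
pose s N := rho - \sum_(i < N) d i.
have sE N : s N.+1 = s N - d N by rewrite /s big_ord_recr/= opprD addrA.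
have s_ge N : rho / 2 <= s N by have := sum_d N; rewrite /s; lra.
have s_le N : s N <= rho.
  by rewrite /s gerBl sumr_ge0// => i _; exact: ltW.
have grow N : 2 ^+ N * J0 <= J (s N).
  elim: N => [|N IH]; first by rewrite expr0 mul1r /s big_ord0 subr0.
  have sN : s N.+1 < s N by rewrite sE gtrBl.
  have := Jdiff _ _ (s_ge N.+1) sN (s_le N).
  have -> : s N - s N.+1 = d N by rewrite sE; ring.
  set x := (c * d N) ^+ m * J (s N) / V.
  pose w := 2 ^+ N * J0 / V.
  have w0 : 0 < w by rewrite divr_gt0// mulr_gt0// exprn_gt0.
  have xw : (c * d N) ^+ m * w <= x.
    rewrite /x /w mulrA ler_wpM2r ?invr_ge0 ?(ltW V0)// ler_wpM2l//.
    by rewrite exprn_ge0// mulr_ge0 ?ltW.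
  have xy : y N <= (c * d N) ^+ m * w.
    apply: (@le_trans _ _ ((c * (step_size * rho * step_ratio ^+ N)) ^+ m * w)).
      rewrite /y /y0 /w le_eqVlt; apply/predU1P; left.
      rewrite [c * (_ * _ ^+ N)]mulrA [(_ * _ ^+ N) ^+ m]exprMn.
      rewrite -[(step_ratio ^+ N) ^+ m]exprM mulnC exprM bm.
      have -> : (3 / 2) ^+ N = (3 / 4) ^+ N * 2 ^+ N :> R.
        by rewrite -exprMn; congr (_ ^+ _); field.
      by ring.
    rewrite ler_wpM2r ?(ltW w0)//; apply: expr_le.
      exact: mulr_ge0 (ltW c0) (ltW (d1 N)).
    by rewrite ler_wpM2l ?(ltW c0)// lerDl ltW.
  have xr : y N / g (y N) / q ^+ m * w <= (c * d N) ^+ m * w.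
    rewrite ler_wpM2r ?(ltW w0)// -(root_ratio_pow ag m_ge1 (yi0 N)) -expr_div_n.
    apply: expr_le; first exact: divr_ge0 (ltW (rr0 N)) (ltW q0).
    have -> : root_ratio g m (y N) / q = c * (root_ratio g m (y N) / (c * q)).
      by field; rewrite !gt_eqF.
    by rewrite ler_wpM2l ?(ltW c0)// lerDr ltW.
  (* The slope inequality from [y N] to [x] gives [g x >= x g(y N) / y N]; the factor
     [y N / g (y N)] that [xr] puts into [x] cancels. *)
  have gx : w / q ^+ m <= g x.
    have gy0 := admissible_gt0 ag (yi0 N).
    have -> : w / q ^+ m = (y N / g (y N) / q ^+ m * w) * g (y N) / y N.
      by field; rewrite !gt_eqF ?exprn_gt0.
    rewrite ler_pdivrMr// [leRHS]mulrC.
    apply: le_trans (admissible_slope ag (yi0 N) (le_trans xy xw)).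
    by rewrite ler_wpM2r ?(ltW gy0)// (le_trans xr xw).
  have : 2 ^+ N * J0 <= V * q ^+ m * g x.
    have -> : 2 ^+ N * J0 = V * q ^+ m * (w / q ^+ m).
      by rewrite /w; field; rewrite !gt_eqF ?exprn_gt0.
    by rewrite ler_wpM2l// mulr_ge0 ?exprn_ge0 ?ltW.
  rewrite exprS -mulrA; lra.
have Jhalf N : 2 ^+ N * J0 <= J (rho / 2).
  by apply: le_trans (grow N) _; apply: Jmono.
pose N := (Num.truncn (J (rho / 2) / J0)).+1.
have : J (rho / 2) < 2 ^+ N * J0.
  rewrite -ltr_pdivrMr//; apply: lt_trans (truncnS_gt _) _.
  by rewrite -natrX ltr_nat ltn_expl.
by rewrite ltNge Jhalf.
Qed.

Lemma powR_near0_le (K d : R) : 0 < K -> 0 < d -> \forall r \near 0^'+, r `^ d <= K.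
Proof.
move=> K0 d0; near=> r.
have r0 : 0 < r by [].
have -> : K = (K `^ d^-1) `^ d.
  by rewrite -powRrM mulVf ?gt_eqF// powRr1// ltW.
apply: ge0_ler_powR; rewrite ?nnegrE ?powR_ge0 ?(ltW d0) ?(ltW r0)//.
by near: r; apply: nbhs_right_le; rewrite powR_gt0.
Unshelve. all: by end_near. Qed.

(** The two halves of the exponent [d]: one is lost in the bound on the volume, the other makes room
    for the constant [K] once [rho] is small. *)
Let powR_le_ratio (rho V K p d : R) : 0 < rho -> 0 < V -> 0 < K ->
  V <= rho `^ (p - d / 2) -> rho `^ (d / 2) <= K ->
  rho `^ (m%:R - p + d) <= K * rho ^+ m / V.
Proof.
move=> rho0 V0 K0 Vle Kge; have rhoN0 : rho != 0 by rewrite gt_eqF.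
have -> : m%:R - p + d = m%:R + (d / 2 - (p - d / 2)) by field.
rewrite powRD ?rhoN0 ?implybT// powRB ?rhoN0 ?implybT// powR_mulrn ?(ltW rho0)//.
rewrite [K * _]mulrC -mulrA ler_wpM2l ?exprn_ge0 ?(ltW rho0)//.
rewrite ler_pM ?powR_ge0 ?invr_ge0 ?powR_ge0//.
by rewrite lef_pV2 ?posrE ?powR_gt0.
Qed.

(* [J r] is the integral of [f g(|u|)] outside [S_r], [A r s] that of [|u|] over
   [S_s \ S_r], [V r] the volume of [S_r \ S], [e r] the essential infimum of
   [f^(1/m)] there, and [p = n - k]. *)
Section core.
Variables (J V e : R -> R) (A : R -> R -> R) (C0 C1 p delta rho0 : R).
Hypotheses (C0_ge0 : 0 <= C0) (C1_gt0 : 0 < C1) (delta_gt0 : 0 < delta).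
Hypothesis rho0_gt0 : 0 < rho0.
Hypothesis J_mono : forall r s, 0 < r -> r <= s -> s <= rho0 -> J s <= J r.
Hypothesis J_le : forall r s, 0 < r -> r < s -> s <= rho0 ->
  J s <= C1 * A r s / (s - r) ^+ m + C0.
Hypothesis J_diff : \forall rho \near 0^'+, [/\ 0 < V rho, 0 < e rho,
  V rho <= rho `^ (p - delta / 2) &
  forall r s y, 0 < r -> r < s -> s <= rho -> 0 < y -> y <= A r s / (2 * V rho) ->
    V rho * e rho ^+ m * g y <= J r - J s].
Hypothesis G_le : forall C, 0 < C -> \forall rho \near 0^'+,
  forall y, rho `^ (m%:R - p + delta) <= y -> G_fun m g y <= C * (rho * e rho).

Let delta2 : 0 < delta / 2. Proof. by rewrite divr_gt0. Qed.

(** For unbounded [J] and small [rho], [blow_up] with [J0 = 1] bounds [G] from below at a point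
    where [G_le] bounds it from above by the same quantity. *)
Lemma core_bounded : exists M, forall r, 0 < r -> r <= rho0 -> J r <= M.
Proof.
have st1 (a x : R) : 0 <= a -> 2 * a + 1 < x -> 1 < x /\ 2 * a <= x by lra.
have st2 (a x : R) : 2 * a <= x -> x / 2 <= x - a by lra.
apply: contrapT => /forallNP H.
(* Below such an [r1] the additive constant [C0] is at most half of [J], and [J] exceeds 1. *)
have /existsNP[r1 /not_implyP[r10 /not_implyP[r1rho0 /negP]]] := H (2 * C0 + 1).
rewrite -ltNge => Jr1.
(* In [4 * C1], one factor 2 pays for absorbing [C0] into [J] and the other for the 2 in
   [2 * V rho]. *)
pose c := (4 * C1)^-1 `^ m%:R^-1.
have c0 : 0 < c by rewrite powR_gt0// invr_gt0 mulr_gt0.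
have cm : c ^+ m = (4 * C1)^-1.
  rewrite /c -powR_mulrn ?powR_ge0// -powRrM mulVf ?pnatr_eq0 -?lt0n//.
  by rewrite powRr1// invr_ge0 mulr_ge0// ltW.
pose K := 2 / 3 * (c * step_size) ^+ m.
have K0 : 0 < K by rewrite mulr_gt0 ?divr_gt0// exprn_gt0// mulr_gt0// step_size_gt0.
have c12 : 0 < c / 12 by rewrite divr_gt0.
have HG := G_le c12.
near (0 : R)^'+ => rho.
have rho_gt0 : 0 < rho by [].
have rhor1 : rho <= r1 by near: rho; exact: nbhs_right_le.
have rholt : rho <= rho0 by exact: le_trans r1rho0.
have [V0 e0 Vle diff] : [/\ 0 < V rho, 0 < e rho,
  V rho <= rho `^ (p - delta / 2) &
  forall r s y, 0 < r -> r < s -> s <= rho -> 0 < y -> y <= A r s / (2 * V rho) ->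
    V rho * e rho ^+ m * g y <= J r - J s] by near: rho.
have Kle : rho `^ (delta / 2) <= K by near: rho; exact: powR_near0_le.
have GC : forall y, rho `^ (m%:R - p + delta) <= y ->
  G_fun m g y <= c / 12 * (rho * e rho) by near: rho.
have Jbig s : 0 < s -> s <= rho -> 1 < J s /\ 2 * C0 <= J s.
  move=> s0 srho; apply: (st1 _ _ C0_ge0); apply: lt_le_trans Jr1 _.
  by apply: J_mono => //; exact: le_trans rhor1.
have : rho * (c * e rho) / 12 <
    G_fun m g (2 / 3 * ((c * (step_size * rho)) ^+ m * 1 / V rho)).
  apply: (@blow_up J) => //.
  - by have [/ltW] := Jbig rho rho_gt0 (lexx _).
  - move=> r s rr rs srho; apply: J_mono => //; last exact: le_trans rholt.
    by apply: lt_le_trans rr; rewrite divr_gt0.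
  move=> r s rr rs srho; have r0 : 0 < r by apply: lt_le_trans rr; rewrite divr_gt0.
  have s0 : 0 < s by exact: lt_trans rs.
  have sr0 : 0 < (s - r) ^+ m by rewrite exprn_gt0// subr_gt0.
  have [Js1 JsC] := Jbig s s0 srho.
  have Js0 : 0 < J s by exact: lt_trans Js1.
  rewrite exprMn cm; apply: diff => //.
    by rewrite divr_gt0// mulr_gt0// mulr_gt0// invr_gt0 mulr_gt0.
  have := J_le r0 rs (le_trans srho rholt).
  have JC : J s / 2 <= J s - C0 by exact: st2.
  move: (A r s) ((s - r) ^+ m) sr0 => a D D0.
  rewrite -lerBlDr ler_pdivlMr// => JD.
  have -> : (4 * C1)^-1 * D * J s / V rho = (J s * D / 2) / C1 / (2 * V rho).
    by field; rewrite !gt_eqF.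
  rewrite ler_wpM2r ?invr_ge0 ?mulr_ge0 ?(ltW V0)// ler_pdivrMr// mulrC.
  rewrite [a * _]mulrC; apply: le_trans JD; rewrite mulrA [2^-1 * _]mulrC.
  by rewrite ler_wpM2r ?(ltW D0).
rewrite ltNge => /negP; apply.
have -> : rho * (c * e rho) / 12 = c / 12 * (rho * e rho) by ring.
apply: GC; apply: le_trans (powR_le_ratio rho_gt0 V0 K0 Vle Kle) _.
rewrite mulr1 [c * _]mulrA [(c * _ * _) ^+ m]exprMn /K.
by rewrite -!mulrA.
Unshelve. all: by end_near. Qed.

(* [J] is bounded and monotone, so its increments tend to 0 near 0, whereas a large
   [A] on a layer would force a large increment. *)
Lemma core_layer (eta : R) : 0 < eta ->
  \forall rho \near 0^'+, A (rho / 2) rho <= eta * rho ^+ m.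
Proof.
have st (x v b c d : R) : x - v < b -> c <= x -> b <= d -> c - d <= v by lra.
move=> eta0.
(* Chosen so that [y] below equals [3^m rho^m / V] times [2 nu], while the estimates bound it by the
   same factor times [nu]. *)
pose nu := eta / (4 * 3 ^+ m).
have nu0 : 0 < nu by rewrite divr_gt0// mulr_gt0// exprn_gt0.
have [M JM] := core_bounded.
have Jsub : exists2 r1, 0 < r1 <= rho0 &
    forall r s, 0 < r -> r <= s -> s <= r1 -> J r - J s <= nu.
  pose I := [set J r | r in [set r | 0 < r <= rho0]].
  have supI : has_sup I.
    split; first by exists (J rho0); exists rho0 => //=; rewrite rho0_gt0 lexx.
    by exists M => _ [r /= /andP[r0 rr0] <-]; exact: JM.
  have [_ [r1 /= /andP[r10 r1rho0] <-] H] := sup_adherent nu0 supI.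
  exists r1; first by rewrite r10.
  move=> r s r0 rs sr1.
  apply: (st _ _ _ _ _ H).
    apply: ub_le_sup; first exact: supI.2.
    by exists r => //=; rewrite r0 (le_trans rs)// (le_trans sr1).
  by apply: J_mono => //; exact: lt_le_trans rs.
have [r1 /andP[r10 r1rho0] Jnu] := Jsub.
have HG := G_le ltr01.
(* [eta / 3] is the coefficient of [rho^m / V rho] in [2/3 * y], the point at which [G] is
   evaluated. *)
have K0 : 0 < eta / 3 by rewrite divr_gt0.
near=> rho.
have rho_gt0 : 0 < rho by [].
have rhor1 : rho <= r1 by near: rho; exact: nbhs_right_le.
have [V0 e0 Vle diff] : [/\ 0 < V rho, 0 < e rho,
  V rho <= rho `^ (p - delta / 2) &
  forall r s y, 0 < r -> r < s -> s <= rho -> 0 < y -> y <= A r s / (2 * V rho) ->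
    V rho * e rho ^+ m * g y <= J r - J s] by near: rho.
have Kle : rho `^ (delta / 2) <= eta / 3 by near: rho; exact: powR_near0_le.
have GC : forall y, rho `^ (m%:R - p + delta) <= y ->
  G_fun m g y <= 1 * (rho * e rho) by near: rho.
rewrite leNgt; apply/negP => Abig.
have rm0 : 0 < rho ^+ m by rewrite exprn_gt0.
pose y := eta * rho ^+ m / (2 * V rho).
have y0 : 0 < y by rewrite divr_gt0// mulr_gt0.
have half0 : 0 < rho / 2 by rewrite divr_gt0.
have half1 : rho / 2 < rho by rewrite ltr_pdivrMr// ltr_pMr// ltr1n.
have yA : y <= A (rho / 2) rho / (2 * V rho).
  by rewrite ler_wpM2r ?invr_ge0 ?mulr_ge0 ?(ltW V0)// ltW.
have gy : V rho * e rho ^+ m * g y <= nu.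
  apply: le_trans (diff _ _ _ half0 half1 (lexx _) y0 yA) _.
  by apply: Jnu => //; exact: ltW.
have gy0 := admissible_gt0 ag y0.
have rr : root_ratio g m y <= 3 * (rho * e rho).
  apply: le_trans (root_ratio_le_G ag gint y0) _; rewrite ler_wpM2l//.
  rewrite -[leRHS]mul1r; apply: GC.
  apply: le_trans (powR_le_ratio rho_gt0 V0 K0 Vle Kle) _.
  rewrite le_eqVlt; apply/predU1P; left.
  by rewrite /y; field; rewrite gt_eqF.
have : root_ratio g m y ^+ m <= (3 * (rho * e rho)) ^+ m.
  by rewrite lerXn2r ?nnegrE ?mulr_ge0 ?(ltW rho_gt0) ?(ltW e0) ?(ltW (root_ratio_gt0 ag m y0)).
rewrite (root_ratio_pow ag m_ge1 y0) ler_pdivrMr//.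
have -> : (3 * (rho * e rho)) ^+ m * g y =
  (3 ^+ m * rho ^+ m / V rho) * (V rho * e rho ^+ m * g y).
  by rewrite !exprMn; field; rewrite gt_eqF.
move=> H; have := le_trans H (ler_wpM2l _ gy).
have -> : y = (3 ^+ m * rho ^+ m / V rho) * (2 * nu).
  by rewrite /y /nu; field; rewrite !gt_eqF ?exprn_gt0.
have c0 : 0 < 3 ^+ m * rho ^+ m / V rho by rewrite divr_gt0// mulr_gt0// exprn_gt0.
rewrite (ler_pM2l c0) => /(_ (ltW c0)); lra.
Unshelve. all: by end_near. Qed.

End core.

End iteration.

(** * Testing the inequality near the singular set *)

(* [u] is the limit of functions with values in [Z / (k + 1)], for which the
   composition is measurable by the first Caratheodory condition. *)
Lemma caratheodory_comp (R : realType) (n : nat) (Omega D : set 'rV[R]_n)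
    (a : 'rV[R]_n -> R -> R) (u : 'rV[R]_n -> R) :
  measurable Omega -> measurable D -> D `<=` Omega ->
  caratheodory_function Omega a -> measurable_fun D u ->
  measurable_fun D (fun x => a x (u x)).
Proof.
move=> mO mD DO [ma [N [mN N0 aN]]] mu.
pose uk (k : nat) x : R := (Num.floor (u x * k.+1%:R))%:~R / k.+1%:R.
have muk k : measurable_fun D (fun x => a x (uk k x)).
  move=> _ Y mY.
  (* The union runs over the values [j] of the floor, on each level set of which [uk k] is
     constant. *)
  rewrite (_ : D `&` _ = \bigcup_(j : int)
    ((D `&` (fun x => u x * k.+1%:R) @^-1` `[j%:~R, (j + 1)%:~R[) `&`
     (D `&` (a ^~ (j%:~R / k.+1%:R)) @^-1` Y))).
    apply: countable_bigcupT_measurable; first exact: countableP.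
    move=> j; apply: measurableI.
      have mk : measurable_fun D (fun x => u x * k.+1%:R).
        by apply: measurable_funM => //.
      by apply: mk => //; exact: measurable_itv.
    have maD : measurable_fun D (a ^~ (j%:~R / k.+1%:R)).
      by apply: measurable_funS (ma _).
    exact: maD.
  apply/seteqP; split=> [x [Dx Yx]|x [j _ [[Dx /=]]]].
    exists (Num.floor (u x * k.+1%:R)) => //; split; split => //=.
    by rewrite in_itv/= floor_le floorD1_gt.
  rewrite in_itv/= => /andP[jx xj] [_ Yx]; split => //.
  rewrite /= /uk; suff -> : Num.floor (u x * k.+1%:R) = j by [].
  by apply/eqP; rewrite floor_eq jx.
have cuk x : uk k x @[k --> \oo] --> u x.
  apply/cvgrPdist_le => e e0; near=> k.
  have k0 : 0 < k.+1%:R :> R by [].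
  have -> : u x - uk k x = (u x * k.+1%:R - (Num.floor (u x * k.+1%:R))%:~R) / k.+1%:R.
    by rewrite /uk mulrBl mulfK// gt_eqF.
  have := floor_le (u x * k.+1%:R); have := floorD1_gt (u x * k.+1%:R).
  rewrite intrD => H1 H2.
  rewrite ger0_norm; last by rewrite divr_ge0// subr_ge0.
  apply: (@le_trans _ _ (1 / k.+1%:R)).
    by rewrite ler_wpM2r// ltW// ltrBlDl.
  rewrite div1r ltW//; near: k; exact: (near_infty_natSinv_lt (PosNum e0)).
have mDN : measurable_fun (D `\` N) (fun x => a x (u x)).
  apply: (@measurable_fun_cvg _ _ _ _ (fun k x => a x (uk k x))).
    by move=> k; apply: measurable_funS (muk k) => //; exact: subDsetl.
  move=> x [Dx Nx]; have cax : continuous (a x).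
    by apply: contrapT => nc; apply: Nx; apply: aN => /= H; apply: nc; exact/H/DO.
  exact: continuous_cvg (cax _) (cuk x).
move=> _ Y mY.
(* On the null set where [a x] may fail to be continuous, measurability comes from completeness of
   the measure. *)
rewrite (_ : D `&` _ = ((D `\` N) `&` (fun x => a x (u x)) @^-1` Y) `|`
  ((D `&` N) `&` (fun x => a x (u x)) @^-1` Y)).
  apply: measurableU; first by apply: mDN => //; exact: measurableD.
  apply: mes_complete; exists N; split => //.
  by move=> x [[]].
apply/seteqP; split=> [x [Dx Yx]|x []].
  by have [Nx|Nx] := pselect (N x); [right|left].
- by move=> [[]].
- by move=> [[]].
Unshelve. all: by end_near. Qed.

(** * The Euclidean norm and the neighbourhoods [S_r] *)

Section nbhd.
Variables (R : realType) (n : nat).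
Implicit Types (x y : 'rV[R]_n) (S : set 'rV[R]_n).

Lemma enorm_ge0 x : 0 <= enorm x. Proof. exact: sqrtr_ge0. Qed.

Lemma coord_le_enorm x i : `|x 0 i| <= enorm x.
Proof.
rewrite /enorm -sqrtr_sqr ler_wsqrtr// (bigD1 i)//= lerDl.
by apply: sumr_ge0 => j _; exact: sqr_ge0.
Qed.

Lemma norm_le_enorm x : `|x| <= enorm x.
Proof.
rewrite /Num.norm/= mx_normrE; apply/bigmax_leP; split; first exact: enorm_ge0.
by move=> [i j] _ /=; rewrite (ord1 i) coord_le_enorm.
Qed.

Lemma enorm_le_norm x : enorm x <= n%:R * `|x|.
Proof.
have nx0 : 0 <= n%:R * `|x| by rewrite mulr_ge0.
rewrite /enorm -[leRHS]ger0_norm// -sqrtr_sqr ler_wsqrtr//.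
apply: (@le_trans _ _ (\sum_(i < n) `|x| ^+ 2)).
  apply: ler_sum => i _; rewrite -real_normK ?num_real// lerXn2r ?nnegrE//.
  rewrite [leRHS]/Num.norm/= mx_normrE.
  exact: (le_bigmax _ (fun ij => `|x ij.1 ij.2|) (0, i)).
rewrite sumr_const card_ord exprMn -[leLHS]mulr_natl ler_wpM2r ?sqr_ge0//.
by case: (n) => [|k]; rewrite ?expr0n// expr2 ler_peMr// ler1n.
Qed.

Lemma ler_enormD x y : enorm (x + y) <= enorm x + enorm y.
Proof.
have xy0 : 0 <= enorm x + enorm y by rewrite addr_ge0 ?enorm_ge0.
rewrite {1}/enorm -[leRHS]ger0_norm// -sqrtr_sqr ler_wsqrtr//.
have sq z : enorm z ^+ 2 = \sum_(i < n) z 0 i ^+ 2.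
  by rewrite sqr_sqrtr// sumr_ge0// => i _; exact: sqr_ge0.
have CS : \sum_(i < n) x 0 i * y 0 i <= enorm x * enorm y.
  have [x0|x0] := eqVneq (enorm x) 0.
    rewrite x0 mul0r big1// => i _.
    have := coord_le_enorm x i; rewrite x0 normr_le0 => /eqP ->.
    by rewrite mul0r.
  have [y0|y0] := eqVneq (enorm y) 0.
    rewrite y0 mulr0 big1// => i _.
    have := coord_le_enorm y i; rewrite y0 normr_le0 => /eqP ->.
    by rewrite mulr0.
  have ex : 0 < enorm x by rewrite lt_neqAle eq_sym x0 enorm_ge0.
  have ey : 0 < enorm y by rewrite lt_neqAle eq_sym y0 enorm_ge0.
  (* Termwise Young inequality, with weights that make each of the two sums equal to
     [enorm x * enorm y / 2]. *)
  have H : \sum_(i < n) (x 0 i * y 0 i) <=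
      \sum_(i < n) ((enorm y / (2 * enorm x)) * x 0 i ^+ 2 +
                    (enorm x / (2 * enorm y)) * y 0 i ^+ 2).
    apply: ler_sum => i _; rewrite -subr_ge0.
    have -> : (enorm y / (2 * enorm x)) * x 0 i ^+ 2 +
      (enorm x / (2 * enorm y)) * y 0 i ^+ 2 - x 0 i * y 0 i =
      (enorm y * x 0 i - enorm x * y 0 i) ^+ 2 / (2 * enorm x * enorm y).
      by field; rewrite x0 y0.
    by rewrite divr_ge0 ?sqr_ge0// !mulr_ge0// ltW.
  apply: le_trans H _; rewrite big_split/= -!mulr_sumr -!sq le_eqVlt.
  by apply/predU1P; left; field; rewrite x0 y0.
rewrite sqrrD !sq.
rewrite (eq_bigr (fun i => x 0 i ^+ 2 + (x 0 i * y 0 i) *+ 2 + y 0 i ^+ 2)); last first.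
  by move=> i _; rewrite mxE sqrrD.
by rewrite !big_split/= lerD2r lerD2l; apply: lerD.
Qed.

Lemma enormN x : enorm (- x) = enorm x.
Proof. by congr Num.sqrt; apply: eq_bigr => i _; rewrite mxE sqrrN. Qed.

Lemma nbhd_of_open S r : open (nbhd_of S r).
Proof.
rewrite openE => x [y Sy xy]; have e0 : 0 < r - enorm (x - y) by rewrite subr_gt0.
pose d := (r - enorm (x - y)) / n.+1%:R.
have d0 : 0 < d by rewrite divr_gt0.
apply/nbhs_ballP; exists d => //= z; rewrite -ball_normE /= => xz.
exists y => //; have -> : z - y = (x - y) - (x - z) by rewrite opprB [RHS]addrC addrA subrK.
apply: le_lt_trans (ler_enormD _ _) _; rewrite enormN -ltrBrDl.
apply: le_lt_trans (enorm_le_norm _) _.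
apply: (@le_lt_trans _ _ (n%:R * d)); first by rewrite ler_wpM2l// ltW.
by rewrite /d mulrA ltr_pdivrMr// mulrC ltr_pM2l// ltr_nat.
Qed.

Lemma nbhd_of_sub S r s : r <= s -> nbhd_of S r `<=` nbhd_of S s.
Proof. by move=> rs x [y Sy xy]; exists y => //; exact: lt_le_trans rs. Qed.

Lemma sub_nbhd_of S r : 0 < r -> S `<=` nbhd_of S r.
Proof.
move=> r0 x Sx; exists x => //; rewrite subrr /enorm big1 ?sqrtr0// => i _.
by rewrite mxE expr0n.
Qed.

Lemma nbhd_of_shift S r d x y : nbhd_of S r x -> enorm (y - x) < d -> nbhd_of S (r + d) y.
Proof.
move=> [z Sz xz] yx; exists z => //.
have -> : y - z = (y - x) + (x - z) by rewrite addrA subrK.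
by apply: le_lt_trans (ler_enormD _ _) _; rewrite addrC ltrD.
Qed.

Lemma nbhd_of_bounded S r : bounded_set S -> bounded_set (nbhd_of S r).
Proof.
move=> [M [Mr MS]]; exists (`|M| + 1 + r); split; first exact: num_real.
move=> B BM x [y Sy xy] /=; apply: le_trans (ltW BM).
rewrite -(subrK y x) addrC.
apply: le_trans (ler_normD _ _) _; apply: lerD.
  by apply: MS => //; rewrite (le_lt_trans (ler_norm _))// ltrDl.
by rewrite (le_trans (norm_le_enorm _))// ltW.
Qed.

(** Otherwise points of [S] at distance less than [1 / (k + 1)] from the complement of [U] cluster
    at a point of [S], around which [U] contains a ball. *)
Lemma nbhd_of_compact S (U : set 'rV[R]_n) : compact S -> open U -> S `<=` U ->
  exists2 r, 0 < r & nbhd_of S r `<=` U.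
Proof.
move=> kS oU SU; apply: contrapT => H.
have far k : exists x, exists y, [/\ S x, ~ U y & enorm (y - x) < k.+1%:R^-1].
  apply: contrapT => /forallNP nk; apply: H; exists k.+1%:R^-1; first by rewrite invr_gt0.
  move=> y [x Sx yx]; apply: contrapT => nUy; apply: (nk x).
  by exists y.
have /choice[x xP] := far.
have [p [Sp clp]] : S `&` cluster (x k @[k --> \oo]) !=set0.
  apply: kS; exists 0%N => // k _ /=.
  by have [y []] := xP k.
have /nbhs_ballP[e /= e0 pU] : nbhs p U by apply: open_nbhs_nbhs; split => //; exact: SU.
have : (\forall k \near \oo, k.+1%:R^-1 < e / 2).
  have e2 : 0 < e / 2 by rewrite divr_gt0.
  exact: (near_infty_natSinv_lt (PosNum e2)).
move=> [K _ KP].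
have e2 : 0 < e / 2 by rewrite divr_gt0.
have Fx : (x k @[k --> \oo]) [set x k | k in [set k | (K <= k)%N]].
  by exists K => // k Kk; exists k.
have [_ [[k Kk <-] pz]] := clp _ _ Fx (nbhsx_ballx p _ e2).
have [y [_ nUy yx]] := xP k; apply: nUy; apply: pU.
rewrite -ball_normE /= in pz *.
have -> : p - y = (p - x k) - (y - x k) by rewrite opprB addrA subrK.
apply: le_lt_trans (ler_normB _ _) _.
rewrite [e]splitr ltrD//; apply: le_lt_trans (norm_le_enorm _) _.
exact: lt_trans (KP k Kk).
Qed.

End nbhd.

(** * Cutoffs between two neighbourhoods of [S], and test functions *)

Section nbhd_cutoff.
Variables (R : realType) (n : nat).
Implicit Types (phi psi : 'rV[R]_n -> R) (x y : 'rV[R]_n) (S U : set 'rV[R]_n).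

Lemma enorm_ball x (d : R) : 0 < d -> nbhs x [set y | enorm (y - x) < d].
Proof.
move=> d0; have dn : 0 < d / n.+1%:R by rewrite divr_gt0.
apply/nbhs_ballP; exists (d / n.+1%:R) => //= y; rewrite -ball_normE /= => xy.
apply: le_lt_trans (enorm_le_norm _) _; rewrite distrC.
apply: (@le_lt_trans _ _ (n%:R * (d / n.+1%:R))); first by rewrite ler_wpM2l// ltW.
by rewrite mulrA ltr_pdivrMr// mulrC ltr_pM2l// ltr_nat.
Qed.

(** The transition ends halfway, at [(r + s) / 2], so that [psi] is 1 on a whole neighbourhood of
    each point outside [S_s]; derivatives of the product then agree with those of [phi] there. *)
Lemma nbhd_cutoff S phi m : bounded_set S -> smooth phi ->
  (forall s, exists C : R, forall x, `|partials s phi x| <= C) ->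
  exists2 C : R, 0 <= C & forall r s, 0 < r -> r < s -> s - r <= 1 ->
  exists psi : 'rV[R]_n -> R,
    [/\ smooth psi, forall x, 0 <= psi x <= 1,
      (forall x, nbhd_of S r x -> psi x = 0),
      (forall x, ~ nbhd_of S ((r + s) / 2) x -> psi x = 1) &
      [/\ forall t x, nbhd_of S r x -> partials t (fun x => phi x * psi x) x = 0,
        forall t x, ~ nbhd_of S s x ->
          partials t (fun x => phi x * psi x) x = partials t phi x &
        forall t x, size t = m ->
          `|partials t (fun x => phi x * psi x) x| <= C / (s - r) ^+ m]].
Proof.
move=> bS sphi bphi; have [C C0 CP] := cutoff_exists m sphi bphi.
(* [cutoff_exists] needs sup-norm distance [3 eps] to reach the value 1, that is at most [3 n eps]
   in Euclidean distance; with [eps = (s - r) / K] this is less than [(s - r) / 2]. *)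
pose K : R := 6 * n.+1%:R.
have K1 : 1 <= K.
  by rewrite /K -natrM ler1n.
have K0 : 0 < K by exact: lt_le_trans K1.
exists (C * K ^+ m); first by rewrite mulr_ge0// exprn_ge0// ltW.
move=> r s r0 rs sr1.
have sr0 : 0 < s - r by rewrite subr_gt0.
have e01 : 0 < (s - r) / K <= 1.
  by rewrite divr_gt0//= ler_pdivrMr// mul1r (le_trans sr1).
have /andP[e0 _] := e01.
have [psi [spsi psi01 psi0 psi1 dpsi]] := CP _ _ (nbhd_of_bounded r bS) e01.
have Z x : nbhd_of S r x -> psi x = 0.
  move=> Sx; apply: (psi0 x x) => //; rewrite subrr normr0.
  by rewrite divr_ge0// ltW.
have O x : ~ nbhd_of S ((r + s) / 2) x -> psi x = 1.
  move=> Sx; apply: psi1 => e Ee; rewrite leNgt; apply/negP => xe; apply: Sx.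
  have -> : (r + s) / 2 = r + (s - r) / 2 by field.
  apply: (nbhd_of_shift Ee); apply: le_lt_trans (enorm_le_norm _) _.
  apply: (@le_lt_trans _ _ (n%:R * (3 * ((s - r) / K)))).
    by rewrite ler_wpM2l// ltW.
  have -> : n%:R * (3 * ((s - r) / K)) = n%:R / n.+1%:R * ((s - r) / 2).
    by rewrite /K; field; rewrite gt_eqF.
  rewrite gtr_pMl ?divr_gt0// ltr_pdivrMr// mul1r ltr_nat//.
exists psi; split => //; split.
- move=> t x Sx.
  have nr : \near x, phi x * psi x = 0.
    have : nbhs x (nbhd_of S r) by apply: open_nbhs_nbhs; split => //; exact: nbhd_of_open.
    by apply: filterS => y Sy; rewrite Z// mulr0.
  case: t => [|i t]; first exact: (nbhs_singleton nr).
  exact: partials_near_cst nr.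
- move=> t x Sx; have d0 : 0 < (s - r) / 2 by rewrite divr_gt0.
  have ne : \near x, phi x * psi x = phi x.
    have := enorm_ball x d0; apply: filterS => y /= yx.
    rewrite O ?mulr1// => Sy; apply: Sx.
    have -> : s = (r + s) / 2 + (s - r) / 2 by field.
    by apply: nbhd_of_shift Sy _; rewrite -opprB enormN.
  exact: nbhs_singleton (partials_near t ne).
- move=> t x tm; apply: le_trans (dpsi t x tm) _.
  by rewrite expr_div_n invf_div mulrA.
Qed.

Lemma test_function_bounded U phi s : test_function U phi ->
  exists C : R, forall x, `|partials s phi x| <= C.
Proof.
move=> [sphi kphi _]; apply: (partials_compact_bounded s kphi sphi) => x nx.
apply/eqP; apply: contrapT => /negP px; apply: nx; exact: subset_closure.
Qed.

Lemma test_function_cutoff U S phi psi r : 0 < r -> test_function U phi -> smooth psi ->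
  (forall x, nbhd_of S r x -> psi x = 0) ->
  test_function (U `\` S) (fun x => phi x * psi x).
Proof.
move=> r0 [sphi kphi suppU] spsi psi0.
have sub : support_of (fun x => phi x * psi x) `<=` support_of phi.
  by apply: closure_subset => x /=; rewrite mulf_eq0 negb_or => /andP[].
split; first exact: smoothM.
  by apply: subclosed_compact kphi sub; exact: closed_closure.
move=> x xs; split; first by apply: suppU; exact: sub.
move=> Sx; have Ox : nbhs x (nbhd_of S r).
  by apply: open_nbhs_nbhs; split; [exact: nbhd_of_open|exact: sub_nbhd_of].
by have [y [/= + Sy]] := xs _ Ox; rewrite psi0// mulr0 eqxx.
Qed.

(** [eta] is [1 - psi] for a cutoff [psi] between radii [r / 3] and [2r / 3]: it is nonzero only in
    [S_(r/2)], so its closed support stays in [S_r]. *)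
Lemma plateau_function U S : compact S -> open U -> S `<=` U ->
  exists rho eta, [/\ 0 < rho <= 1, nbhd_of S rho `<=` U, test_function U eta,
    forall x, 0 <= eta x <= 1 & forall x, nbhd_of S rho x -> eta x = 1].
Proof.
move=> kS oU SU; have [r0 r00 r0U] := nbhd_of_compact kS oU SU.
pose r := Num.min r0 1; have rr0 : r <= r0 by rewrite /r ge_min lexx.
have r1 : r <= 1 by rewrite /r ge_min lexx orbT.
have rgt0 : 0 < r by rewrite lt_min r00 ltr01.
have bS : bounded_set S by exact: compact_bounded.
have bcst s : exists C : R, forall x, `|partials s (fun _ : 'rV[R]_n => 1) x| <= C.
  case: s => [|i s]; first by exists 1 => x; rewrite /= normr1.
  exists 0 => x; rewrite (@partials_near_cst _ _ _ _ _ 1) ?normr0//.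
  by apply: (@filterE _ (nbhs x)).
have [C _ CP] := nbhd_cutoff 0 bS (@smooth_cst R n 1) bcst.
have [|||psi] := CP (r / 3) (2 * r / 3); [by rewrite divr_gt0|lra|lra|].
move=> [spsi psi01 psi0 psi1 _].
have eta0 x : 1 - psi x != 0 -> nbhd_of S (r / 2) x.
  move=> p1; apply: contrapT => Sx; move: p1; rewrite psi1 ?subrr ?eqxx//.
  by have -> : (r / 3 + 2 * r / 3) / 2 = r / 2 by field.
exists (r / 3), (fun x => 1 - psi x); split.
- by apply/andP; split; [rewrite divr_gt0|lra].
- apply: subset_trans r0U; apply: nbhd_of_sub; lra.
- have supp : support_of (fun x => 1 - psi x) `<=` nbhd_of S r.
    move=> x xs; have d0 : 0 < r / 2 by rewrite divr_gt0.
    have [y [/= /eta0 Sy yx]] := xs _ (enorm_ball x d0).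
    by rewrite [r]splitr; apply: nbhd_of_shift Sy _; rewrite -opprB enormN.
  split.
  + apply/smoothP => N; apply: smooth_uptoD; first exact: smooth_upto_cst.
    under eq_fun do rewrite -mulN1r.
    apply: smooth_uptoM; first exact: smooth_upto_cst.
    exact: (smoothP _).1 spsi N.
  + apply: bounded_closed_compact; last exact: closed_closure.
    have [M [Mr MS]] := nbhd_of_bounded r bS; exists M; split => // B MB x /supp.
    exact: MS.
  + by apply: subset_trans supp _; apply: subset_trans r0U; exact: nbhd_of_sub.
- by move=> x; have := psi01 x; lra.
- by move=> x Sx; rewrite psi0// subr0.
Qed.

End nbhd_cutoff.

(** * Integrability by domination, and comparison of integrals *)

Section integration.
Context d (T : measurableType d) (R : realType).
Variable mu : {measure set T -> \bar R}.
Implicit Types (A B D : set T) (X Y : T -> R).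

Lemma integrable_dominated D X Y (c : R) : measurable D -> measurable_fun D X ->
  mu.-integrable D (EFin \o Y) -> (forall x, D x -> `|X x| <= c * `|Y x|) ->
  mu.-integrable D (EFin \o X).
Proof.
move=> mD mX iY XY.
apply: (@le_integrable _ _ _ _ _ mD _ (fun x => (c%:E * (EFin \o Y) x)%E)).
- exact/measurable_EFinP.
- move=> x Dx; rewrite /= lee_fin normrM; apply: le_trans (XY x Dx) _.
  by rewrite ler_wpM2r// ler_norm.
- exact: integrableZl.
Qed.

Lemma integrable_bounded_mul D X Y (c : R) : measurable D -> measurable_fun D X ->
  mu.-integrable D (EFin \o Y) -> (forall x, D x -> `|X x| <= c) ->
  mu.-integrable D (EFin \o (fun x => Y x * X x)).
Proof.
move=> mD mX iY Xc; have mY : measurable_fun D Y.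
  by apply/measurable_EFinP; exact: measurable_int iY.
apply: (integrable_dominated (c := c) mD _ iY); first exact: measurable_funM.
by move=> x Dx; rewrite normrM mulrC ler_wpM2r// Xc.
Qed.

Lemma integrable_scale D X (c : R) : measurable D -> mu.-integrable D (EFin \o X) ->
  mu.-integrable D (EFin \o (fun x => c * X x)).
Proof.
move=> mD iX; have mX : measurable_fun D X.
  by apply/measurable_EFinP; exact: measurable_int iX.
apply: (integrable_dominated (c := `|c|) mD _ iX); first exact: measurable_funM.
by move=> x _; rewrite normrM.
Qed.

Lemma integrable_add D X Y : measurable D -> mu.-integrable D (EFin \o X) ->
  mu.-integrable D (EFin \o Y) -> mu.-integrable D (EFin \o (fun x => X x + Y x)).
Proof.
move=> mD iX iY; have -> : EFin \o (fun x => X x + Y x) = ((EFin \o X) \+ (EFin \o Y))%E.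
  by apply/funext => x; rewrite /= EFinD.
exact: integrableD.
Qed.

Lemma integrable_sub D X Y : measurable D -> mu.-integrable D (EFin \o X) ->
  mu.-integrable D (EFin \o Y) -> mu.-integrable D (EFin \o (fun x => X x - Y x)).
Proof.
move=> mD iX iY; have -> : EFin \o (fun x => X x - Y x) = ((EFin \o X) \- (EFin \o Y))%E.
  by apply/funext => x; rewrite /= EFinB.
exact: integrableB.
Qed.

Lemma Rintegral_setD_eq0 A B X : (forall x, A x -> B x -> X x = 0) ->
  \int[mu]_(x in A) X x = \int[mu]_(x in A `\` B) X x.
Proof.
move=> X0; rewrite /Rintegral integral_mkcond [in RHS]integral_mkcond.
congr (fine (integral _ _ _)); apply/funext => x; rewrite !patchE.
have [Ax|Ax] := boolP (x \in A); last first.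
  by rewrite ifF//; apply/negbTE; apply: contra Ax; rewrite !inE => -[].
have [Bx|Bx] := boolP (x \in B).
  rewrite ifF; first by rewrite X0//; apply/set_mem.
  by apply/negbTE; rewrite notin_setE => -[_]; apply; apply/set_mem.
by rewrite ifT// inE; split; [exact/set_mem|apply/set_mem; rewrite in_setC].
Qed.

Lemma Rintegral_setD A B X : measurable A -> measurable B -> B `<=` A ->
  mu.-integrable A (EFin \o X) ->
  \int[mu]_(x in A) X x = \int[mu]_(x in A `\` B) X x + \int[mu]_(x in B) X x.
Proof.
move=> mA mB BA iX; rewrite -{1}(setDUK BA) setUC Rintegral_setU//.
- exact: measurableD.
- by rewrite setUC setDUK.
- by apply/disj_setPS => x [[_ nBx]].
Qed.

Lemma ae_ge0_Rintegral D X : measurable D -> mu.-integrable D (EFin \o X) ->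
  {ae mu, forall x, D x -> 0 <= X x} -> 0 <= \int[mu]_(x in D) X x.
Proof.
move=> mD iX X0; have mX : measurable_fun D (EFin \o X) by exact: measurable_int iX.
rewrite /Rintegral (@ae_eq_integral _ _ _ mu D (EFin \o (fun x => Num.max 0 (X x))))//.
- apply: fine_ge0; apply: integral_ge0 => x _.
  by rewrite lee_fin le_max lexx.
- apply/measurable_EFinP; apply: measurable_maxr => //; exact/measurable_EFinP.
- by apply: filterS X0 => x X0 Dx /=; congr EFin; apply/esym/max_r/X0.
Qed.

(** The integral of a nonnegative function is a supremum over the simple functions below it, hence
    monotone even for nonmeasurable functions. It allows comparison with [gamma(1/f)] without
    studying the measurability of the latter. *)
Lemma ge0_le_integral_nonmeasurable D (f1 f2 : T -> \bar R) :
  (forall x, D x -> (0 <= f1 x)%E) -> (forall x, D x -> (f1 x <= f2 x)%E) ->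
  (\int[mu]_(x in D) f1 x <= \int[mu]_(x in D) f2 x)%E.
Proof.
move=> f10 f12; rewrite integral_mkcond [leRHS]integral_mkcond.
have h1 x : (0 <= (f1 \_ D) x)%E by apply: erestrict_ge0.
have h2 x : (0 <= (f2 \_ D) x)%E.
  by apply: erestrict_ge0 => y Dy; exact: le_trans (f10 y Dy) (f12 y Dy).
rewrite !ge0_integralTE//; apply: le_ereal_sup => _ /= [h hf <-].
exists h => // x; apply: le_trans (hf x) _.
by apply: lee_restrict.
Qed.

End integration.

(** * Integral estimates drawn from the inequality outside [S] *)

Section removal.
Variables (R : realType) (n m : nat) (Omega S : set 'rV[R]_n).
Hypotheses (oO : open Omega) (kS : compact S) (SO : S `<=` Omega).
Variables (F u : 'rV[R]_n -> R) (b : multi_index n m -> 'rV[R]_n -> R) (A0 : R).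
Hypothesis F_ge0 : forall x, Omega x -> 0 <= F x.
Hypothesis uL1 : forall r, 0 < r -> in_L1 (Omega `\` nbhd_of S r) u.
Hypothesis FL1 : forall r, 0 < r -> in_L1 (Omega `\` nbhd_of S r) F.
Hypothesis mb : forall al, measurable_fun (Omega `\` S) (b al).
Hypothesis A0_gt0 : 0 < A0.
Hypothesis b_le : forall al x, (Omega `\` S) x -> `|b al x| <= A0 * `|u x|.

(** [b al x] stands for [a al x (u x)] after a change on a null set, so that the growth bound can be
    assumed at every point outside [S]. *)
Definition flux phi x : R :=
  \sum_(al : multi_index n m) (-1) ^+ m * b al x * partial_multi al phi x.

Hypothesis weak : forall phi, test_function (Omega `\` S) phi -> (forall x, 0 <= phi x) ->
  \int[mes]_(x in Omega) (F x * phi x) <= \int[mes]_(x in Omega) flux phi x.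

Let mO : measurable Omega. Proof. exact: open_rV_measurable. Qed.

Let mS : measurable S.
Proof.
by apply: closed_rV_measurable; apply: compact_closed kS; exact: norm_hausdorff.
Qed.

Let mN r : measurable (nbhd_of S r).
Proof. by apply: open_rV_measurable; exact: nbhd_of_open. Qed.

Let mON r : measurable (Omega `\` nbhd_of S r).
Proof. exact: measurableD. Qed.

Let ONS r : 0 < r -> Omega `\` nbhd_of S r `<=` Omega `\` S.
Proof. by move=> r0 x [Ox Nx]; split => // /(sub_nbhd_of r0). Qed.

Lemma size_multi_index (al : multi_index n m) :
  size (flatten [seq nseq (val al i) i | i <- enum 'I_n]) = m.
Proof.
rewrite -[RHS](eqP (valP al)) size_flatten /shape -map_comp sumnE big_map big_enum.
by apply: eq_bigr => i _; rewrite /= size_nseq.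
Qed.

Lemma partial_multi_measurable phi (al : multi_index n m) (D : set 'rV[R]_n) :
  smooth phi -> measurable D -> measurable_fun D (partial_multi al phi).
Proof. by move=> sphi mD; apply: continuous_rV_measurable => //; exact: (sphi _).1. Qed.

Lemma flux_bound phi x (c : R) : (Omega `\` S) x ->
  (forall al : multi_index n m, `|partial_multi al phi x| <= c) ->
  `|flux phi x| <= #|{: multi_index n m}|%:R * A0 * c * `|u x|.
Proof.
move=> Ox pc; rewrite /flux; apply: le_trans (ler_norm_sum _ _ _) _.
apply: (@le_trans _ _ (\sum_(al : multi_index n m) A0 * c * `|u x|)).
  apply: ler_sum => al _; rewrite !normrM normrX normrN1 expr1n mul1r.
  by rewrite mulrAC ler_pM// b_le.
by rewrite sumr_const -[leLHS]mulr_natl !mulrA.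
Qed.

Lemma flux_measurable phi (D : set 'rV[R]_n) : measurable D -> D `<=` Omega `\` S ->
  smooth phi -> measurable_fun D (flux phi).
Proof.
move=> mD DO sphi; apply: measurable_sum => al; apply: measurable_funM.
  by apply: measurable_funM => //; apply: measurable_funS (mb al) => //; exact: measurableD.
exact: partial_multi_measurable.
Qed.

Lemma flux_integrable phi (D : set 'rV[R]_n) (c : R) :
  measurable D -> D `<=` Omega `\` S -> smooth phi -> in_L1 D u ->
  (forall (al : multi_index n m) x, `|partial_multi al phi x| <= c) ->
  mes.-integrable D (EFin \o flux phi).
Proof.
move=> mD DO sphi iu pc.
apply: (integrable_dominated (c := #|{: multi_index n m}|%:R * A0 * c) _ _ iu) => //.
  exact: flux_measurable.
by move=> x Dx; apply: flux_bound => //; exact: DO.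
Qed.

Lemma test_partial_multi_bounded U phi : test_function U phi ->
  exists c : R, forall (al : multi_index n m) x, `|partial_multi al phi x| <= c.
Proof.
move=> tphi.
have /choice[C CP] : forall al : multi_index n m, exists c : R,
    forall x, `|partial_multi al phi x| <= c.
  by move=> al; exact: test_function_bounded tphi.
exists (\sum_al `|C al|) => al x; rewrite (bigD1 al)//=.
by rewrite (le_trans (CP al x))// (le_trans (ler_norm _))// lerDl sumr_ge0.
Qed.

(* The test function is [phi psi], where [psi] vanishes on [S_r] and is 1 outside
   [S_((r + s) / 2)], with derivatives of order [m] bounded by [C (s - r)^-m]. *)
Lemma weak_cutoff phi : test_function Omega phi -> (forall x, 0 <= phi x) ->
  exists2 K : R, 0 <= K & forall r s, 0 < r -> r < s -> s - r <= 1 ->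
    nbhd_of S s `<=` Omega ->
  \int[mes]_(x in Omega `\` nbhd_of S s) (F x * phi x) <=
  \int[mes]_(x in Omega `\` nbhd_of S s) flux phi x +
  K / (s - r) ^+ m * \int[mes]_(x in nbhd_of S s `\` nbhd_of S r) `|u x|.
Proof.
move=> tphi phi0; have sphi : smooth phi by case: tphi.
have bS : bounded_set S by exact: compact_bounded.
have [C C0 CP] := nbhd_cutoff m bS sphi (fun s => test_function_bounded s tphi).
exists (#|{: multi_index n m}|%:R * A0 * C); first by rewrite !mulr_ge0// ltW.
move=> r s r0 rs sr1 sO; have s0 : 0 < s by exact: lt_trans rs.
have [psi [spsi psi01 psi0 psi1 [d0 d1 dC]]] := CP r s r0 rs sr1.
pose chi x := phi x * psi x.
have tchi : test_function (Omega `\` S) chi by exact: test_function_cutoff psi0.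
have chi0 x : 0 <= chi x by rewrite mulr_ge0//; have /andP[] := psi01 x.
have schi : smooth chi by case: tchi.
have [cchi cchiP] := test_partial_multi_bounded tchi.
have [c cP] := test_function_bounded [::] tchi.
have mchi D : measurable D -> measurable_fun D chi.
  by move=> mD; apply: continuous_rV_measurable => //; exact: (schi [::]).1.
have rsN : nbhd_of S r `<=` nbhd_of S s by apply: nbhd_of_sub; exact: ltW.
have := weak tchi chi0.
(* Both integrands vanish on [S_r]; removing it leaves a region where [u] and [F] are known to be
   integrable, so that the integrals can be split. *)
rewrite (@Rintegral_setD_eq0 _ _ _ _ _ (nbhd_of S r)); last first.
  by move=> x _ Nx; rewrite /chi psi0// mulr0 mulr0.
rewrite [X in _ <= X -> _](@Rintegral_setD_eq0 _ _ _ _ _ (nbhd_of S r)); last first.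
  move=> x _ Nx; rewrite /flux big1// => al _.
  by rewrite [partial_multi al chi x]d0// mulr0.
have layer : nbhd_of S s `\` nbhd_of S r `<=` Omega `\` nbhd_of S r.
  by move=> x [/sO].
have outer : (Omega `\` nbhd_of S r) `\` (nbhd_of S s `\` nbhd_of S r) =
    Omega `\` nbhd_of S s.
  apply/seteqP; split=> [x [[Ox Nr] H]|x [Ox Ns]].
    by split => // Ns; apply: H.
  by split; [split => // /rsN|case].
have mL : measurable (nbhd_of S s `\` nbhd_of S r) by exact: measurableD.
have iFchi : mes.-integrable (Omega `\` nbhd_of S r) (EFin \o (fun x => F x * chi x)).
  by apply: (integrable_bounded_mul (c := c)) => //; [exact: mchi|exact: FL1].
rewrite (Rintegral_setD _ mL layer)// outer => H.
have iflux := flux_integrable (mON r) (ONS r0) schi (uL1 r0) cchiP.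
move: H; rewrite (Rintegral_setD _ mL layer iflux)// outer => H.
have E1 : \int[mes]_(x in Omega `\` nbhd_of S s) (F x * chi x) =
    \int[mes]_(x in Omega `\` nbhd_of S s) (F x * phi x).
  apply: eq_Rintegral => x; rewrite inE => -[_ Ns]; rewrite /chi psi1 ?mulr1//.
  by move=> Nx; apply: Ns; apply: nbhd_of_sub Nx; lra.
have E2 : \int[mes]_(x in Omega `\` nbhd_of S s) flux chi x =
    \int[mes]_(x in Omega `\` nbhd_of S s) flux phi x.
  apply: eq_Rintegral => x; rewrite inE => -[_ Ns]; apply: eq_bigr => al _.
  by rewrite [partial_multi al chi x]d1.
(* The share of the layer in the left side is nonnegative and is dropped; in the right side it is
   the error term. *)
have P1 : 0 <= \int[mes]_(x in nbhd_of S s `\` nbhd_of S r) (F x * chi x).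
  by apply: Rintegral_ge0 => x [/sO Ox _]; rewrite mulr_ge0// F_ge0.
have P2 : \int[mes]_(x in nbhd_of S s `\` nbhd_of S r) flux chi x <=
    #|{: multi_index n m}|%:R * A0 * C / (s - r) ^+ m *
    \int[mes]_(x in nbhd_of S s `\` nbhd_of S r) `|u x|.
  have iu : mes.-integrable (nbhd_of S s `\` nbhd_of S r) (EFin \o u).
    exact: integrableS (mON r) mL layer (uL1 r0).
  have iu' : mes.-integrable (nbhd_of S s `\` nbhd_of S r) (EFin \o (fun x => `|u x|)).
    exact: integrable_abse iu.
  rewrite -RintegralZl//; apply: le_Rintegral => //.
  - exact: integrableS (mON r) mL layer iflux.
  - exact: integrable_scale.
  move=> x Lx; apply: le_trans (ler_norm _) _.
  rewrite -[_ * C / _]mulrA; apply: flux_bound; first exact/(ONS r0)/layer.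
  by move=> al; apply: dC; exact: size_multi_index.
rewrite -E1 -E2; apply: le_trans (lerD (lexx _) P2).
by apply: le_trans H; rewrite lerDl.
Qed.

Let J s := \int[mes]_(x in Omega `\` nbhd_of S s) F x.
Let A r s := \int[mes]_(x in nbhd_of S s `\` nbhd_of S r) `|u x|.

Lemma outside_mono r s : 0 < r -> r <= s -> J s <= J r.
Proof.
move=> r0 rs; rewrite /J.
have sub : Omega `\` nbhd_of S s `<=` Omega `\` nbhd_of S r.
  by move=> x [Ox Ns]; split => // /(nbhd_of_sub rs).
rewrite [leRHS](Rintegral_setD (mON r) (mON s) sub (FL1 r0)) lerDr.
by apply: Rintegral_ge0 => x [[Ox _] _]; exact: F_ge0.
Qed.

(* The test function is 1 near [S], so its flux outside [S_s] does not depend on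
   [s]. *)
Lemma outside_bound : (1 <= m)%N -> exists rho K C0,
  [/\ 0 < rho <= 1, nbhd_of S rho `<=` Omega, 0 < K, 0 <= C0 &
  forall r s, 0 < r -> r < s -> s <= rho -> J s <= K * A r s / (s - r) ^+ m + C0].
Proof.
move=> m1; have [rho [eta [/andP[rho0 rho1] rhoO teta eta01 eta1]]] :=
  plateau_function kS oO SO.
have eta0 x : 0 <= eta x by have /andP[] := eta01 x.
have [K K0 KP] := weak_cutoff teta eta0.
pose c1 := \int[mes]_(x in Omega `\` nbhd_of S rho) flux eta x.
(* [F (1 - eta)] vanishes on [S_rho], so replacing [F eta] by [F] costs the same constant for every
   [s <= rho]. *)
pose c2 := \int[mes]_(x in Omega `\` nbhd_of S rho) (F x * (1 - eta x)).
exists rho, (K + 1), (`|c1| + `|c2|); split.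
- by rewrite rho0.
- exact: rhoO.
- by rewrite ltr_wpDl.
- by rewrite addr_ge0.
move=> r s r0 rs srho; have s0 : 0 < s by exact: lt_trans rs.
have sr0 : 0 < (s - r) ^+ m by rewrite exprn_gt0// subr_gt0.
have setE : (Omega `\` nbhd_of S s) `\` nbhd_of S rho = Omega `\` nbhd_of S rho.
  apply/seteqP; split=> [x [[Ox _] Nx]//|x [Ox Nx]]; split => //; split => //.
  by move=> /(nbhd_of_sub srho).
have := KP r s r0 rs _ (subset_trans (nbhd_of_sub srho) rhoO).
have -> : \int[mes]_(x in Omega `\` nbhd_of S s) flux eta x = c1.
  rewrite (@Rintegral_setD_eq0 _ _ _ _ _ (nbhd_of S rho)) ?setE// => x _ Nx.
  rewrite /flux big1// => al _; rewrite [partial_multi _ _ _](_ : _ = 0) ?mulr0//.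
  apply: (@partials_near_cst _ _ _ _ _ 1); first by rewrite size_multi_index.
  have : nbhs x (nbhd_of S rho) by apply: open_nbhs_nbhs; split => //; exact: nbhd_of_open.
  by apply: filterS => y; exact: eta1.
have meta : measurable_fun (Omega `\` nbhd_of S s) (fun x => 1 - eta x).
  apply: measurable_funB => //; apply: continuous_rV_measurable => //.
  by case: teta => /(_ [::])[].
have iFe : mes.-integrable (Omega `\` nbhd_of S s) (EFin \o (fun x => F x * (1 - eta x))).
  apply: (integrable_bounded_mul (c := 1)) => //; first exact: FL1.
  by move=> x _; have /andP[e0 e1] := eta01 x; rewrite ger0_norm ?subr_ge0// gerBl.
have -> : \int[mes]_(x in Omega `\` nbhd_of S s) (F x * eta x) = J s - c2.
  rewrite /c2 -setE -(@Rintegral_setD_eq0 _ _ _ _ (Omega `\` nbhd_of S s)).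
    rewrite -RintegralB//; last exact: FL1.
    by apply: eq_Rintegral => x _; ring.
  by move=> x _ Nx; rewrite eta1// subrr mulr0.
have sr1 : s - r <= 1 by apply: le_trans rho1; apply: le_trans srho; rewrite gerBl ltW.
move=> /(_ sr1).
have Apos : 0 <= A r s by apply: Rintegral_ge0.
rewrite -/(A r s) lerBlDr => H; apply: le_trans H _.
have st (y z k1 k2 k3 k4 : R) : y <= z -> k1 <= k3 -> k2 <= k4 ->
  k1 + y + k2 <= z + (k3 + k4) by lra.
apply: st; [|exact: ler_norm|exact: ler_norm].
by rewrite mulrAC ler_wpM2r ?invr_ge0 ?(ltW sr0)// ler_wpM2r// lerDl.
Qed.

Lemma exhaustion rho : 0 < rho ->
  \bigcup_k (Omega `\` nbhd_of S (rho / k.+1%:R)) = Omega `\` S.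
Proof.
move=> rho0; apply/seteqP; split=> [x [k _ Ex]|x [Ox Sx]].
  by apply: ONS Ex; rewrite divr_gt0.
have : nbhs x (~` S).
  apply: open_nbhs_nbhs; split => //; apply: closed_openC.
  by apply: compact_closed kS; exact: norm_hausdorff.
move=> /nbhs_ballP[d /= d0 xd].
have dr0 : 0 < d / rho by rewrite divr_gt0.
have [k _ /(_ k (leqnn k)) kd] := near_infty_natSinv_lt (PosNum dr0).
exists k => //; split => // -[y Sy xy]; apply: (xd y) => //.
rewrite -ball_normE /=; apply: le_lt_trans (norm_le_enorm _) _.
apply: lt_trans xy _; rewrite mulrC -ltr_pdivlMr//.
Qed.

Lemma exhaustion_cvg rho (X : 'rV[R]_n -> \bar R) : 0 < rho ->
  measurable_fun (Omega `\` S) X -> (forall x, (Omega `\` S) x -> (0 <= X x)%E) ->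
  (\int[mes]_(x in Omega `\` nbhd_of S (rho / k.+1%:R)) X x @[k --> \oo] -->
   \int[mes]_(x in Omega `\` S) X x)%E.
Proof.
move=> rho0 mX X0; rewrite -(exhaustion rho0).
have sub k : Omega `\` nbhd_of S (rho / k.+1%:R) `<=` Omega `\` S.
  by apply: ONS; rewrite divr_gt0.
apply: ge0_nondecreasing_set_cvg_integral => //.
- move=> i j ij; apply/subsetPset => x [Ox Nx]; split => //.
  apply: contra_not Nx; apply: nbhd_of_sub.
  by rewrite ler_wpM2l ?(ltW rho0)// lef_pV2 ?posrE// ler_nat.
- by move=> k; apply: measurable_funS mX => //; exact: measurableD.
- by move=> k x /sub; exact: X0.
Qed.

Lemma F_measurable : measurable_fun (Omega `\` S) F.
Proof.
rewrite -(exhaustion ltr01); apply/measurable_fun_bigcup => // k.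
by apply/measurable_EFinP; apply: measurable_int (FL1 _); rewrite divr_gt0.
Qed.

Lemma u_measurable : measurable_fun (Omega `\` S) u.
Proof.
rewrite -(exhaustion ltr01); apply/measurable_fun_bigcup => // k.
by apply/measurable_EFinP; apply: measurable_int (uL1 _); rewrite divr_gt0.
Qed.

Lemma F_integrable rho M : 0 < rho -> (forall r, 0 < r -> r <= rho -> J r <= M) ->
  in_L1 (Omega `\` S) F.
Proof.
move=> rho0 JM; apply/integrableP; split; first exact/measurable_EFinP/F_measurable.
have mF : measurable_fun (Omega `\` S) (fun x => `|(EFin \o F) x|)%E.
  by apply: measurableT_comp => //; exact/measurable_EFinP/F_measurable.
have cF := exhaustion_cvg rho0 mF (fun x _ => abse_ge0 _).
apply: (@le_lt_trans _ _ M%:E); last exact: ltry.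
rewrite -(cvg_lim _ cF)//; apply: lime_le; first by apply/cvg_ex; eexists; exact: cF.
apply: nearW => k; have k0 : 0 < rho / k.+1%:R by rewrite divr_gt0.
have := JM _ k0; rewrite ler_pdivrMr// ler_peMr ?ler1n ?(ltW rho0)// => /(_ isT).
rewrite -lee_fin /J /Rintegral fineK; last by apply: integrable_fin_num => //; exact: FL1.
apply: le_trans; rewrite le_eqVlt; apply/predU1P; left.
apply: eq_integral => x; rewrite inE => -[Ox _].
by rewrite /= ger0_norm// F_ge0.
Qed.

Lemma u_integrable (gam : 'rV[R]_n -> \bar R) : in_L1 (Omega `\` S) F ->
  (\int[mes]_(x in Omega `\` S) gam x < +oo)%E ->
  (forall x, (Omega `\` S) x -> (0 <= gam x)%E) ->
  (forall x, (Omega `\` S) x -> ((`|u x| / 4 - F x)%:E <= gam x)%E) ->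
  in_L1 (Omega `\` S) u.
Proof.
move=> iF gamoo gam0 ugam; have mOS : measurable (Omega `\` S) by exact: measurableD.
have mu := u_measurable; have mF := F_measurable.
(* A measurable function below [gam]; [u] is then dominated by [4 (F + h)]. *)
pose h x := Num.max 0 (`|u x| / 4 - F x).
have mh : measurable_fun (Omega `\` S) h.
  have mu4 : measurable_fun (Omega `\` S) (fun x => `|u x| / 4).
    have mnu := measurableT_comp (@normr_measurable R setT) mu.
    exact: measurable_funM mnu (measurable_cst _).
  exact: measurable_maxr (measurable_cst _) (measurable_funB mu4 mF).
have h0 x : 0 <= h x by rewrite le_max lexx.
have ih : in_L1 (Omega `\` S) h.
  apply/integrableP; split; first exact/measurable_EFinP.
  apply: le_lt_trans gamoo; apply: ge0_le_integral_nonmeasurable.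
    by move=> x _; exact: abse_ge0.
  move=> x Ox; rewrite /= ger0_norm// /h /Num.max; case: ifP => _.
    exact: ugam.
  exact: gam0.
have iFh : in_L1 (Omega `\` S) (fun x => F x + h x) by exact: integrable_add.
apply: (integrable_dominated (c := 4) mOS mu iFh) => x [Ox Sx].
have Fh : `|u x| / 4 <= F x + h x.
  by rewrite -lerBlDl /h le_max lexx orbT.
rewrite [X in _ <= _ * X]ger0_norm ?addr_ge0 ?F_ge0//.
by rewrite -ler_pdivrMl// mulrC.
Qed.

(** [weak_cutoff] between [s / 2] and [s] compares the integrals outside [S_s] up to an error of at
    most [e / 2], by smallness of the layers. What remains of both inside [S_s] is controlled by the
    integral of the integrable function [Y], at most [e / 2] for small [s]. *)
Lemma weak_extends phi : in_L1 (Omega `\` S) F -> in_L1 (Omega `\` S) u ->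
  (forall eta, 0 < eta -> \forall s \near 0^'+, A (s / 2) s <= eta * s ^+ m) ->
  test_function Omega phi -> (forall x, 0 <= phi x) ->
  \int[mes]_(x in Omega `\` S) (F x * phi x) <= \int[mes]_(x in Omega `\` S) flux phi x.
Proof.
move=> iF iu Asmall tphi phi0; have mOS : measurable (Omega `\` S) by exact: measurableD.
have sphi : smooth phi by case: tphi.
have [K K0 KP] := weak_cutoff tphi phi0.
have [r0 r00 r0O] := nbhd_of_compact kS oO SO.
pose r1 := Num.min r0 1; have r1r0 : r1 <= r0 by rewrite /r1 ge_min lexx.
have r11 : r1 <= 1 by rewrite /r1 ge_min lexx orbT.
have r1gt0 : 0 < r1 by rewrite lt_min r00 ltr01.
have [c cP] := test_function_bounded [::] tphi.
have [cd cdP] := test_partial_multi_bounded tphi.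
pose H x := F x * phi x.
have iH : in_L1 (Omega `\` S) H.
  apply: (integrable_bounded_mul (c := c)) => //.
  by apply: continuous_rV_measurable => //; exact: (sphi [::]).1.
have iT : in_L1 (Omega `\` S) (flux phi) by exact: flux_integrable cdP.
pose Y x : R := `|H x| + `|flux phi x|.
have iY : in_L1 (Omega `\` S) Y.
  by apply: integrable_add => //; [exact: integrable_abse iH|exact: integrable_abse iT].
have mY : measurable_fun (Omega `\` S) (EFin \o Y) by exact: measurable_int iY.
have Y0 x : (Omega `\` S) x -> (0 <= (EFin \o Y) x)%E by rewrite lee_fin addr_ge0.
have cY := exhaustion_cvg r1gt0 mY Y0.
apply/ler_addgt0Pr => e e0.
have e2 : 0 < e / 2 by rewrite divr_gt0.
(* The power of 2 comes from [(s - s / 2) ^ m]; [K + 1] guards against [K = 0]. *)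
pose eta := e / 2 / ((K + 1) * 2 ^+ m).
have eta0 : 0 < eta by rewrite divr_gt0// mulr_gt0 ?exprn_gt0// ltr_wpDl.
have /nbhs_ballP[d /= d0 dA] := Asmall eta eta0.
have dr1 : 0 < d / r1 by rewrite divr_gt0.
have lim_gt : ((\int[mes]_(x in Omega `\` S) Y x - e / 2)%:E <
    \int[mes]_(x in Omega `\` S) (EFin \o Y) x)%E.
  rewrite -[ltRHS]fineK; last exact: integrable_fin_num.
  by rewrite lte_fin ltrBlDr ltrDl.
have nY : \forall k \near \oo, ((\int[mes]_(x in Omega `\` S) Y x - e / 2)%:E <
    \int[mes]_(x in Omega `\` nbhd_of S (r1 / k.+1%:R)) (EFin \o Y) x)%E.
  exact: cY _ (open_ereal_gt' lim_gt).
near \oo => k.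
have Yk : ((\int[mes]_(x in Omega `\` S) Y x - e / 2)%:E <
    \int[mes]_(x in Omega `\` nbhd_of S (r1 / k.+1%:R)) (EFin \o Y) x)%E by near: k.
pose s := r1 / k.+1%:R; have s0 : 0 < s by rewrite divr_gt0.
have sd : s < d.
  rewrite /s mulrC -ltr_pdivlMr//; near: k; exact: (near_infty_natSinv_lt (PosNum dr1)).
rewrite -/s in Yk.
have sr1 : s <= r1 by rewrite /s ler_pdivrMr// ler_peMr ?ler1n// ltW.
have sO : nbhd_of S s `<=` Omega.
  by apply: subset_trans r0O; apply: nbhd_of_sub; exact: le_trans r1r0.
have half0 : 0 < s / 2 by rewrite divr_gt0.
have half1 : s / 2 < s by rewrite ltr_pdivrMr// ltr_pMr// ltr1n.
have half2 : s - s / 2 = s / 2 by field.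
have half3 : s - s / 2 <= 1.
  by rewrite half2 (le_trans (ltW half1))// (le_trans sr1).
have Hw := KP _ _ half0 half1 half3 sO.
have As : A (s / 2) s <= eta * s ^+ m.
  by apply: dA => //=; rewrite /ball/= sub0r normrN gtr0_norm.
have err : K / (s - s / 2) ^+ m * A (s / 2) s <= e / 2.
  rewrite half2 expr_div_n invf_div.
  apply: (@le_trans _ _ (K * (2 ^+ m / s ^+ m) * (eta * s ^+ m))).
    by rewrite ler_wpM2l// mulr_ge0// divr_ge0 ?exprn_ge0// ltW.
  have -> : K * (2 ^+ m / s ^+ m) * (eta * s ^+ m) = K / (K + 1) * (e / 2).
    rewrite /eta; field.
    by rewrite !gt_eqF ?exprn_gt0// ltr_wpDl.
  have K1 : 0 < K + 1 by rewrite ltr_wpDl.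
  by rewrite ger_pMl// ler_pdivrMr// mul1r lerDl.
set D := Omega `\` S in iF iu iH iT iY mY Y0 cY lim_gt Yk mOS *.
set E := Omega `\` nbhd_of S s in Yk Hw *.
have ED : E `<=` D by exact: ONS.
have mE : measurable E by exact: mON.
have mDE : measurable (D `\` E) by exact: measurableD.
have sDE : D `\` E `<=` D by exact: subDsetl.
rewrite (Rintegral_setD mOS mE ED iH) (Rintegral_setD mOS mE ED iT).
have y2 : \int[mes]_(x in D `\` E) Y x <= e / 2.
  have := Rintegral_setD mOS mE ED iY.
  have : \int[mes]_(x in D) Y x - e / 2 < \int[mes]_(x in E) Y x.
    rewrite -lte_fin {2}/Rintegral fineK//; apply: integrable_fin_num => //.
    exact: integrableS iY.
  move: (\int[mes]_(x in D) Y x) (\int[mes]_(x in E) Y x)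
    (\int[mes]_(x in D `\` E) Y x) => y1 y2 y3 {Hw err}; lra.
have iHs : mes.-integrable (D `\` E) (EFin \o H) by exact: integrableS iH.
have iTs : mes.-integrable (D `\` E) (EFin \o flux phi) by exact: integrableS iT.
have HT : \int[mes]_(x in D `\` E) H x - \int[mes]_(x in D `\` E) flux phi x <= e / 2.
  apply: le_trans y2; rewrite -RintegralB//; apply: le_Rintegral => //.
  - exact: integrable_sub.
  - exact: integrableS iY.
  by move=> x _; rewrite lerD ?ler_norm// -normrN ler_norm.
rewrite -/(A (s / 2) s) in Hw.
have st (h1 h2 t1 t2 a : R) : h1 <= t1 + a -> a <= e / 2 -> h2 - t2 <= e / 2 ->
  h2 + h1 <= t2 + t1 + e by clear Hw err HT y2; lra.
exact: st Hw err HT.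
Unshelve. all: by end_near. Qed.

End removal.

(** * Removability *)

(** Near 0 the logarithm of [r] is negative, so a lower bound on [log V / log r] is an upper bound
    on [V]. If the lower limit is infinite, [fine] returns 0 and the claim is that the bounded [V]
    lies below [r ^ (- eps)], which tends to infinity. *)
Lemma liminf_power_bound (R : realType) (V : R -> \bar R) (M eps : R) : 0 < eps ->
  (\forall r \near 0^'+, (0 <= V r <= M%:E)%E) ->
  \forall r \near 0^'+,
    (V r <= (r `^ (fine (limf_einf (fun r => lne (V r) * ((ln r)^-1)%:E)%E 0^'+) - eps))%:E)%E.
Proof.
move=> eps0 VM; set L := limf_einf _ _.
have [Lfin|Linf] := boolP (L \is a fin_num); last first.
  have -> : fine L = 0 by case: (L) Linf.
  have M1 : 0 < `|M| + 1 by rewrite ltr_wpDl.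
  have := powR_near0_le (K := (`|M| + 1)^-1) (d := eps); rewrite invr_gt0 => /(_ M1 eps0) H.
  near=> r; have /andP[_ VrM] : (0 <= V r <= M%:E)%E by near: r.
  have r0 : 0 < r by [].
  apply: (le_trans VrM); rewrite lee_fin sub0r powRN.
  have H1 : r `^ eps <= (`|M| + 1)^-1 by near: r.
  rewrite -[M]invrK; apply: (@le_trans _ _ (`|M| + 1)).
    by rewrite invrK (le_trans (ler_norm M))// lerDl.
  by rewrite -[leLHS]invrK lef_pV2 ?posrE ?powR_gt0 ?invr_gt0.
have : ((fine L - eps)%:E < L)%E by rewrite -[X in (_ < X)%E](fineK Lfin) lte_fin ltrBlDr ltrDl.
rewrite {2}/L limf_einfE => /ereal_sup_gt[_ [B FB <-]] Beps.
near=> r; have r0 : 0 < r by []. 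
have r1 : r < 1 by [].
have Br : B r by near: r.
have /andP[Vr0 _] : (0 <= V r <= M%:E)%E by near: r.
have lnr : ln r < 0 by apply: ln_lt0; rewrite r0.
have : ((fine L - eps)%:E < lne (V r) * ((ln r)^-1)%:E)%E.
  apply: lt_le_trans Beps _; apply: ereal_inf_lbound; by exists r.
have VrM : (V r <= M%:E)%E by have /andP[] : (0 <= V r <= M%:E)%E by near: r.
move: Vr0 VrM; case: (V r) => [v| |]//; rewrite !lee_fin => v0 vM.
rewrite /lne; case: ifP => [vle|/negbT].
  by move=> _; rewrite (le_trans vle)// powR_ge0.
rewrite -ltNge => v1; rewrite -EFinM lte_fin => H.
rewrite -[v]lnK ?posrE// /powR gt_eqF// ler_expR.
rewrite -ler_ndivlMr// ltW//.
Unshelve. all: by end_near.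
Qed.

(** Positive measure of [D] rules out the value [+oo], which the essential infimum takes on a
    negligible set. *)
Lemma ess_inf_on_root (R : realType) (n m : nat) (D : set 'rV[R]_n) (f : 'rV[R]_n -> R) :
  (1 <= m)%N -> (0 < mes D)%E -> (forall x, D x -> 0 <= f x) ->
  exists E : R, [/\ 0 <= E, ess_inf_on D (fun x => f x `^ m%:R^-1) = E%:E &
    {ae mes, forall x, D x -> E ^+ m <= f x}].
Proof.
move=> m1 D0 f0; set h := fun x => f x `^ m%:R^-1.
have h0 : (0 <= ess_inf_on D h)%E.
  apply/ess_infP/aeW => x; rewrite /patch; case: ifP => xD; last exact: leey.
  by rewrite lee_fin powR_ge0.
have hoo : ess_inf_on D h != +oo%E.
  apply/eqP => /ess_inf_eqyP [N [mN N0 hN]].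
  have DN : D `<=` N.
    by move=> x Dx; apply: hN => /=; rewrite /patch mem_set.
  have : (mes D <= 0)%E by rewrite -N0; exact: le_outer_measure.
  by rewrite leNgt D0.
have [E EE] : exists E : R, ess_inf_on D h = E%:E.
  by case: (ess_inf_on D h) h0 hoo => // E _ _; exists E.
exists E; split => //; first by rewrite -lee_fin -EE.
have := ess_inf_le mes (patch (fun=> +oo%E) D (EFin \o h)).
rewrite -/(ess_inf_on D h) EE; apply: filterS => x + Dx.
rewrite /patch mem_set//= lee_fin => Eh.
have E0 : 0 <= E by rewrite -lee_fin -EE.
have mn0 : m%:R != 0 :> R by rewrite pnatr_eq0 -lt0n.
have -> : f x = h x ^+ m.
  by rewrite -powR_mulrn ?powR_ge0// -powRrM mulVf// powRr1// f0.
by apply: lerXn2r; rewrite ?nnegrE ?powR_ge0.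
Qed.

(* The affine minorant [g z >= (g y / y) (z - y)] plays the role of Jensen's
   inequality. *)
Lemma annulus_estimate (R : realType) (n : nat) (g : R -> R) (L : set 'rV[R]_n)
    (u f : 'rV[R]_n -> R) (V q y : R) : admissible_g g ->
  measurable L -> in_L1 L u -> in_L1 L (fun x => f x * g `|u x|) ->
  (mes L <= V%:E)%E -> 0 <= q -> {ae mes, forall x, L x -> q <= f x} ->
  0 < y -> 2 * V * y <= \int[mes]_(x in L) `|u x| ->
  V * q * g y <= \int[mes]_(x in L) (f x * g `|u x|).
Proof.
move=> ag mL iu iF LV q0 qf y0 Vu.
(* Here [I] is the integral of [|u|], [v] the measure of [L] and [c] the slope of the minorant times
   [q]. Of the two copies of [V y] in the hypothesis, one pays for the constant term of the
   minorant. *)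
have st (I J c v : R) : 0 <= c -> v <= V -> 2 * V * y <= I -> c * I - c * y * v <= J ->
  V * (c * y) <= J .
  move=> c0 vV VI; have := ler_wpM2l c0 VI.
  have := ler_wpM2l (mulr_ge0 c0 (ltW y0)) vV; clear; lra.
pose c := q * g y / y.
have gy0 : 0 <= g y by apply: (admissible_ge0 ag); exact: ltW.
have c0 : 0 <= c by rewrite divr_ge0 ?mulr_ge0// ltW.
have -> : V * q * g y = V * (c * y) by rewrite /c divfK ?gt_eqF// mulrA.
have Lfin : (mes L < +oo)%E by rewrite (le_lt_trans LV)// ltry.
have ic : in_L1 L (fun=> c * y).
  apply: measurable_bounded_integrable => //; exists `|c * y|; split; first exact: num_real.
  by move=> x xc z _ /=; exact: ltW.
have iau : in_L1 L (fun x => `|u x|) by exact: integrable_abse iu.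
have icu : in_L1 L (fun x => c * `|u x|) by exact: integrable_scale.
have iS := integrable_sub mL icu ic.
have iT := integrable_sub mL iF iS.
apply: (st _ _ _ (fine (mes L)) c0 _ Vu).
  by rewrite -lee_fin fineK ?ge0_fin_numE.
rewrite -subr_ge0 -(RintegralZl _ mL iau).
rewrite -(@Rintegral_cst _ _ _ mes _ mL (c * y)) -RintegralB// -RintegralB//.
apply: ae_ge0_Rintegral => //; apply: filterS qf => x qf Lx.
rewrite subr_ge0; apply: (@le_trans _ _ (q * g `|u x|)); last first.
  by rewrite ler_wpM2r ?qf// (admissible_ge0 ag).
rewrite -mulrBr /c -!mulrA ler_wpM2l// mulrCA ler_pdivrMl//.
have [yu|uy] := leP y `|u x|.
  apply: le_trans (admissible_slope ag y0 yu).
  by rewrite [leRHS]mulrC ler_wpM2l// lerBlDr lerDl ltW.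
rewrite (@le_trans _ _ 0)//.
  by rewrite mulr_ge0_le0// subr_le0 ltW.
by rewrite mulr_ge0 ?(admissible_ge0 ag)// ltW.
Qed.

(** * The iteration applied to the layers around [S] *)

Section near_singular_set.
Variables (R : realType) (n m : nat) (g : R -> R).
Hypotheses (ag : admissible_g g) (m_ge1 : (1 <= m)%N).
Hypothesis gint :
  (\int[lebesgue_measure]_(z in `[1%R, +oo[) (G_integrand m g z)%:E < +oo)%E.

(** From the limit only [product < 1] for small [r] is kept. It excludes [e = 0], where [G_inv] is
    [+oo]; for [e > 0] it says that [G_inv] at [C r e] is less than [r ^ d], and [G_inv_le] turns
    this into a bound on [G] beyond [r ^ d]. *)
Lemma G_le_of_limit (D : R -> set 'rV[R]_n) (f : 'rV[R]_n -> R) (C d : R) : 0 < C ->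
  (\forall r \near 0^'+, (0 < mes (D r))%E) ->
  (\forall r \near 0^'+, forall x, D r x -> 0 <= f x) ->
  ((r `^ (- d))%:E *
    G_inv m g ((C * r)%:E * ess_inf_on (D r) (fun x => (f x `^ m%:R^-1)%R)))%E
    @[r --> 0^'+] --> (0 : R)%:E ->
  \forall r \near 0^'+,
    let e := fine (ess_inf_on (D r) (fun x => (f x `^ m%:R^-1)%R)) in
    [/\ 0 < e, {ae mes, forall x, D r x -> e ^+ m <= f x} &
      forall y, r `^ d <= y -> G_fun m g y <= C * (r * e)].
Proof.
move=> C0 D0 f0 lim0.
have lt1 := lim0 _ (open_ereal_lt' (y := 1%E) (@lte01 R)).
near=> r; have r0 : 0 < r by [].
have Dr : (0 < mes (D r))%E by near: r.
have fr : forall x, D r x -> 0 <= f x by near: r.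
have [E [E0 EE Ef]] := ess_inf_on_root m_ge1 Dr fr.
have : ((r `^ (- d))%:E *
    G_inv m g ((C * r)%:E * ess_inf_on (D r) (fun x => (f x `^ m%:R^-1)%R)) < 1)%E by near: r.
have rd0 : 0 < r `^ d by rewrite powR_gt0.
rewrite EE -EFinM [fine _]/= powRN; move: E0; rewrite le_eqVlt => /predU1P[E0|E0].
  by rewrite -E0 mulr0 /= eqxx gt0_muley// lte_fin invr_gt0.
have s0 : 0 < C * r * E by rewrite !mulr_gt0.
rewrite /= gt_eqF// -EFinM lte_fin -ltr_pdivlMl ?invr_gt0// invrK mulr1 => tr.
split=> // y ry; rewrite mulrA; apply: (G_inv_le ag gint s0).
  exact: lt_le_trans ry.
by rewrite /= gt_eqF// lee_fin (le_trans (ltW tr)).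
Unshelve. all: by end_near.
Qed.

Variables (Omega S : set 'rV[R]_n) (f u : 'rV[R]_n -> R) (h delta rho0 K C0 : R).
Hypotheses (oO : open Omega) (kS : compact S) (SO : S `<=` Omega).
Hypothesis f_ge0 : forall x, Omega x -> 0 <= f x.
Let F x := f x * g `|u x|.
Hypothesis uL1 : forall r, 0 < r -> in_L1 (Omega `\` nbhd_of S r) u.
Hypothesis FL1 : forall r, 0 < r -> in_L1 (Omega `\` nbhd_of S r) F.
Hypothesis delta_gt0 : 0 < delta.
Hypothesis f_limit : forall C, 0 < C ->
  ((r `^ (h - m%:R - delta))%:E *
    G_inv m g ((C * r)%:E *
      ess_inf_on (nbhd_of S r `\` S) (fun x => (f x `^ m%:R^-1)%R)))%E
    @[r --> 0^'+] --> (0 : R)%:E.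
Hypothesis volume_bound : \forall r \near 0^'+,
  (mes (nbhd_of S r `\` S) <= (r `^ (h - delta / 2))%:E)%E.
Let J s := \int[mes]_(x in Omega `\` nbhd_of S s) F x.
Let A r s := \int[mes]_(x in nbhd_of S s `\` nbhd_of S r) `|u x|.
Hypotheses (rho0_gt0 : 0 < rho0) (rho0_sub : nbhd_of S rho0 `<=` Omega).
Hypotheses (K_gt0 : 0 < K) (C0_ge0 : 0 <= C0).
Hypothesis J_le : forall r s, 0 < r -> r < s -> s <= rho0 ->
  J s <= K * A r s / (s - r) ^+ m + C0.

Let F_ge0 x : Omega x -> 0 <= F x.
Proof. by move=> Ox; rewrite mulr_ge0 ?f_ge0// (admissible_ge0 ag). Qed.

Let mO : measurable Omega. Proof. exact: open_rV_measurable. Qed.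

Let mN r : measurable (nbhd_of S r).
Proof. by apply: open_rV_measurable; exact: nbhd_of_open. Qed.

Let J_mono r s : 0 < r -> r <= s -> s <= rho0 -> J s <= J r.
Proof. by move=> r0 rs _; exact: (outside_mono oO F_ge0 FL1). Qed.

Let e r := fine (ess_inf_on (nbhd_of S r `\` S) (fun x => f x `^ m%:R^-1)).
Let V r := fine (mes (nbhd_of S r `\` S)).

Let V_fin r : mes (nbhd_of S r `\` S) = (V r)%:E.
Proof.
rewrite /V fineK// ge0_fin_numE//.
apply: le_lt_trans (mes_bounded_lty (nbhd_of_bounded r (compact_bounded kS))).
by apply: le_outer_measure; exact: subDsetl.
Qed.

Let layer_gain rho r s y : rho <= rho0 -> 0 < V rho -> 0 < e rho ->
  {ae mes, forall x, (nbhd_of S rho `\` S) x -> e rho ^+ m <= f x} ->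
  0 < r -> r < s -> s <= rho -> 0 < y -> y <= A r s / (2 * V rho) ->
  V rho * e rho ^+ m * g y <= J r - J s.
Proof.
move=> rho_le V0 e0 ef r0 rs srho y0 yA.
have Ls : nbhd_of S s `\` nbhd_of S r `<=` Omega `\` nbhd_of S r.
  by move=> x [Sx Nx]; split => //; apply: rho0_sub; exact: nbhd_of_sub (le_trans srho rho_le) _ Sx.
have LD : nbhd_of S s `\` nbhd_of S r `<=` nbhd_of S rho `\` S.
  move=> x [Sx Nx]; split; first exact: nbhd_of_sub srho _ Sx.
  by move=> Sx'; apply: Nx; exact: sub_nbhd_of.
have mL : measurable (nbhd_of S s `\` nbhd_of S r) by exact: measurableD.
have sub : Omega `\` nbhd_of S s `<=` Omega `\` nbhd_of S r.
  by move=> x [Ox Ns]; split => // /(nbhd_of_sub (ltW rs)).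
have -> : J r - J s = \int[mes]_(x in nbhd_of S s `\` nbhd_of S r) F x.
  rewrite /J (Rintegral_setD _ _ sub (FL1 r0)); try exact: measurableD.
  rewrite addrK; congr (Rintegral _ _ _); apply/seteqP; split => x.
    by move=> [[Ox Nr] H]; split => //; apply: contrapT => Ns; exact: H.
  by move=> Lx; split; [exact: Ls|case: Lx => Sx _ [_]].
apply: (annulus_estimate ag mL).
- by apply: integrableS Ls (uL1 r0) => //; exact: measurableD.
- by apply: integrableS Ls (FL1 r0) => //; exact: measurableD.
- by rewrite -V_fin; exact: le_outer_measure.
- by rewrite exprn_ge0// ltW.
- by apply: filterS ef => x ef Lx; exact/ef/LD.
- by [].
- by rewrite mulrC -ler_pdivlMr// mulr_gt0.
Qed.

(* When some [S_r \ S] is negligible the layers carry no mass and there is nothing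
   to iterate; otherwise the essential infima are finite and positive. *)
Lemma layer_bounds :
  (exists M, forall r, 0 < r -> r <= rho0 -> J r <= M) /\
  (forall eta, 0 < eta -> \forall s \near 0^'+, A (s / 2) s <= eta * s ^+ m).
Proof.
have [[rho1 rho10 V0]|V0] := pselect (exists2 r, 0 < r & V r = 0).
  have A0 r s : 0 < r -> s <= rho0 -> s <= rho1 -> A r s = 0.
    move=> r0 s0 s1; have mL : measurable (nbhd_of S s `\` nbhd_of S r) by exact: measurableD.
    rewrite /A /Rintegral null_set_integral//.
      apply/measurable_EFinP; apply: measurableT_comp (@normr_measurable R setT) _.
      apply: (@measurable_funS _ _ _ _ (Omega `\` nbhd_of S r)).
      - exact: measurableD.
      - move=> x [Sx Nx]; split => //; apply: rho0_sub; exact: nbhd_of_sub s0 _ Sx.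
      - by apply/measurable_EFinP; exact: measurable_int (uL1 r0).
    have Z : mes (nbhd_of S rho1 `\` S) = 0%E by rewrite V_fin V0.
    apply/eqP; rewrite -measure_le0 -[X in (_ <= X)%E]Z; apply: le_outer_measure.
    move=> x [Sx Nx]; split; first exact: nbhd_of_sub s1 _ Sx.
    by move=> Sx'; apply: Nx; exact: sub_nbhd_of.
  pose rho := Num.min rho0 rho1; have rho_gt0 : 0 < rho by rewrite lt_min rho0_gt0.
  have rho_le0 : rho <= rho0 by rewrite ge_min lexx.
  have rho_le1 : rho <= rho1 by rewrite ge_min lexx orbT.
  split.
    have Jsmall s : 0 < s -> s <= rho -> J s <= C0.
      move=> s0 sr; have s20 : 0 < s / 2 by rewrite divr_gt0.
      have ss : s / 2 < s by rewrite ltr_pdivrMr// ltr_pMr// ltr1n.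
      have := J_le s20 ss (le_trans sr rho_le0).
      by rewrite A0// ?(le_trans sr)// mulr0 mul0r add0r.
    exists C0 => r r0 rr0; have [rr|/ltW rr] := leP r rho; first exact: Jsmall.
    by apply: le_trans (Jsmall _ rho_gt0 (lexx _)); exact: J_mono.
  move=> eta eta0; near=> s; have s0 : 0 < s by [].
  have sr : s <= rho by near: s; exact: nbhs_right_le.
  by rewrite A0 ?divr_gt0 ?(le_trans sr)// mulr_ge0 ?exprn_ge0 ?ltW.
have Vgt0 r : 0 < r -> 0 < V r.
  move=> r0; rewrite lt_neqAle fine_ge0// andbT; apply/negP => /eqP V0'.
  by apply: V0; exists r.
have D0 : \forall r \near 0^'+, (0 < mes (nbhd_of S r `\` S))%E.
  by near=> r; rewrite V_fin lte_fin; exact: Vgt0.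
have Df : \forall r \near 0^'+, forall x, (nbhd_of S r `\` S) x -> 0 <= f x.
  near=> r; move=> x [Sx _]; apply/f_ge0/rho0_sub; apply: nbhd_of_sub Sx.
  by near: r; exact: nbhs_right_le.
have dE : h - m%:R - delta = - (m%:R - h + delta) by ring.
have GL C : 0 < C -> \forall r \near 0^'+, [/\ 0 < e r,
    {ae mes, forall x, (nbhd_of S r `\` S) x -> e r ^+ m <= f x} &
    forall y, r `^ (m%:R - h + delta) <= y -> G_fun m g y <= C * (r * e r)].
  by move=> C1; apply: (G_le_of_limit C1 D0 Df); rewrite -dE; exact: f_limit.
have JD : \forall rho \near 0^'+, [/\ 0 < V rho, 0 < e rho,
  V rho <= rho `^ (h - delta / 2) &
  forall r s y, 0 < r -> r < s -> s <= rho -> 0 < y -> y <= A r s / (2 * V rho) ->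
    V rho * e rho ^+ m * g y <= J r - J s].
  have G1 := GL 1 ltr01; near=> rho; have rho_gt0 : 0 < rho by [].
  have [e0 ef _] : [/\ 0 < e rho,
    {ae mes, forall x, (nbhd_of S rho `\` S) x -> e rho ^+ m <= f x} &
    forall y, rho `^ (m%:R - h + delta) <= y -> G_fun m g y <= 1 * (rho * e rho)].
    by near: rho.
  split => //; first exact: Vgt0.
    by rewrite -lee_fin -V_fin; near: rho.
  move=> r s y; apply: layer_gain => //; last exact: Vgt0.
  by near: rho; exact: nbhs_right_le.
have GL' C : 0 < C -> \forall rho \near 0^'+, forall y,
    rho `^ (m%:R - h + delta) <= y -> G_fun m g y <= C * (rho * e rho).
  by move=> C1; apply: filterS (GL C C1) => rho [].
split; first exact: (core_bounded ag m_ge1 gint C0_ge0 K_gt0 delta_gt0 J_mono J_le JD GL').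
by move=> eta; exact: (core_layer ag m_ge1 gint C0_ge0 K_gt0 delta_gt0 rho0_gt0 J_mono J_le JD GL').
Unshelve. all: by end_near.
Qed.

End near_singular_set.

Lemma ae_eq_Rintegral d (T : measurableType d) (R : realType)
    (mu : {measure set T -> \bar R}) (D : set T) (X Y : T -> R) : measurable D ->
  measurable_fun D X -> measurable_fun D Y -> {ae mu, forall x, D x -> X x = Y x} ->
  \int[mu]_(x in D) X x = \int[mu]_(x in D) Y x.
Proof.
move=> mD mX mY XY; rewrite /Rintegral (@ae_eq_integral _ _ _ mu D (EFin \o Y))//.
- exact/measurable_EFinP.
- exact/measurable_EFinP.
- by apply: filterS XY => x XY Dx /=; rewrite XY.
Qed.

(** * Truncated coefficients and the extension of [u] by zero *)

Section extension.
Variables (R : realType) (n m : nat) (g : R -> R).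
Hypotheses (ag : admissible_g g) (m_ge1 : (1 <= m)%N).
Hypothesis gint :
  (\int[lebesgue_measure]_(z in `[1%R, +oo[) (G_integrand m g z)%:E < +oo)%E.
Variables (Omega S : set 'rV[R]_n) (a : multi_index n m -> 'rV[R]_n -> R -> R).
Variables (f u : 'rV[R]_n -> R) (A0 : R).
Hypotheses (oO : open Omega) (kS : compact S) (SO : S `<=` Omega).
Hypothesis ca : forall al, caratheodory_function Omega (a al).
Hypothesis A0_gt0 : 0 < A0.
Hypothesis a_le : forall al,
  {ae mes, forall x, Omega x -> forall z, `|a al x z| <= A0 * `|z|}.
Hypothesis usol : weak_solution Omega a f g S u.

Let F x := f x * g `|u x|.
Let w := extend_by_zero S u.

Let uL1 r : 0 < r -> in_L1 (Omega `\` nbhd_of S r) u.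
Proof. by move=> r0; have [] := usol.1 r r0. Qed.

Let FL1 r : 0 < r -> in_L1 (Omega `\` nbhd_of S r) F.
Proof. by move=> r0; have [] := usol.1 r r0. Qed.

Let mO : measurable Omega. Proof. exact: open_rV_measurable. Qed.

Let cS : closed S. Proof. by apply: compact_closed kS; exact: norm_hausdorff. Qed.

Let mS : measurable S. Proof. exact: closed_rV_measurable. Qed.

Let mOS : measurable (Omega `\` S). Proof. exact: measurableD. Qed.

Lemma extend_by_zero_out x : ~ S x -> w x = u x.
Proof. by move=> Sx; rewrite /w /extend_by_zero patchE mem_set. Qed.

Lemma extend_by_zero_in x : S x -> w x = 0.
Proof. by move=> Sx; rewrite /w /extend_by_zero patchE memNset//; exact. Qed.

(* Off a null set this is [a al x (u x)]. *)
Definition clamped_flux al x : R :=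
  Num.max (- (A0 * `|u x|)) (Num.min (A0 * `|u x|) (a al x (u x))).

Lemma clamped_flux_measurable al : measurable_fun (Omega `\` S) (clamped_flux al).
Proof.
have mu : measurable_fun (Omega `\` S) u := u_measurable oO kS uL1.
have mA : measurable_fun (Omega `\` S) (fun x => A0 * `|u x|).
  exact: measurable_funM (measurable_cst _) (measurableT_comp (@normr_measurable R setT) mu).
have ma : measurable_fun (Omega `\` S) (fun x => a al x (u x)).
  by apply: (caratheodory_comp mO) => //; exact: subDsetl.
have mNA : measurable_fun (Omega `\` S) (fun x => - (A0 * `|u x|)).
  exact: measurableT_comp (@oppr_measurable R setT) mA.
exact: measurable_maxr mNA (measurable_minr mA ma).
Qed.

Lemma clamped_flux_le al x : `|clamped_flux al x| <= A0 * `|u x|.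
Proof.
have c0 : 0 <= A0 * `|u x| by rewrite mulr_ge0// ltW.
rewrite /clamped_flux ler_norml le_max lexx/= ge_max ge_min lexx /= andbT.
by rewrite (le_trans _ c0)// oppr_le0.
Qed.

(** A single null set for all multi-indices: they are enumerated through [pickle], and a countable
    union of null sets is null. *)
Lemma growth_ae :
  {ae mes, forall x, forall al, Omega x -> forall z, `|a al x z| <= A0 * `|z|}.
Proof.
have H : {ae mes, forall x, forall k, if unpickle k is Some al
    then Omega x -> forall z, `|a al x z| <= A0 * `|z| else True}.
  by apply: ae_foralln => k; case: unpickle => [al|]; [exact: a_le|exact: aeW].
by apply: filterS H => x ax al; have := ax (pickle al); rewrite pickleK.
Qed.

Lemma clamped_flux_ae phi :
  {ae mes, forall x, (Omega `\` S) x ->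
    flux (fun al x => a al x (w x)) phi x = flux clamped_flux phi x}.
Proof.
apply: filterS growth_ae => x ax [Ox Sx]; apply: eq_bigr => al _; congr (_ * _ * _).
rewrite extend_by_zero_out// /clamped_flux.
have := ax al Ox (u x); rewrite ler_norml => /andP[H1 H2].
by rewrite (min_r H2) (max_r H1).
Qed.

Lemma extend_by_zero_measurable : measurable_fun Omega w.
Proof.
rewrite -(setDUK SO); apply/measurable_funU => //; split.
  have m0 : measurable_fun S (fun=> 0 : R) by exact: measurable_cst.
  by apply: eq_measurable_fun m0 => x /set_mem Sx; rewrite extend_by_zero_in.
have mu : measurable_fun (Omega `\` S) u := u_measurable oO kS uL1.
by apply: eq_measurable_fun mu => x /set_mem[_ Sx]; rewrite extend_by_zero_out.
Qed.

Lemma flux_extend_by_zero_measurable phi : smooth phi ->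
  measurable_fun Omega (flux (fun al x => a al x (w x)) phi).
Proof.
(* Applied with an empty singular set, since [w] is measurable on all of [Omega]. *)
move=> sphi; apply: (@flux_measurable _ _ _ Omega set0) => //; first exact: compact0.
  by move=> al; rewrite setD0; apply: (caratheodory_comp mO) => //; exact: extend_by_zero_measurable.
by rewrite setD0.
Qed.

Lemma clamped_weak phi : test_function (Omega `\` S) phi -> (forall x, 0 <= phi x) ->
  \int[mes]_(x in Omega) (F x * phi x) <= \int[mes]_(x in Omega) flux clamped_flux phi x.
Proof.
move=> tphi phi0; have [sphi _ supp] := tphi.
have S0 (b : multi_index n m -> 'rV[R]_n -> R) x : Omega x -> S x -> flux b phi x = 0.
  move=> _ Sx; apply: big1 => al _.
  rewrite /partial_multi (@partials_out_closed _ _ _ _ (support_of phi)) ?mulr0//.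
  - exact: closed_closure.
  - by move=> y Ny; apply: contra_notP Ny => /eqP y0; apply: subset_closure.
  - by move=> /supp[].
apply: le_trans (usol.2 phi tphi phi0) _.
rewrite [leLHS](Rintegral_setD_eq0 _ (S0 (fun al x => a al x (u x)))).
rewrite [leRHS](Rintegral_setD_eq0 _ (S0 _)).
rewrite le_eqVlt; apply/predU1P; left; apply: ae_eq_Rintegral => //.
- apply: (flux_measurable oO kS) => // al.
  by apply: (caratheodory_comp mO) => //; exact: (u_measurable oO kS uL1).
- by apply: (flux_measurable oO kS) => //; exact: clamped_flux_measurable.
- apply: filterS (clamped_flux_ae phi) => x H Ox; rewrite -(H Ox).
  by apply: eq_bigr => al _; rewrite extend_by_zero_out//; case: Ox.
Qed.

Hypothesis f_ge0 : forall x, Omega x -> 0 <= f x.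
Hypothesis gamma_integral :
  (\int[mes]_(x in Omega `\` S) gamma_of_inv g (f x) < +oo)%E.

Lemma young_gamma x : (Omega `\` S) x ->
  (0 <= gamma_of_inv g (f x))%E /\ ((`|u x| / 4 - F x)%:E <= gamma_of_inv g (f x))%E.
Proof.
move=> [Ox _]; rewrite /gamma_of_inv; case: eqP => [_|/eqP fx0]; first by rewrite !leey.
have fx : 0 < f x by rewrite lt_neqAle eq_sym fx0 f_ge0.
have st (p q r : R) : q <= 4 * p + 4 * r -> q / 4 - p <= r by lra.
have g0 : g 0 = 0 by case: ag.
split; rewrite lee_fin; last exact/st/(young_weak ag m_ge1 gint fx).
by have := young_weak ag m_ge1 gint fx (lexx 0); rewrite g0 !mulr0 add0r pmulr_rge0.
Qed.

Lemma removable_of_bounds rho M : 0 < rho ->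
  (forall r, 0 < r -> r <= rho -> \int[mes]_(x in Omega `\` nbhd_of S r) F x <= M) ->
  (forall eta, 0 < eta -> \forall s \near 0^'+,
    \int[mes]_(x in nbhd_of S s `\` nbhd_of S (s / 2)) `|u x| <= eta * s ^+ m) ->
  removable Omega a f g S u.
Proof.
move=> rho0 JM small.
have F_ge0 x : Omega x -> 0 <= F x.
  by move=> Ox; rewrite mulr_ge0 ?f_ge0// (admissible_ge0 ag).
have g0 : g 0 = 0 by case: ag.
have iF : in_L1 (Omega `\` S) F := F_integrable oO kS F_ge0 FL1 rho0 JM.
have iu : in_L1 (Omega `\` S) u.
  by apply: (u_integrable oO kS F_ge0 uL1 FL1 iF gamma_integral) => x /young_gamma[].
have ext X Y : (forall x, S x -> Y x = 0) -> (forall x, ~ S x -> Y x = X x) ->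
    in_L1 (Omega `\` S) X -> in_L1 Omega Y.
  move=> Y0 YX /(integrable_mkcond _ mOS) iX; apply/(integrable_mkcond _ mO).
  congr (mes.-integrable _ _): iX; apply/funext => x; rewrite !patchE.
  have [Sx|Sx] := pselect (S x).
    by rewrite (mem_set (SO Sx)) /= Y0// memNset// => -[].
  rewrite /= YX//; have [Ox|Ox] := pselect (Omega x); first by rewrite !mem_set.
  by rewrite !memNset// => -[].
have wF x : ~ S x -> f x * g `|w x| = F x by move=> Sx; rewrite extend_by_zero_out.
have wS x : S x -> f x * g `|w x| = 0.
  by move=> Sx; rewrite extend_by_zero_in// normr0 g0 mulr0.
split.
- exact: ext extend_by_zero_in extend_by_zero_out iu.
- exact: ext wS wF iF.
move=> phi tphi phi0; have [sphi _ _] := tphi.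
rewrite -/(flux (fun al x => a al x (w x)) phi _) -/w.
have -> : \int[mes]_(x in Omega) (f x * g `|w x| * phi x) =
    \int[mes]_(x in Omega `\` S) (F x * phi x).
  rewrite (@Rintegral_setD_eq0 _ _ _ _ _ S).
    by apply: eq_Rintegral => x /set_mem[_ Sx]; rewrite wF.
  by move=> x _ Sx; rewrite wS// mul0r.
suff -> : \int[mes]_(x in Omega) flux (fun al x => a al x (w x)) phi x =
    \int[mes]_(x in Omega `\` S) flux clamped_flux phi x.
  apply: (weak_extends oO kS SO F_ge0 uL1 FL1 clamped_flux_measurable A0_gt0 _ clamped_weak
    iF iu small tphi phi0).
  by move=> al x _; exact: clamped_flux_le.
pose Y x := if x \in S then 0 else flux clamped_flux phi x.
have YS x : S x -> Y x = 0 by move=> Sx; rewrite /Y mem_set.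
have YOS x : (Omega `\` S) x -> Y x = flux clamped_flux phi x.
  by move=> [_ Sx]; rewrite /Y memNset.
have mc : measurable_fun (Omega `\` S) (flux clamped_flux phi).
  by apply: (flux_measurable oO kS) => //; exact: clamped_flux_measurable.
rewrite (@ae_eq_Rintegral _ _ _ mes Omega _ Y)//.
- rewrite (@Rintegral_setD_eq0 _ _ _ _ _ S).
    by apply: eq_Rintegral => x /set_mem; exact: YOS.
  by move=> x _; exact: YS.
- exact: flux_extend_by_zero_measurable.
- rewrite -(setDUK SO); apply/measurable_funU => //; split.
    have m0 : measurable_fun S (fun=> 0 : R) by exact: measurable_cst.
    by apply: eq_measurable_fun m0 => x /set_mem Sx; rewrite YS.
  by apply: eq_measurable_fun mc => x /set_mem Ox; rewrite YOS.
(* [S] may have positive measure, but [w] is 0 there and the growth bound at [z = 0] forces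
   [a al x 0 = 0] for almost every [x]: the flux has no contribution from [S]. *)
- apply: filterS2 (clamped_flux_ae phi) growth_ae => x H1 H2 Ox.
  have [Sx|Sx] := pselect (S x); last by rewrite YOS// H1.
  rewrite YS//; apply: big1 => al _.
  have := H2 al Ox 0; rewrite extend_by_zero_in// normr0 mulr0 normr_le0 => /eqP ->.
  by rewrite mulr0 mul0r.
Qed.

End extension.

Theorem theorem2p3 (R : realType) (m n : nat)
  (m_ge1 : (1 <= m)%N) (n_ge1 : (1 <= n)%N)
  (Omega S : set 'rV[R]_n)
  (Omega_domain : bounded_domain Omega)
  (S_compact : compact S) (S_Omega : S `<=` Omega)
  (a : multi_index n m -> 'rV[R]_n -> R -> R)
  (a_caratheodory : forall al, caratheodory_function Omega (a al))
  (a_growth : exists2 A : R, 0 < A & forall al,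
    {ae mes, forall x, Omega x -> forall z, `|a al x z| <= A * `|z|})
  (f : 'rV[R]_n -> R)
  (f_ge0 : forall x, Omega x -> 0 <= f x)
  (f_measurable : measurable_fun Omega f)
  (g : R -> R)
  (g_admissible : admissible_g g)
  (g_integral :
    (\int[lebesgue_measure]_(z in `[1%R, +oo[) (G_integrand m g z)%:E < +oo)%E)
  (gamma_integral :
    (\int[mes]_(x in Omega `\` S) gamma_of_inv g (f x) < +oo)%E)
  (k : R)
  (k_def : k = n%:R - fine (limf_einf
    (fun r : R => lne (mes (nbhd_of S r `\` S)) * ((ln r)^-1)%:E)%E 0^'+))
  (f_limit : exists2 delta : R, 0 < delta & forall C : R, 0 < C ->
    ((r `^ (n%:R - k - m%:R - delta))%:E *
      G_inv m g ((C * r)%:E *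
        ess_inf_on (nbhd_of S r `\` S) (fun x => (f x `^ m%:R^-1)%R)))%E
      @[r --> 0^'+] --> (0 : R)%:E)
  (u : 'rV[R]_n -> R)
  (u_solution : weak_solution Omega a f g S u) :
  removable Omega a f g S u.
Proof.
have [oO _ _ _] := Omega_domain.
have [A0 A0_gt0 a_le] := a_growth.
have [delta delta0 lim0] := f_limit.
pose F x := f x * g `|u x|.
have uL1 r : 0 < r -> in_L1 (Omega `\` nbhd_of S r) u by move=> /u_solution.1[].
have FL1 r : 0 < r -> in_L1 (Omega `\` nbhd_of S r) F by move=> /u_solution.1[].
have F_ge0 x : Omega x -> 0 <= F x.
  by move=> Ox; rewrite mulr_ge0 ?f_ge0// (admissible_ge0 g_admissible).
have [rho [K [C0 [/andP[rho0 _] rhoO K0 C00 Jle]]]] := outside_bound oO S_compact S_Omega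
  F_ge0 uL1 FL1 (clamped_flux_measurable A0 oO S_compact a_caratheodory u_solution)
  A0_gt0 (fun al x _ => clamped_flux_le a u A0_gt0 al x)
  (clamped_weak oO S_compact a_caratheodory a_le u_solution) m_ge1.
set h := fine _ in k_def.
have vol : \forall r \near 0^'+, (mes (nbhd_of S r `\` S) <= (r `^ (h - delta / 2))%:E)%E.
  apply: (liminf_power_bound (M := fine (mes (nbhd_of S 1)))); first by rewrite divr_gt0.
  near=> r; rewrite measure_ge0 /= fineK; last first.
    by rewrite ge0_fin_numE//; apply: mes_bounded_lty; apply: nbhd_of_bounded;
      exact: compact_bounded.
  apply: le_outer_measure => x [Sx _]; apply: nbhd_of_sub Sx.
  by near: r; exact: nbhs_right_le.
have hE : n%:R - k = h by rewrite k_def opprB addrC subrK.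
rewrite hE in lim0.
have [[M JM] small] := layer_bounds g_admissible m_ge1 g_integral oO S_compact f_ge0 uL1 FL1
  delta0 lim0 vol rho0 rhoO K0 C00 Jle.
exact: (removable_of_bounds g_admissible m_ge1 g_integral oO S_compact S_Omega a_caratheodory
  A0_gt0 a_le u_solution f_ge0 gamma_integral rho0 JM small).
Unshelve. all: by end_near.
Qed.
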